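(* Let $H^3\subset\mathbb{P}(\bigwedge^2\mathbb{C}^5)$ be a general linear subspace of codimension $3$. The automorphism group of $\mathbb{G}(1,4)\cap H^3$ is isomorphic to $\mathbb{P}\mathrm{GL}(2,\mathbb{C})$.
   Context: Everything is over $\mathbb{C}$. $\mathbb{G}(1,4)$ is the Grassmannian of lines in $\mathbb{P}_4=\mathbb{P}(\mathbb{C}^5)$, embedded in $\mathbb{P}(\bigwedge^2\mathbb{C}^5)\cong\mathbb{P}_9$ by the Plücker embedding $\mathrm{span}\{v,w\}\mapsto\mathbb{P}(v\wedge w)$. ''General'' means: for all $H^3$ in some nonempty Zariski open subset of the parameter space of codimension-$3$ linear subspaces. *)

(* Defs.v *)
From HB Require Import structures.
From mathcomp Require Import all_boot all_order all_algebra.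
From mathcomp Require Import boolp classical_sets reals complex mpoly.

Set Implicit Arguments.
Unset Strict Implicit.
Unset Printing Implicit Defensive.

Import GRing.Theory.
Local Open Scope ring_scope.
Local Open Scope classical_set_scope.
Local Open Scope quotient_scope.

Section Grassmannian.
Variable F : fieldType.

Definition grass (k n : nat) := {U : {vspace 'rV[F]_n} | \dim U == k}.

(* P(F^n), a projective space of dimension n - 1; the point P(v) is <[v]>. *)
Definition proj (n : nat) := grass 1 n.

Definition ltn_tuple (k n : nat) (i : 'I_'C(n, k)) : k.-tuple 'I_n :=
  enum_val (cast_ord (esym (card_ltn_sorted_tuples k n)) i).

(* \bigwedge^k F^n is identified with F^'C(n, k) by means of the basis
   e_(t_1) /\ ... /\ e_(t_k), t a strictly increasing k-tuple; in this basis
   the wedge product of the rows of A is the row of its maximal minors. *)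
Definition wedge (k n : nat) (A : 'M[F]_(k, n)) : 'rV[F]_'C(n, k) :=
  \row_i \det (colsub (tnth (ltn_tuple i)) A).

Lemma wedge_mulmx (k n : nat) (M : 'M[F]_k) (A : 'M[F]_(k, n)) :
  wedge (M *m A) = \det M *: wedge A.
Proof.
apply/rowP => i; rewrite !mxE -det_mulmx; congr (\det _).
by apply/matrixP => a b; rewrite !mxE; apply: eq_bigr => j _; rewrite !mxE.
Qed.

(* Pluecker coordinates; by wedge_mulmx, another basis of U would only
   rescale them. *)
Definition plucker (k n : nat) (U : grass k n) : 'rV[F]_'C(n, k) :=
  wedge (\matrix_(i < k) (vbasis (val U))`_i).

Definition plucker_image (k n : nat) : set (proj 'C(n, k)) :=
  [set x | exists U : grass k n, val x = <[plucker U]>%VS].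

Definition linear_section (n k : nat) (X : set (proj n)) (H : grass k n) :
    set (proj n) :=
  [set x | X x /\ (val x <= val H)%VS].

(* The Zariski topology of the Grassmannian as a projective variety: a closed
   set is cut out by homogeneous polynomials in the Pluecker coordinates. *)
Definition zariski_open (k n : nat) (A : set (grass k n)) : Prop :=
  exists S : set {mpoly F['C(n, k)]},
    (forall p, S p -> exists d : nat, p \is d.-homog) /\
    A = [set U | exists2 p, S p & p.@[fun i => plucker U 0 i] != 0].

End Grassmannian.

Section Regular.
Variable F : fieldType.

Definition mpoly_map (m n : nat) (P : 'I_m -> {mpoly F[n]}) (v : 'rV[F]_n) :
    'rV[F]_m :=
  \row_j (P j).@[fun i => v 0 i].

(* Around each point x of X, f is given by homogeneous polynomials of the same
   degree, on the open set where they do not all vanish. *)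
Definition regular (n m : nat) (X : set (proj F n)) (Y : set (proj F m))
    (f : X -> Y) : Prop :=
  forall x : X, exists (d : nat) (P : 'I_m -> {mpoly F[n]}),
    [/\ forall j, P j \is d.-homog,
        mpoly_map P (vpick (val (val x))) != 0 &
        forall y : X, mpoly_map P (vpick (val (val y))) != 0 ->
          val (val (f y)) = <[mpoly_map P (vpick (val (val y)))]>%VS].

Lemma mpoly_mapZ (m n d : nat) (P : 'I_m -> {mpoly F[n]}) (c : F) v :
  (forall j, P j \is d.-homog) ->
  mpoly_map P (c *: v) = c ^+ d *: mpoly_map P v.
Proof.
move=> hP; apply/rowP => j; rewrite !mxE !mevalE mulr_sumr.
rewrite big_seq [RHS]big_seq; apply: eq_bigr => s sP.
rewrite mulrCA; congr (_ * _); have /dhomogP/(_ s sP) <- := hP j.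
rewrite /= mdegE -prodrXr -big_split /=; apply: eq_bigr => i _.
by rewrite mxE exprMn.
Qed.

Lemma dhomog_comp (m n d e : nat) (p : {mpoly F[m]}) (P : m.-tuple {mpoly F[n]}) :
  p \is e.-homog -> (forall i, tnth P i \is d.-homog) ->
  p \mPo P \is (d * e)%N.-homog.
Proof.
move=> /dhomogP hp hP; rewrite comp_mpolyE big_seq rpred_sum // => s sp.
rewrite dhomogZ // -(hp s sp) /= mdegE big_distrr /=.
apply: (big_ind2 (fun (q : {mpoly F[n]}) (k : nat) => q \is k.-homog)).
- exact: dhomog1.
- by move=> *; exact: dhomogM.
- by move=> i _; exact: dhomogMn.
Qed.

Lemma vpick_proj (n : nat) (x : proj F n) :
  vpick (val x) != 0 /\ <[vpick (val x)]>%VS = val x.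
Proof.
have d1 : \dim (val x) = 1%N := eqP (valP x).
have v0 : vpick (val x) != 0 by rewrite vpick0 -dimv_eq0 d1.
by split=> //; apply/eqP; rewrite eqEdim -memvE memv_pick d1 dim_vline v0.
Qed.

Lemma vpick_line (n : nat) (x : proj F n) (v : 'rV[F]_n) :
  val x = <[v]>%VS -> exists2 c, c != 0 & vpick (val x) = c *: v.
Proof.
move=> xv; have [v0 _] := vpick_proj x.
have: vpick (val x) \in <[v]>%VS by rewrite -xv memv_pick.
case/vlineP => c cE; exists c => //; apply: contra_neq v0 => c0.
by rewrite cE c0 scale0r.
Qed.

Lemma vlineZ (n : nat) (c : F) (v : 'rV[F]_n) :
  c != 0 -> <[c *: v]>%VS = <[v]>%VS.
Proof.
move=> c0; apply/eqP; rewrite eqEsubv -!memvE memvZ ?memv_line //=.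
by apply/vlineP; exists c^-1; rewrite scalerA mulVf // scale1r.
Qed.

Lemma regular_id (n : nat) (X : set (proj F n)) : regular (@id X).
Proof.
move=> x; exists 1%N, (fun j => 'X_j).
have pX (v : 'rV[F]_n) : mpoly_map (fun j => 'X_j) v = v.
  by apply/rowP => j; rewrite mxE mevalXU.
split=> [j||y _]; rewrite ?pX.
- by rewrite dhomogX; apply/eqP; exact: mdeg1.
- by have [] := vpick_proj (val x).
- by have [] := vpick_proj (val y).
Qed.

Lemma regular_comp (n m l : nat) (X : set (proj F n)) (Y : set (proj F m))
    (Z : set (proj F l)) (f : X -> Y) (g : Y -> Z) :
  regular f -> regular g -> regular (g \o f).
Proof.
move=> rf rg x; have [d [P [hP Px Pf]]] := rf x.
have [e [Q [hQ Qfx Qg]]] := rg (f x).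
exists (d * e)%N, (fun j => Q j \mPo [tuple P i | i < m]).
have PQ v : mpoly_map (fun j => Q j \mPo [tuple P i | i < m]) v =
            mpoly_map Q (mpoly_map P v).
  apply/rowP => j; rewrite !mxE comp_mpoly_meval.
  by apply: meval_eq => i; rewrite tnth_mktuple mxE.
split=> [j||y]; rewrite ?PQ.
- by apply: dhomog_comp => // i; rewrite tnth_mktuple.
- have [c c0 cE] := vpick_line (Pf x Px).
  by move: Qfx; rewrite cE (mpoly_mapZ _ _ hQ) scaler_eq0 negb_or => /andP[].
- have [->|Py QPy] := eqVneq (mpoly_map P (vpick (val (val y)))) 0.
    have Q0 v : mpoly_map Q 0 = 0 ^+ e *: mpoly_map Q v.
      by rewrite -(mpoly_mapZ _ _ hQ) scale0r.
    rewrite /= [X in X != 0](Q0 (vpick (val (val (f y))))).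
    rewrite scaler_eq0 negb_or expf_eq0 eqxx andbT -eqn0Ngt.
    case/andP => /eqP e0 Qy; rewrite (Qg _ Qy) (Q0 (vpick (val (val (f y))))).
    by rewrite e0 scale1r.
  have [c c0 cE] := vpick_line (Pf y Py).
  rewrite /= Qg cE (mpoly_mapZ _ _ hQ) ?vlineZ ?expf_neq0 //.
  by rewrite scaler_eq0 negb_or expf_neq0.
Qed.

End Regular.

Section AutomorphismGroup.
Variables (F : fieldType) (n : nat) (X : set (proj F n)).

Record autom := Autom {
  autom_fun :> X -> X;
  autom_inv : X -> X;
  autom_funK : cancel autom_fun autom_inv;
  autom_invK : cancel autom_inv autom_fun;
  autom_fun_regular : regular autom_fun;
  autom_inv_regular : regular autom_inv }.

Lemma autom_eqP (f g : autom) : f =1 g -> f = g.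
Proof.
case: f g => [f f' fK f'K rf rf'] [g g' gK g'K rg rg'] /= /funext fg.
have fg' : f' = g' by apply/funext => x; rewrite -[x in LHS]g'K -fg fK.
case: _ / fg in gK g'K rg *; case: _ / fg' in gK g'K rg' *.
by congr Autom; exact: Prop_irrelevance.
Qed.

HB.instance Definition _ := gen_eqMixin autom.
HB.instance Definition _ := gen_choiceMixin autom.

Definition autom_one : autom :=
  @Autom id id (fun=> erefl) (fun=> erefl) (@regular_id F n X) (@regular_id F n X).

Definition autom_opp (f : autom) : autom :=
  Autom (autom_invK f) (autom_funK f) (autom_inv_regular f)
    (autom_fun_regular f).

Definition autom_comp (f g : autom) : autom :=
  Autom (can_comp (autom_funK f) (autom_funK g))
    (can_comp (autom_invK g) (autom_invK f))
    (regular_comp (autom_fun_regular g) (autom_fun_regular f))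
    (regular_comp (autom_inv_regular f) (autom_inv_regular g)).

Fact autom_compA : associative autom_comp.
Proof. by move=> f g h; exact: autom_eqP. Qed.
Fact autom_comp1f : left_id autom_one autom_comp.
Proof. by move=> f; exact: autom_eqP. Qed.
Fact autom_compf1 : right_id autom_one autom_comp.
Proof. by move=> f; exact: autom_eqP. Qed.
Fact autom_compVf : left_inverse autom_one autom_opp autom_comp.
Proof. by move=> f; apply: autom_eqP => x; exact: autom_funK. Qed.
Fact autom_compfV : right_inverse autom_one autom_opp autom_comp.
Proof. by move=> f; apply: autom_eqP => x; exact: autom_invK. Qed.

HB.instance Definition _ := isGroup.Build autom
  autom_compA autom_comp1f autom_compf1 autom_compVf autom_compfV.

End AutomorphismGroup.

Section GeneralLinearGroup.
Variables (n : nat) (F : fieldType).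

Record GL := MkGL { GL_mx :> 'M[F]_n; GL_unit : GL_mx \in unitmx }.
HB.instance Definition _ := [isSub for GL_mx].
HB.instance Definition _ := [Choice of GL by <:].

Fact GL_mul_subproof (A B : GL) : A *m B \in unitmx.
Proof. by rewrite unitmx_mul !GL_unit. Qed.
Fact GL_inv_subproof (A : GL) : invmx A \in unitmx.
Proof. by rewrite unitmx_inv GL_unit. Qed.

Definition GL_one := MkGL (unitmx1 F n).
Definition GL_mul (A B : GL) := MkGL (GL_mul_subproof A B).
Definition GL_inv (A : GL) := MkGL (GL_inv_subproof A).

Fact GL_mulA : associative GL_mul.
Proof. by move=> A B C; apply: val_inj; exact: mulmxA. Qed.
Fact GL_mul1 : left_id GL_one GL_mul.
Proof. by move=> A; apply: val_inj; exact: mul1mx. Qed.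
Fact GL_mulr1 : right_id GL_one GL_mul.
Proof. by move=> A; apply: val_inj; exact: mulmx1. Qed.
Fact GL_mulV : left_inverse GL_one GL_inv GL_mul.
Proof. by move=> A; apply: val_inj; apply: mulVmx; exact: GL_unit. Qed.
Fact GL_mulrV : right_inverse GL_one GL_inv GL_mul.
Proof. by move=> A; apply: val_inj; apply: mulmxV; exact: GL_unit. Qed.

HB.instance Definition _ := isGroup.Build GL
  GL_mulA GL_mul1 GL_mulr1 GL_mulV GL_mulrV.

Definition GL_scalar_eq (A B : GL) : bool := is_scalar_mx (A^-1 * B)%g.

Lemma GL_scalar_eqP (A B : GL) :
  reflect (exists c : F, GL_mx B = c *: GL_mx A) (GL_scalar_eq A B).
Proof.
apply: (iffP is_scalar_mxP) => -[c cE]; exists c.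
  by rewrite -mul_mx_scalar -cE /= mulKVmx ?GL_unit.
by rewrite /= cE -scalemxAr mulVmx ?GL_unit // scalemx1.
Qed.

Fact GL_scalar_eq_refl : reflexive GL_scalar_eq.
Proof. by move=> A; apply/GL_scalar_eqP; exists 1; rewrite scale1r. Qed.
Fact GL_scalar_eq_sym : ssrbool.symmetric GL_scalar_eq.
Proof.
suff H A B : GL_scalar_eq A B -> GL_scalar_eq B A by move=> A B; apply/idP/idP => /H.
case/GL_scalar_eqP=> c cE; apply/GL_scalar_eqP.
have [c0|c0] := eqVneq c 0; last by exists c^-1; rewrite cE scalerA mulVf ?scale1r.
exists 1; rewrite scale1r; have := GL_unit B.
have [n0|n0] := posnP n.
  by move=> _; apply/matrixP => i; have := ltn_ord i; rewrite [X in (_ < X)%N]n0.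
rewrite cE c0 scale0r => /mulmxV; rewrite mul0mx => /matrixP /(_ (Ordinal n0)).
by move/(_ (Ordinal n0)); rewrite !mxE eqxx => /eqP; rewrite eq_sym oner_eq0.
Qed.
Fact GL_scalar_eq_trans : transitive GL_scalar_eq.
Proof.
move=> B A C /GL_scalar_eqP[c cE] /GL_scalar_eqP[d dE]; apply/GL_scalar_eqP.
by exists (d * c); rewrite dE cE scalerA.
Qed.

Canonical GL_scalar_equiv :=
  EquivRel GL_scalar_eq GL_scalar_eq_refl GL_scalar_eq_sym GL_scalar_eq_trans.

Definition PGL := {eq_quot GL_scalar_equiv}.
HB.instance Definition _ : EqQuotient _ GL_scalar_equiv PGL :=
  EqQuotient.on PGL.
HB.instance Definition _ := Choice.on PGL.

Definition PGL_one : PGL := \pi_PGL (1%g : GL).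
Definition PGL_mul (x y : PGL) : PGL := \pi_PGL (repr x * repr y)%g.
Definition PGL_inv (x : PGL) : PGL := \pi_PGL ((repr x)^-1)%g.

Lemma pi_PGL_eqP (A B : GL) :
  reflect (exists c : F, GL_mx B = c *: GL_mx A) (\pi_PGL A == \pi_PGL B).
Proof. by rewrite piE; exact: GL_scalar_eqP. Qed.

Lemma PGL_mulE (A B : GL) : PGL_mul (\pi_PGL A) (\pi_PGL B) = \pi_PGL (A * B)%g.
Proof.
apply/eqP/pi_PGL_eqP.
have /eqP/pi_PGL_eqP[c cE] := reprK (\pi_PGL A).
have /eqP/pi_PGL_eqP[d dE] := reprK (\pi_PGL B).
by exists (c * d); rewrite /= cE dE -scalemxAl -scalemxAr scalerA.
Qed.

Lemma PGL_piP (x : PGL) : exists A : GL, x = \pi_PGL A.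
Proof. by exists (repr x); rewrite reprK. Qed.

Fact PGL_mulA : associative PGL_mul.
Proof.
move=> x y z; have [A ->] := PGL_piP x.
have [B ->] := PGL_piP y; have [C ->] := PGL_piP z.
rewrite (PGL_mulE B C) (PGL_mulE A B).
by rewrite (PGL_mulE A (B * C)%g) (PGL_mulE (A * B)%g C) mulgA.
Qed.
Fact PGL_mul1 : left_id PGL_one PGL_mul.
Proof. by move=> x; have [A ->] := PGL_piP x; rewrite PGL_mulE mul1g. Qed.
Fact PGL_mulr1 : right_id PGL_one PGL_mul.
Proof. by move=> x; have [A ->] := PGL_piP x; rewrite PGL_mulE mulg1. Qed.
Fact PGL_mulV : left_inverse PGL_one PGL_inv PGL_mul.
Proof. by move=> x; rewrite -[x in PGL_mul _ x]reprK PGL_mulE mulVg. Qed.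
Fact PGL_mulrV : right_inverse PGL_one PGL_inv PGL_mul.
Proof. by move=> x; rewrite -[x in PGL_mul x _]reprK PGL_mulE mulgV. Qed.

HB.instance Definition _ := isGroup.Build PGL
  PGL_mulA PGL_mul1 PGL_mulr1 PGL_mulV PGL_mulrV.

End GeneralLinearGroup.

Definition isomorphic (G H : groupType) : Prop :=
  exists2 f : G -> H, {morph f : x y / (x * y)%g} & bijective f.

(* Main.v *)
Require Import Defs.
From HB Require Import structures.
From mathcomp Require Import all_boot all_order all_algebra perm.
From mathcomp Require Import boolp classical_sets reals complex mpoly.
From mathcomp Require Import ring zify.

(* The lines meeting the codimension 3 condition are described by a net of
   alternating forms on C^5. The vectors of 4 x 4 Pfaffians of the forms of the net
   give Sym^2 C^3 -> C^5, whose kernel is spanned by a conic on the net; when this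
   conic is smooth, expressing the forms in the basis of C^5 provided by their
   Pfaffian vectors brings the net to a single normal form. So the general section
   is the quintic threefold of binary sextics f with (f, f)_4 = 0, on which PGL_2
   acts.

   Conversely, let an automorphism be given. The complement of the hyperplane
   section x_0 = 0 is an affine space, so by unique factorization in K[a, b, c] the
   automorphism is given there by one tuple of polynomials without common factor.
   Homogenizing it, and dividing by x_0 as long as all the entries vanish on
   x_0 = 0, one gets forms of a degree k on the cone without common zero. For the
   inverse one gets similarly a degree k', and comparing the composition with the
   identity yields k k' = 1: the automorphism is linear. It preserves the rational
   normal sextic of the points lying on a single line of the threefold, hence comes
   from PGL_2. *)

Set Implicit Arguments.
Unset Strict Implicit.
Unset Printing Implicit Defensive.
Import GRing.Theory Num.Theory.
Local Open Scope ring_scope.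

(** Linearity of an automorphism usually rests on the Picard group. Here two properties of the
    section x_0 = 0, cut out by the osculating hyperplane of the rational normal sextic at [e6],
    take its place. Its complement is an affine 3-space, whose ring K[a, b, c] is factorial with
    constant units; and a form that vanishes on it is a multiple of x_0 on the cone. The second
    property is the delicate one. Modulo x_0 every polynomial is a combination of 1, x_2, x_3, x_4,
    x_2 x_4 over K[x_1, x_5, x_6]; on the section, with x_1 nonzero and x_5 fixed, these monomials
    are multiples of 1, v, ..., v^4 for a parameter v, while x_6 is a polynomial of degree 5 in v,
    so that no nontrivial combination vanishes. Coordinate rings are never formed: polynomials are
    compared through their values on the cone, and maps up to nonzero scalars depending on the
    point. For the open set, one homogeneous polynomial on one chart of the Grassmannian is enough:
    the determinant of the conic with two pivot factors. The normal form itself supplies a subspace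
    where it is nonzero. *)

Local Notation co x k := (x 0 (inord k)) (only parsing).

(** * Factorial rings *)

Section Factorial.
Variable R : idomainType.
Implicit Types (a b c p : R) (s : seq R).

Definition divides a b := exists c, b = c * a.

Definition prime_elt p :=
  [/\ p != 0, p \isn't a GRing.unit &
      forall a b, divides p (a * b) -> divides p a \/ divides p b].

Definition prime_seq s := forall p, p \in s -> prime_elt p.

Definition factorial_ring :=
  forall a, a != 0 ->
  exists s u, [/\ prime_seq s, u \is a GRing.unit & a = u * \prod_(p <- s) p].

Lemma divides_mull a b c : divides a b -> divides a (c * b).
Proof. by case=> d ->; exists (c * d); rewrite mulrA. Qed.

Lemma divides_mulr a b c : divides a b -> divides a (b * c).
Proof. by rewrite mulrC; exact: divides_mull. Qed.

Lemma divides_add a b c : divides a b -> divides a c -> divides a (b + c).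
Proof. by case=> d -> [e ->]; exists (d + e); rewrite mulrDl. Qed.

(** The primes of [s] are split off one at a time: each divides b c for some admissible c that it
    does not divide, hence divides b and can be cancelled. No gcd is involved. *)
Lemma divides_prod_primes s b (P : R -> Prop) :
  prime_seq s ->
  (forall p, p \in s -> exists2 c, P c & ~ divides p c) ->
  (forall c, P c -> divides (\prod_(p <- s) p) (b * c)) ->
  divides (\prod_(p <- s) p) b.
Proof.
elim: s b => [|p s IH] b ps sP bP; first by exists b; rewrite big_nil mulr1.
have [p0 pU pp] := ps p (mem_head _ _).
have [d Pd pd] := sP p (mem_head _ _).
have pb : divides p b.
  have [e eE] := bP d Pd.
  have /pp[//|/pd//] : divides p (b * d).
  by rewrite eE big_cons; exists (e * \prod_(j <- s) j); ring.
have [b' b'E] := pb.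
have [||c Pc|d' d'E] := IH b'.
- by move=> q qs; apply: ps; rewrite inE qs orbT.
- by move=> q qs; apply: sP; rewrite inE qs orbT.
- have [e eE] := bP c Pc; exists e; apply: (mulfI p0).
  transitivity (b * c); first by rewrite b'E; ring.
  by rewrite eE big_cons; ring.
by exists d'; rewrite b'E d'E big_cons; ring.
Qed.

(* Take for P the tuple Q divided by its greatest common divisor. *)
Lemma factorial_proportional (I : finType) (Q : I -> R) (i0 : I) :
  factorial_ring -> Q i0 != 0 ->
  exists (g : R) (P : I -> R), [/\ g != 0, forall i, Q i = g * P i &
    forall Q', (forall i j, Q' i * P j = Q' j * P i) ->
      exists h, forall i, Q' i = h * P i].
Proof.
move=> fR Q0; have [s [u [ps uU QE]]] := fR _ Q0.
elim: {s}(size s) {-2}s (erefl (size s)) ps Q u uU QE Q0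
  => [|n IH] s ss ps Q u uU QE Q0.
  exists 1, Q; split=> [|i|Q' Q'E]; rewrite ?oner_eq0 ?mul1r //.
  move: QE; rewrite (size0nil ss) big_nil mulr1 => QE.
  by exists (Q' i0 / Q i0) => i; rewrite mulrAC -Q'E mulrK // QE.
(* The induction is on the number of primes of [Q i0]: a prime common to all the entries is moved
   into g. *)
have [[p ps' pQ]|nQ] := pselect (exists2 p, p \in s & forall i, divides p (Q i)).
  have [p0 _ _] := ps p ps'.
  pose Q1 i := sval (cid (pQ i)).
  have Q1E i : Q i = Q1 i * p by rewrite /Q1; case: cid.
  have Q1i0 : Q1 i0 = u * \prod_(q <- rem p s) q.
    apply: (mulIf p0); rewrite -Q1E QE (perm_big _ (perm_to_rem ps')) big_cons /=.
    by ring.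
  have [|||g [P [g0 PE hP]]] := IH (rem p s) _ _ Q1 u uU Q1i0.
  - by rewrite size_rem // ss.
  - by move=> q /mem_rem; exact: ps.
  - by move: Q0; rewrite Q1E mulf_eq0 negb_or => /andP[].
  exists (g * p), P; split=> [|i|//]; first by rewrite mulf_neq0.
  by rewrite Q1E PE; ring.
exists 1, Q; split=> [|i|Q' Q'E]; rewrite ?oner_eq0 ?mul1r //.
(* [Q i0] divides every product of [Q' i0] with some [Q i], and each of its primes fails to divide
   some [Q i]; so it divides [Q' i0]. *)
have [||d dE] := @divides_prod_primes s (Q' i0) (fun c => exists i, c = Q i) ps.
- move=> p pin; apply: contrapT => np; apply: nQ; exists p => // i.
  by apply: contrapT => npi; apply: np; exists (Q i); first by exists i.
- move=> _ [i ->]; rewrite Q'E QE; exists (Q' i * u).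
  by ring.
exists (d / u) => i; apply: (mulIf Q0); rewrite Q'E dE QE.
by rewrite [RHS]mulrAC; congr (_ * _); rewrite mulrA divrK // mulrC.
Qed.

End Factorial.

Lemma field_factorial (F : fieldType) : factorial_ring F.
Proof.
move=> a a0; exists [::], a; split=> //; first by rewrite unitfE.
by rewrite big_nil mulr1.
Qed.

(** * Gauss' lemma: polynomials over a factorial ring *)

Section PolyFactorial.
Variable R : idomainType.
Hypothesis fR : factorial_ring R.
Implicit Types (f g h : {poly R}).

Lemma divides_polyC (p : R) f : divides p%:P f <-> forall i, divides p f`_i.
Proof.
split=> [[g ->] i|pf]; first by exists g`_i; rewrite coefMC.
exists (\poly_(i < size f) sval (cid (pf i))); apply/polyP => i.
rewrite coefMC coef_poly; case: ltnP => [_|fi]; first by case: cid.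
by rewrite mul0r nth_default.
Qed.

(** If p divides neither f nor g, take the lowest coefficients of f and g not divisible by p, in
    degrees i and j: all the other terms of the coefficient of degree i + j of f g are divisible by
    p. *)
Lemma prime_polyC (p : R) : prime_elt p -> prime_elt p%:P.
Proof.
case=> p0 pU pp; split=> [||f g pfg].
- by rewrite polyC_eq0.
- by apply: contra pU; rewrite poly_unitE coefC eqxx => /andP[].
apply: contrapT => /not_orP[/divides_polyC/existsNP nf /divides_polyC/existsNP ng].
have minP h : (exists i, ~ divides p h`_i) ->
    exists i, ~ divides p h`_i /\ forall j, (j < i)%N -> divides p h`_j.
  case=> i ni; have exi : exists i, `[< ~ divides p h`_i >] by exists i; apply/asboolP.
  have [k /asboolP nk kmin] := ex_minnP exi; exists k; split=> // j jk.
  apply: contrapT => nj; have /kmin : `[< ~ divides p h`_j >] by apply/asboolP.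
  by rewrite leqNgt jk.
have [i [ni mi]] := minP f nf; have [j [nj mj]] := minP g ng.
have := (divides_polyC p (f * g)).1 pfg (i + j)%N.
rewrite coefM (bigD1 (inord i)) //= inordK ?ltnS ?leq_addr // addKn => pS.
suff /pp[] : divides p (f`_i * g`_j) by [].
have [c cE] := pS.
have: divides p (\sum_(k < (i + j).+1 | k != inord i) f`_k * g`_(i + j - k)).
  apply: (big_ind (divides p)) => [|x y|k ki]; first by exists 0; rewrite mul0r.
    exact: divides_add.
  have [kli|] := ltnP k i; first by apply: divides_mulr; exact: mi.
  rewrite leq_eqVlt => /orP[/eqP ik|ik].
    by case/eqP: ki; apply: val_inj; rewrite /= inordK ?ltnS ?leq_addr.
  by apply: divides_mull; apply: mj; rewrite ltn_subLR ?ltn_add2r // -ltnS.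
case=> d dE; exists (c - d); rewrite mulrBl -cE dE; ring.
Qed.

Definition primitive f := forall p, prime_elt p -> ~ divides p%:P f.

(** A prime constant dividing f divides its leading coefficient, so the number of primes of the
    latter bounds how many can be extracted. *)
Lemma primitive_decomp f : f != 0 ->
  exists c f0, [/\ c != 0, f = c%:P * f0 & primitive f0].
Proof.
move=> f0; have [s [u [ps uU lE]]] := fR (etrans (congr1 negb (lead_coef_eq0 f)) f0).
elim: {s}(size s) {-2}s (erefl (size s)) ps f f0 u uU lE
  => [|n IH] s ss ps f f0 u uU lE.
  exists 1, f; split; rewrite ?oner_eq0 ?mul1r // => p [_ pU _] /divides_polyC.
  move/(_ (size f).-1); rewrite -/(lead_coef f) lE (size0nil ss) big_nil mulr1.
  by case=> c cE; move: uU; rewrite cE unitrM (negPf pU) andbF.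
have [[p [ps' pf]]|nf] := pselect (exists p, prime_elt p /\ divides p%:P f).
  have [f1 f1E] := pf; have [p0 pU pp] := ps'.
  have: divides p (u * \prod_(q <- s) q).
    by rewrite -lE; apply: ((divides_polyC p f).1 pf).
  case/pp => [[c cE]|].
    by move: uU; rewrite cE unitrM (negPf pU) andbF.
  have exq : forall t, prime_seq t -> divides p (\prod_(q <- t) q) ->
      exists2 q, q \in t & divides p q.
    elim=> [|q t IHt] pt; rewrite ?big_nil ?big_cons.
      by case=> c cE; move: (unitr1 R); rewrite cE unitrM (negPf pU) andbF.
    case/pp => [pq|]; first by exists q; rewrite ?mem_head.
    case/IHt => [r rt|r rt pr]; first by apply: pt; rewrite inE rt orbT.
    by exists r; rewrite // inE rt orbT.
  (* The primes p and q are associated: v is a unit. So the leading coefficient of f1 has the primes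
     of [s] with q removed. *)
  case/(exq _ ps) => q qs [v vE].
  have [q0 qU qq] := ps q qs.
  have vU : v \is a GRing.unit.
    have [|[c cE]|[c cE]] := qq v p; first by exists 1; rewrite mul1r vE.
      have: 1 * q = c * p * q by rewrite mul1r {1}vE cE; ring.
      by move/(mulIf q0) => E; move: (unitr1 R); rewrite E unitrM (negPf pU) andbF.
    have: 1 * q = v * c * q by rewrite mul1r {1}vE cE; ring.
    by move/(mulIf q0) => E; move: (unitr1 R); rewrite E unitrM => /andP[].
  have f10 : f1 != 0 by move: f0; rewrite f1E mulf_eq0 negb_or => /andP[].
  have l1 : lead_coef f1 = (u * v) * \prod_(q <- rem q s) q.
    apply: (mulIf p0); rewrite -[X in _ * X = _](lead_coefC p) -lead_coefM -f1E lE.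
    by rewrite (perm_big _ (perm_to_rem qs)) big_cons vE /=; ring.
  have [|||c [g [c0 gE gP]]] := IH (rem q s) _ _ f1 f10 (u * v) _ l1.
  - by rewrite size_rem // ss.
  - by move=> r /mem_rem; exact: ps.
  - by rewrite unitrM uU.
  by exists (c * p), g; split; rewrite ?mulf_neq0 // f1E gE polyCM; ring.
exists 1, f; split; rewrite ?oner_eq0 ?mul1r // => p pp pf; apply: nf.
by exists p.
Qed.

(** Write c f = w d. A prime of c divides w d but not the primitive d; by [prime_polyC] it divides w
    and is cancelled. *)
Lemma primitive_divides d f (c : R) :
  primitive d -> c != 0 -> divides d (c%:P * f) -> divides d f.
Proof.
move=> dP /fR[s [u [ps uU ->]]].
elim: s ps => [|p s IH] ps [w].
  rewrite big_nil mulr1 => E; exists ((u^-1)%:P * w).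
  by rewrite -mulrA -E mulrA -polyCM mulVr ?mul1r.
rewrite big_cons => E; have pp := ps p (mem_head _ _).
have [p0 _ pw] := prime_polyC pp.
have /pw[[w' w'E]|/dP] : divides p%:P (w * d).
- by rewrite -E !polyCM; exists (u%:P * (\prod_(j <- s) j)%:P * f); ring.
- apply: IH => [q qs|]; first by apply: ps; rewrite inE qs orbT.
  exists w'; apply: (mulIf p0).
  transitivity (w * d); last by rewrite w'E; ring.
  by rewrite -E !polyCM; ring.
- by [].
Qed.

Lemma primitive_unit f : primitive f -> (size f <= 1)%N -> f != 0 ->
  f \is a GRing.unit.
Proof.
move=> fP /size1_polyC fE f0; move: f0 fP; rewrite fE polyC_eq0 => c0 cP.
have [[|p s] [u [ps uU cE]]] := fR c0.
  by rewrite poly_unitE coefC eqxx size_polyC c0 cE big_nil mulr1.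
case: (cP p); first by apply: ps; rewrite mem_head.
by exists (u%:P * (\prod_(j <- s) j)%:P); rewrite {1}cE big_cons !polyCM; ring.
Qed.

(* In the ideal (f, g), an element d of least degree divides nonzero constant
   multiples of f and of g; by Gauss' lemma so does its primitive part. *)
Lemma primitive_prime f : primitive f -> (1 < size f)%N ->
  (forall g h, f = g * h -> (size g <= 1)%N \/ (size h <= 1)%N) -> prime_elt f.
Proof.
move=> fP f1 firr; have f0 : f != 0 by rewrite -size_poly_gt0 ltnW.
split=> // [|g h fgh]; first by rewrite poly_unitE (gtn_eqF f1).
pose J d := exists u v, d = u * f + v * g.
have Jf : J f by exists 1, 0; ring.
have exd : exists n, `[< exists d, [/\ d != 0, J d & size d = n] >].
  by exists (size f); apply/asboolP; exists f.
case: (ex_minnP exd) => n /asboolP[d [d0 Jd dn]] nmin.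
have dJ e : J e -> exists2 c, c != 0 & divides d (c%:P * e).
  move=> Je; exists (lead_coef d ^+ scalp e d).
    by rewrite expf_neq0 // lead_coef_eq0.
  have E := Pdiv.Idomain.divp_eq e d.
  have E' : (lead_coef d ^+ scalp e d)%:P * e = e %/ d * d + e %% d.
    by rewrite mul_polyC.
  have Jr : J (e %% d).
    have -> : e %% d = (lead_coef d ^+ scalp e d)%:P * e - e %/ d * d.
      by rewrite E'; ring.
    case: Je Jd => u [v ->] [u' [v' ->]].
    set c := (_ ^+ _)%:P; set q := (_ %/ _).
    by exists (c * u - q * u'), (c * v - q * v'); ring.
  have r0 : e %% d = 0.
    apply/eqP; apply: contraT => r0; have /nmin : `[< exists d', [/\ d' != 0, J d' & size d' = size (e %% d)] >].
      by apply/asboolP; exists (e %% d).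
    by rewrite leqNgt -dn ltn_modp d0.
  by exists (e %/ d); move: E'; rewrite r0 addr0.
have [e [d1 [e0 dE d1P]]] := primitive_decomp d0.
have d1J t : J t -> divides d1 t.
  move/dJ => [c c0 [w wE]]; apply: (primitive_divides d1P c0).
  by rewrite wE dE; exists (w * e%:P); ring.
have [w wE] := d1J _ Jf.
have Jg : J g by exists 0, 1; ring.
have [w1|d11] := firr _ _ wE.
  left; have wU : w \is a GRing.unit.
    apply: primitive_unit => //.
      by move=> p pp [v vE]; case: (fP p pp); rewrite wE vE; exists (v * d1); ring.
    by move: f0; rewrite wE mulf_eq0 negb_or => /andP[].
  have [v ->] := d1J _ Jg.
  by exists (v * w^-1); rewrite wE mulrA divrK.
have [c d1c] : exists c, d1 = c%:P by exists d1`_0; exact: size1_polyC.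
right; have ed0 : e * c != 0 by rewrite -polyC_eq0 polyCM -d1c -dE.
apply: (primitive_divides fP ed0).
have -> : (e * c)%:P = d by rewrite polyCM -d1c.
case: Jd fgh => u [v ->] [k kE]; exists (u * h + v * k).
by rewrite !mulrDl -[v * g * h]mulrA kE; ring.
Qed.

Lemma factorial_mul f g :
  (exists s u, [/\ prime_seq s, u \is a GRing.unit & f = u * \prod_(p <- s) p]) ->
  (exists s u, [/\ prime_seq s, u \is a GRing.unit & g = u * \prod_(p <- s) p]) ->
  exists s u, [/\ prime_seq s, u \is a GRing.unit & f * g = u * \prod_(p <- s) p].
Proof.
move=> [s [u [ps uU ->]]] [t [v [pt vU ->]]]; exists (s ++ t), (u * v).
split; rewrite ?unitrM ?uU ?vU // ?big_cat /=; last by ring.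
by move=> p; rewrite mem_cat => /orP[/ps|/pt].
Qed.

(** Induction on the size. The content is factored in R; the primitive part is a unit, or has no
    factorization into nonconstant factors and is prime by [primitive_prime], or splits into two
    factors of smaller size. *)
Lemma poly_factorial : factorial_ring {poly R}.
Proof.
move=> f; have [n] := ubnP (size f); elim: n f => // n IH f fn f0.
have [c [g [c0 fE gP]]] := primitive_decomp f0.
have g0 : g != 0 by move: f0; rewrite fE mulf_eq0 negb_or => /andP[].
have sg : size g = size f by rewrite fE size_Cmul.
rewrite fE; apply: factorial_mul.
  have [s [u [ps uU ->]]] := fR c0; exists [seq p%:P | p <- s], u%:P; split.
  - by move=> _ /mapP[p ps' ->]; apply: prime_polyC; exact: ps.
  - by rewrite poly_unitE coefC eqxx size_polyC uU andbT; have -> : u != 0 by apply: contraTneq uU => ->; rewrite unitr0.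
  - by rewrite polyCM rmorph_prod big_map.
have [g1|g1] := leqP (size g) 1.
  by exists [::], g; split; rewrite ?big_nil ?mulr1 //; exact: primitive_unit.
have [irr|nirr] := pselect (forall a b, g = a * b -> (size a <= 1)%N \/ (size b <= 1)%N).
  exists [:: g], 1; split; rewrite ?unitr1 ?big_seq1 ?mul1r // => p.
  by rewrite inE => /eqP ->; exact: primitive_prime.
have {nirr}[a [b [gE a1 b1]]] : exists a b, [/\ g = a * b, (1 < size a)%N & (1 < size b)%N].
  apply: contrapT => ne; apply: nirr => a b gE; apply: contrapT => /not_orP[].
  by move/negP; rewrite -ltnNge => a1 /negP; rewrite -ltnNge => b1; apply: ne; exists a, b.
have a0 : a != 0 by rewrite -size_poly_gt0 ltnW.
have b0 : b != 0 by rewrite -size_poly_gt0 ltnW.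
have := size_mul a0 b0; rewrite -gE sg => fab.
rewrite gE; apply: factorial_mul; apply: IH => //.
- by rewrite -ltnS (leq_trans _ fn) // ltnS fab; case: (size b) b1 => [|[|k]] // _; rewrite !addnS /= ltnS leq_addr.
- by rewrite -ltnS (leq_trans _ fn) // ltnS fab; case: (size a) a1 => [|[|k]] // _; rewrite !addSn /= ltnS leq_addl.
Qed.

End PolyFactorial.

(** * Evaluation and substitution of polynomials *)

Definition vec7 (K : nzRingType) (s : seq K) : 'rV[K]_7 := \row_i s`_i.

Lemma co_vec7 (K : nzRingType) (s : seq K) k : (k < 7)%N -> co (vec7 s) k = s`_k.
Proof. by move=> k7; rewrite mxE inordK. Qed.

Definition coords (K : nzRingType) (x : 'rV[K]_7) :=
  [:: co x 0; co x 1; co x 2; co x 3; co x 4; co x 5; co x 6].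

Lemma vec7P (K : nzRingType) (x : 'rV[K]_7) : x = vec7 (coords x).
Proof.
apply/rowP => -[[|[|[|[|[|[|[|//]]]]]]] h]; rewrite mxE /=; congr (x 0 _);
  by apply: val_inj; rewrite /= inordK.
Qed.

(** The evaluation points are natural numbers because these stay available as constants in iterated
    polynomial rings, so that several variables can be specialized one after the other. *)
Lemma horner_nat_neq0 (R : idomainType) (p : {poly R}) :
  (forall n, n.+1%:R != 0 :> R) -> p != 0 -> exists n : nat, p.[n%:R] != 0.
Proof.
move=> char0 p0; apply: contrapT => np.
pose rs : seq R := [seq i%:R | i <- iota 0 (size p)].
have natI (i j : nat) : (i < j)%N -> i%:R != j%:R :> R.
  move=> ij; rewrite eq_sym -subr_eq0 -natrB ?(ltnW ij) //.
  by case: (j - i)%N (subn_gt0 i j) => [|k]; rewrite ?ij.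
have := @max_poly_roots _ p rs p0; rewrite size_map size_iota ltnn => H.
suff: false by []; apply: H.
  apply/allP => _ /mapP[i _ ->]; rewrite rootE; apply: contrapT => pi.
  by apply: np; exists i; apply/negP.
rewrite map_inj_uniq ?iota_uniq // => i j ij.
by case: (ltngtP i j) => // /natI; rewrite ij eqxx.
Qed.

Lemma poly_nat_neq0 (R : nzRingType) :
  (forall n, n.+1%:R != 0 :> R) -> forall n, n.+1%:R != 0 :> {poly R}.
Proof. by move=> R0 n; rewrite -polyC_natr polyC_eq0. Qed.

Section Substitution.
Variable K : numClosedFieldType.

Definition ev7 (x : 'rV[K]_7) (p : {mpoly K[7]}) : K := p.@[fun i => x 0 i].
HB.instance Definition _ x := GRing.RMorphism.copy (ev7 x) (meval (fun i => x 0 i)).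

Lemma ev7X x k : ev7 x 'X_k = x 0 k.
Proof. exact: mevalXU. Qed.

Lemma ev7Z x c p : ev7 x (c *: p) = c * ev7 x p.
Proof. exact: mevalZ. Qed.

Lemma ev7D x p q : ev7 x (p + q) = ev7 x p + ev7 x q.
Proof. exact: rmorphD. Qed.

Lemma ev7N x p : ev7 x (- p) = - ev7 x p.
Proof. exact: rmorphN. Qed.

Lemma ev7M x p q : ev7 x (p * q) = ev7 x p * ev7 x q.
Proof. exact: rmorphM. Qed.

Lemma ev7_0 x : ev7 x 0 = 0.
Proof. exact: rmorph0. Qed.

Definition ev7E := (ev7_0, ev7D, ev7N, ev7M, ev7Z, ev7X).

Lemma ev7_homog (d : nat) p c x : p \is d.-homog -> ev7 (c *: x) p = c ^+ d * ev7 x p.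
Proof.
move=> hp; have := @mpoly_mapZ K 1 7 d (fun=> p) c x (fun=> hp).
by move/rowP/(_ 0); rewrite !mxE.
Qed.

Definition subst7 (S : comNzRingType) (i : {rmorphism K -> S}) (s : seq S) :
  {mpoly K[7]} -> S := mmap i (fun j : 'I_7 => s`_j).

Lemma subst7E (S : comNzRingType) (i : {rmorphism K -> S}) (e : {rmorphism S -> K}) s p :
  cancel i e -> e (subst7 i s p) = ev7 (vec7 (map e s)) p.
Proof.
move=> ie; rewrite /subst7 /mmap rmorph_sum /ev7 mevalE; apply: eq_bigr => m _.
rewrite rmorphM ie; congr (_ * _); rewrite rmorph_prod; apply: eq_bigr => j _.
rewrite rmorphXn mxE; congr (_ ^+ _); have [js|js] := ltnP j (size s).
  by rewrite (nth_map 0).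
by rewrite !nth_default ?rmorph0 ?size_map.
Qed.

(** Nested univariate polynomials, so that [poly_factorial] applies three times; the outermost
    variable is [tC]. *)
Definition T := {poly {poly {poly K}}}.
Definition constT : {rmorphism K -> T} := polyC \o polyC \o polyC.
Definition evT (a b c : K) : {rmorphism T -> K} :=
  horner_eval a \o horner_eval b%:P \o horner_eval c%:P%:P.
Definition tA : T := 'X%:P%:P.
Definition tB : T := 'X%:P.
Definition tC : T := 'X.

Lemma constTK a b c : cancel constT (evT a b c).
Proof. by move=> x; rewrite /evT /constT /= /horner_eval !hornerC. Qed.

Lemma evTA a b c : evT a b c tA = a.
Proof. by rewrite /evT /= /horner_eval !hornerC hornerX. Qed.
Lemma evTB a b c : evT a b c tB = b.
Proof. by rewrite /evT /= /horner_eval !hornerC hornerX hornerC. Qed.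
Lemma evTC a b c : evT a b c tC = c.
Proof. by rewrite /evT /= /horner_eval !hornerX !hornerC. Qed.

Lemma evTM a b c F G : evT a b c (F * G) = evT a b c F * evT a b c G.
Proof. exact: rmorphM. Qed.

Lemma natK_neq0 n : n.+1%:R != 0 :> K.
Proof. by rewrite pnatr_eq0. Qed.

Lemma evT_eq0 (F : T) : (forall a b c, evT a b c F = 0) -> F = 0.
Proof.
move=> F0; apply/eqP; apply: contraT => /horner_nat_neq0.
case=> [|c /horner_nat_neq0]; first by do 2![apply: poly_nat_neq0]; exact: natK_neq0.
case=> [|b /horner_nat_neq0[|a]]; first by apply: poly_nat_neq0; exact: natK_neq0.
  exact: natK_neq0.
by have := F0 a%:R b%:R c%:R; rewrite /evT /= /horner_eval !polyC_natr => ->; rewrite eqxx.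
Qed.

Lemma evT_inj (F G : T) : (forall a b c, evT a b c F = evT a b c G) -> F = G.
Proof.
by move=> FG; apply/eqP; rewrite -subr_eq0; apply/eqP/evT_eq0 => a b c; rewrite rmorphB; apply/eqP; rewrite subr_eq0; apply/eqP; exact: FG.
Qed.

Lemma horner_eq0 (p : {poly K}) : (forall t, p.[t] = 0) -> p = 0.
Proof.
move=> p0; apply/eqP; apply: contraT => /(horner_nat_neq0 natK_neq0)[n].
by rewrite p0 eqxx.
Qed.

Lemma hornerCK (t : K) : cancel polyC (horner_eval t).
Proof. by move=> c; rewrite /horner_eval hornerC. Qed.

End Substitution.

(** * The cone of sextics *)

Section Cone.
Variable K : numClosedFieldType.
Implicit Types x y : 'rV[K]_7.

(** The index of each of these quadrics is its weight, x_i having weight i; the exchange of x_i and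
    x_(6-i) swaps [q4] with [q8] and [q5] with [q7]. *)
Definition q4 x := co x 0 * co x 4 - 4 * co x 1 * co x 3 + 3 * co x 2 ^+ 2.
Definition q5 x := co x 0 * co x 5 - 3 * co x 1 * co x 4 + 2 * co x 2 * co x 3.
Definition q6 x := co x 0 * co x 6 - 9 * co x 2 * co x 4 + 8 * co x 3 ^+ 2.
Definition q7 x := co x 1 * co x 6 - 3 * co x 2 * co x 5 + 2 * co x 3 * co x 4.
Definition q8 x := co x 2 * co x 6 - 4 * co x 3 * co x 5 + 3 * co x 4 ^+ 2.

(* The affine cone over the quintic del Pezzo threefold: the coefficients
   (up to binomials) of the binary sextics f with vanishing transvectant (f, f)_4. *)
Definition V x := [/\ q4 x = 0, q5 x = 0, q6 x = 0, q7 x = 0 & q8 x = 0].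

(** With x_0 = 1 the equations [q4], [q5], [q6] give x_4, x_5, x_6 in terms of x_1, x_2, x_3; [q7]
    and [q8] then hold identically. *)
Definition chart (S : comNzRingType) (a b c : S) : seq S :=
  let d := 4 * a * c - 3 * b ^+ 2 in
  [:: 1; a; b; c; d; 3 * a * d - 2 * b * c; 9 * b * d - 8 * c ^+ 2].

(** The solutions with x_0 = 0, x_1 = r nonzero, x_2 = 2 r v and x_5 = w. For fixed v the formula is
    linear in (r, w): the section is swept out by lines, all meeting the line r = 0 spanned by the
    last two coordinate vectors. *)
Definition bdry (S : comNzRingType) (r v w : S) : seq S :=
  [:: 0; r; 2 * r * v; 3 * r * v ^+ 2; 4 * r * v ^+ 3; w;
      6 * v * w - 24 * r * v ^+ 5].

(** Translation by t of the sextic with coefficients x_i (up to binomials); the entry of index 0 is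
    the value of the sextic at t. *)
Definition lower (S : comNzRingType) (t : S) (x : seq S) : seq S :=
  [:: x`_0 + 6 * t * x`_1 + 15 * t ^+ 2 * x`_2 + 20 * t ^+ 3 * x`_3
      + 15 * t ^+ 4 * x`_4 + 6 * t ^+ 5 * x`_5 + t ^+ 6 * x`_6;
      x`_1 + 5 * t * x`_2 + 10 * t ^+ 2 * x`_3 + 10 * t ^+ 3 * x`_4
      + 5 * t ^+ 4 * x`_5 + t ^+ 5 * x`_6;
      x`_2 + 4 * t * x`_3 + 6 * t ^+ 2 * x`_4 + 4 * t ^+ 3 * x`_5 + t ^+ 4 * x`_6;
      x`_3 + 3 * t * x`_4 + 3 * t ^+ 2 * x`_5 + t ^+ 3 * x`_6;
      x`_4 + 2 * t * x`_5 + t ^+ 2 * x`_6;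
      x`_5 + t * x`_6;
      x`_6].

Lemma map_chart (S S' : comNzRingType) (f : {rmorphism S -> S'}) a b c :
  map f (chart a b c) = chart (f a) (f b) (f c).
Proof. by rewrite /chart /= !(rmorphB, rmorphM, rmorphXn, rmorph_nat, rmorph1). Qed.

Lemma map_bdry (S S' : comNzRingType) (f : {rmorphism S -> S'}) a b c :
  map f (bdry a b c) = bdry (f a) (f b) (f c).
Proof.
by rewrite /bdry /= !(rmorphB, rmorphM, rmorphXn, rmorph_nat, rmorph1, rmorph0).
Qed.

Lemma map_lower (S S' : comNzRingType) (f : {rmorphism S -> S'}) t (x : seq S) :
  map f (lower t x) = lower (f t) (map f x).
Proof.
have fx k : (map f x)`_k = f x`_k.
  have [kx|kx] := ltnP k (size x); first by rewrite (nth_map 0).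
  by rewrite !nth_default ?rmorph0 ?size_map.
by rewrite /lower /= !fx !(rmorphD, rmorphM, rmorphXn, rmorph_nat, rmorph1, rmorph0).
Qed.

Lemma V_chart a b c : V (vec7 (chart a b c)).
Proof. by split; rewrite /q4 /q5 /q6 /q7 /q8 !co_vec7 //=; ring. Qed.

Lemma V_bdry r v w : V (vec7 (bdry r v w)).
Proof. by split; rewrite /q4 /q5 /q6 /q7 /q8 !co_vec7 //=; ring. Qed.

(** The transvectant is a covariant: under translation the five quadrics are transformed among
    themselves like the coefficients of a binary quartic. *)
Lemma V_lower t x : V x -> V (vec7 (lower t (coords x))).
Proof.
case=> E4 E5 E6 E7 E8; pose y := vec7 (lower t (coords x)).
have F4 : q4 y = q4 x + 2 * t * q5 x + t ^+ 2 * q6 x + 2 * t ^+ 3 * q7 x + t ^+ 4 * q8 x.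
  by rewrite /q4 /q5 /q6 /q7 /q8 !co_vec7 //=; ring.
have F5 : q5 y = q5 x + t * q6 x + 3 * t ^+ 2 * q7 x + 2 * t ^+ 3 * q8 x.
  by rewrite /q4 /q5 /q6 /q7 /q8 !co_vec7 //=; ring.
have F6 : q6 y = q6 x + 6 * t * q7 x + 6 * t ^+ 2 * q8 x.
  by rewrite /q4 /q5 /q6 /q7 /q8 !co_vec7 //=; ring.
have F7 : q7 y = q7 x + 2 * t * q8 x by rewrite /q4 /q5 /q6 /q7 /q8 !co_vec7 //=; ring.
have F8 : q8 y = q8 x by rewrite /q4 /q5 /q6 /q7 /q8 !co_vec7 //=; ring.
by split; rewrite -/y ?F4 ?F5 ?F6 ?F7 ?F8 ?E4 ?E5 ?E6 ?E7 ?E8 ?mulr0 ?addr0.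
Qed.

(* Every point of the cone is a limit of points with nonzero first coordinate
   along an orbit of the unipotent group [lower]. *)
Lemma cone_dense p : (forall x, V x -> co x 0 != 0 -> ev7 x p = 0) ->
  forall x, V x -> x != 0 -> ev7 x p = 0.
Proof.
move=> p0 x Vx x0; pose l := lower 'X (map polyC (coords x)).
have lE t : map (horner_eval t) l = lower t (coords x).
  rewrite map_lower -map_comp map_id_in => [|c _]; last exact: hornerC.
  congr lower; exact: hornerX.
pose P := l`_0; pose Q := subst7 polyC l p.
have QE t : Q.[t] = ev7 (vec7 (lower t (coords x))) p.
  by rewrite -lE -(subst7E _ _ (hornerCK t)).
have PQ : P * Q = 0.
  apply: horner_eq0 => t; rewrite hornerM QE.
  have -> : P.[t] = co (vec7 (lower t (coords x))) 0.
    by rewrite -lE co_vec7 // (nth_map 0).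
  set y := vec7 _; have [->|y0] := eqVneq (co y 0) 0; first by rewrite mul0r.
  by rewrite p0 ?mulr0 //; exact: V_lower.
(* P is the sextic itself: its coefficients are the x_k up to binomials, which are nonzero in K. *)
have P0 : P != 0.
  apply: contraNneq x0 => P0; rewrite [x]vec7P.
  have PE : P = \poly_(k < 7) (nth 0 [:: 1; 6; 15; 20; 15; 6; 1] k * (coords x)`_k).
    rewrite /P /l /lower /= poly_def !big_ord_recl big_ord0 /= /bump /= -!mul_polyC.
    by rewrite !polyCM -!polyC_natr; ring.
  have ck k : (k < 7)%N -> (coords x)`_k = 0.
    move=> k7; have /eqP := congr1 (fun r : {poly K} => r`_k) P0.
    rewrite PE coef_poly k7 coef0 mulf_eq0 => /orP[|/eqP //].
    by case: k k7 => [|[|[|[|[|[|[|]]]]]]] //= _; rewrite ?pnatr_eq0 ?oner_eq0.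
  by apply/eqP/rowP => k; rewrite !mxE ck.
have Q0 : Q = 0 by apply/eqP; move/eqP: PQ; rewrite mulf_eq0 (negPf P0).
have := QE 0; rewrite Q0 horner0 => ->; congr (ev7 _ p); rewrite [LHS]vec7P.
by congr vec7; rewrite /lower /=; congr [:: _; _; _; _; _; _; _]; ring.
Qed.

Lemma chartP x : V x -> co x 0 != 0 ->
  x = co x 0 *: vec7 (chart (co x 1 / co x 0) (co x 2 / co x 0) (co x 3 / co x 0)).
Proof.
case; rewrite /q4 /q5 /q6 /q7 /q8 => E4 E5 E6 _ _ x0.
have e4 : co x 4 = (4 * co x 1 * co x 3 - 3 * co x 2 ^+ 2) / co x 0.
  by apply: (mulIf x0); rewrite divfK // -[RHS]addr0 -E4; ring.
have e5 : co x 5 = (3 * co x 1 * co x 4 - 2 * co x 2 * co x 3) / co x 0.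
  by apply: (mulIf x0); rewrite divfK // -[RHS]addr0 -E5; ring.
have e6 : co x 6 = (9 * co x 2 * co x 4 - 8 * co x 3 ^+ 2) / co x 0.
  by apply: (mulIf x0); rewrite divfK // -[RHS]addr0 -E6; ring.
rewrite [LHS]vec7P; apply/rowP => i; rewrite !mxE.
case: i => [[|[|[|[|[|[|[|//]]]]]]] h] /=; rewrite ?e6 ?e5 ?e4; by field.
Qed.

End Cone.

(** * Reduction modulo the hyperplane section x_0 = 0 *)

Section NormalForm.
Variable K : numClosedFieldType.
Implicit Types x y : 'rV[K]_7.

(** Expressed by values, so that p can be treated as an element of K[x_1, x_5, x_6] without
    introducing that ring. *)
Definition depends156 (p : {mpoly K[7]}) := forall x y,
  co x 1 = co y 1 -> co x 5 = co y 5 -> co x 6 = co y 6 -> ev7 x p = ev7 y p.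

Lemma dep0 : depends156 0. Proof. by move=> x y _ _ _; rewrite !ev7_0. Qed.
Lemma depC c : depends156 c%:MP.
Proof. by move=> x y _ _ _; rewrite /ev7 !mevalC. Qed.
Lemma depD p q : depends156 p -> depends156 q -> depends156 (p + q).
Proof. by move=> dp dq x y h1 h5 h6; rewrite !ev7D (dp x y) ?(dq x y). Qed.
Lemma depN p : depends156 p -> depends156 (- p).
Proof. by move=> dp x y h1 h5 h6; rewrite !ev7N (dp x y). Qed.
Lemma depM p q : depends156 p -> depends156 q -> depends156 (p * q).
Proof. by move=> dp dq x y h1 h5 h6; rewrite !ev7M (dp x y) ?(dq x y). Qed.
Lemma depZ c p : depends156 p -> depends156 (c *: p).
Proof. by move=> dp x y h1 h5 h6; rewrite !ev7Z (dp x y). Qed.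
Lemma depX1 : depends156 'X_(inord 1). Proof. by move=> x y; rewrite !ev7X. Qed.
Lemma depX5 : depends156 'X_(inord 5). Proof. by move=> x y _; rewrite !ev7X. Qed.
Lemma depX6 : depends156 'X_(inord 6). Proof. by move=> x y _ _; rewrite !ev7X. Qed.

(* Modulo x_0 the coordinate ring of V is free over K[x_1, x_5, x_6], with basis
   1, x_2, x_3, x_4, x_2 x_4. *)
Definition nf_eq (p p' a0 a1 a2 a3 a4 : {mpoly K[7]}) := forall x, V x ->
  ev7 x p = co x 0 * ev7 x p' + ev7 x a0 + ev7 x a1 * co x 2 + ev7 x a2 * co x 3
    + ev7 x a3 * co x 4 + ev7 x a4 * (co x 2 * co x 4).

Definition has_nf p := exists p' a0 a1 a2 a3 a4,
  [/\ depends156 a0, depends156 a1, depends156 a2, depends156 a3 & depends156 a4]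
  /\ nf_eq p p' a0 a1 a2 a3 a4.

Ltac dep := repeat first
  [ exact: dep0 | exact: depX1 | exact: depX5 | exact: depX6 | assumption
  | apply: depC | apply: depD | apply: depN | apply: depZ | apply: depM ].

Lemma nf0 : has_nf 0.
Proof.
exists 0, 0, 0, 0, 0, 0; split=> [|x _]; first by split; dep.
by rewrite !ev7_0; ring.
Qed.

Lemma nfD p q : has_nf p -> has_nf q -> has_nf (p + q).
Proof.
move=> [p' [a0 [a1 [a2 [a3 [a4 [[d0 d1 d2 d3 d4] pE]]]]]]].
move=> [q' [b0 [b1 [b2 [b3 [b4 [[e0 e1 e2 e3 e4] qE]]]]]]].
exists (p' + q'), (a0 + b0), (a1 + b1), (a2 + b2), (a3 + b3), (a4 + b4).
split=> [|x Vx]; first by split; dep.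
by rewrite !ev7D (pE _ Vx) (qE _ Vx); ring.
Qed.

Lemma nfZ c p : has_nf p -> has_nf (c *: p).
Proof.
move=> [p' [a0 [a1 [a2 [a3 [a4 [[d0 d1 d2 d3 d4] pE]]]]]]].
exists (c *: p'), (c *: a0), (c *: a1), (c *: a2), (c *: a3), (c *: a4).
split=> [|x Vx]; first by split; dep.
by rewrite !ev7Z (pE _ Vx); ring.
Qed.

(** The quadrics are rewriting rules modulo x_0: [q4] removes x_2^2, [q5] x_2 x_3, [q6] x_3^2 (in
    favour of x_2 x_4), [q7] x_3 x_4 and [q8] x_4^2. The cubic products coming from x_2 x_4 need two
    rules in succession. *)
Lemma nf_mulX (k : 'I_7) p : has_nf p -> has_nf ('X_k * p).
Proof.
move=> [p' [a0 [a1 [a2 [a3 [a4 [[d0 d1 d2 d3 d4] pE]]]]]]].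
rewrite -(inord_val k).
case: k => [[|[|[|[|[|[|[|//]]]]]]] h] /=.
- exists p, 0, 0, 0, 0, 0; split=> [|x Vx]; first by split; dep.
  by rewrite !ev7E; ring.
- exists ('X_(inord 1) * p'), ('X_(inord 1) * a0), ('X_(inord 1) * a1),
    ('X_(inord 1) * a2), ('X_(inord 1) * a3), ('X_(inord 1) * a4).
  split=> [|x Vx]; first by split; dep.
  by rewrite !ev7E (pE _ Vx); ring.
- exists ('X_(inord 2) * p' - 3^-1 *: (a1 * 'X_(inord 4)) - 2^-1 *: (a2 * 'X_(inord 5))
    - 3^-1 *: (a4 * 'X_(inord 4) * 'X_(inord 4))),
    ((- (2 / 3)) *: (a4 * 'X_(inord 1) * 'X_(inord 1) * 'X_(inord 6))),
    (a0 + 2 *: (a4 * 'X_(inord 1) * 'X_(inord 5))),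
    ((4 / 3) *: (a1 * 'X_(inord 1))), ((3 / 2) *: (a2 * 'X_(inord 1))), a3.
  split=> [|x Vx]; first by split; dep.
  have [E4 E5 E6 E7 E8] := Vx; rewrite !ev7E (pE _ Vx).
  apply/eqP; rewrite -subr_eq0; apply/eqP.
  (* The error of the reduction as an explicit combination of the quadrics; likewise in the next two
     cases. *)
  transitivity (ev7 x a1 / 3 * q4 x + ev7 x a2 / 2 * q5 x
    + ev7 x a4 * (co x 4 / 3 * q4 x + 2 / 3 * co x 1 * q7 x)).
    by rewrite /q4 /q5 /q6 /q7 /q8; field.
  by rewrite ?E4 ?E5 ?E6 ?E7 ?E8; ring.
- exists ('X_(inord 3) * p' - 2^-1 *: (a1 * 'X_(inord 5)) - 8^-1 *: (a2 * 'X_(inord 6))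
    - 2^-1 *: (a4 * 'X_(inord 4) * 'X_(inord 5))),
    ((- 2^-1) *: (a3 * 'X_(inord 1) * 'X_(inord 6))),
    ((3 / 2) *: (a3 * 'X_(inord 5)) - 2^-1 *: (a4 * 'X_(inord 1) * 'X_(inord 6))),
    (a0 + 2 *: (a4 * 'X_(inord 1) * 'X_(inord 5))),
    ((3 / 2) *: (a1 * 'X_(inord 1))), ((9 / 8) *: a2).
  split=> [|x Vx]; first by split; dep.
  have [E4 E5 E6 E7 E8] := Vx; rewrite !ev7E (pE _ Vx).
  apply/eqP; rewrite -subr_eq0; apply/eqP.
  transitivity (ev7 x a1 / 2 * q5 x + ev7 x a2 / 8 * q6 x + ev7 x a3 / 2 * q7 x
    + ev7 x a4 * (co x 2 / 2 * q7 x + co x 5 / 2 * q4 x)).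
    by rewrite /q4 /q5 /q6 /q7 /q8; field.
  by rewrite ?E4 ?E5 ?E6 ?E7 ?E8; ring.
- exists ('X_(inord 4) * p' + (- (2 / 3)) *: (a4 * 'X_(inord 5) * 'X_(inord 5))
    + 9^-1 *: (a4 * 'X_(inord 4) * 'X_(inord 6))),
    ((- 2^-1) *: (a2 * 'X_(inord 1) * 'X_(inord 6))),
    ((3 / 2) *: (a2 * 'X_(inord 5)) - 3^-1 *: (a3 * 'X_(inord 6))),
    ((4 / 3) *: (a3 * 'X_(inord 5)) - (4 / 9) *: (a4 * 'X_(inord 1) * 'X_(inord 6))),
    (a0 + 2 *: (a4 * 'X_(inord 1) * 'X_(inord 5))), a1.
  split=> [|x Vx]; first by split; dep.
  have [E4 E5 E6 E7 E8] := Vx; rewrite !ev7E (pE _ Vx).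
  apply/eqP; rewrite -subr_eq0; apply/eqP.
  transitivity (ev7 x a2 / 2 * q7 x + ev7 x a3 / 3 * q8 x
    + ev7 x a4 * (co x 2 / 3 * q8 x + 2 / 3 * co x 5 * q5 x - co x 6 / 9 * q4 x)).
    by rewrite /q4 /q5 /q6 /q7 /q8; field.
  by rewrite ?E4 ?E5 ?E6 ?E7 ?E8; ring.
- exists ('X_(inord 5) * p'), ('X_(inord 5) * a0), ('X_(inord 5) * a1),
    ('X_(inord 5) * a2), ('X_(inord 5) * a3), ('X_(inord 5) * a4).
  split=> [|x Vx]; first by split; dep.
  by rewrite !ev7E (pE _ Vx); ring.
- exists ('X_(inord 6) * p'), ('X_(inord 6) * a0), ('X_(inord 6) * a1),
    ('X_(inord 6) * a2), ('X_(inord 6) * a3), ('X_(inord 6) * a4).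
  split=> [|x Vx]; first by split; dep.
  by rewrite !ev7E (pE _ Vx); ring.
Qed.
End NormalForm.

Section Forms.
Variable K : numClosedFieldType.
Implicit Types x y : 'rV[K]_7.

Lemma nf_all (p : {mpoly K[7]}) : has_nf p.
Proof.
rewrite (mpolyE p); apply: (big_ind (@has_nf K)) => [|q r|m _].
- exact: nf0.
- exact: nfD.
apply: nfZ; rewrite mpolyXE_id.
suff H (s : seq 'I_7) : has_nf (\prod_(i <- s) ('X_i : {mpoly K[7]}) ^+ m i) by exact: H.
elim: s => [|i s IH]; rewrite ?big_nil ?big_cons.
  exists 0, 1%:MP, 0, 0, 0, 0; split=> [|x _].
    by split; first [exact: depC | exact: dep0].
  by rewrite !ev7E mpolyC1; ring.
elim: (m i) => [|n IHn]; first by rewrite mul1r.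
by rewrite exprS -mulrA; exact: nf_mulX.
Qed.

Lemma VZ c x : V x -> V (c *: x).
Proof.
case=> E4 E5 E6 E7 E8.
have F4 : q4 (c *: x) = c ^+ 2 * q4 x by rewrite /q4 !mxE; ring.
have F5 : q5 (c *: x) = c ^+ 2 * q5 x by rewrite /q5 !mxE; ring.
have F6 : q6 (c *: x) = c ^+ 2 * q6 x by rewrite /q6 !mxE; ring.
have F7 : q7 (c *: x) = c ^+ 2 * q7 x by rewrite /q7 !mxE; ring.
have F8 : q8 (c *: x) = c ^+ 2 * q8 x by rewrite /q8 !mxE; ring.
by split; rewrite ?F4 ?F5 ?F6 ?F7 ?F8 ?E4 ?E5 ?E6 ?E7 ?E8 mulr0.
Qed.

(** The powers of X below the degree of z are independent over K[z]. The induction is on the size of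
    the [b i]: separating their constant terms writes the sum as z S' plus a polynomial of size at
    most n. *)
Lemma comp_poly_free (z : {poly K}) n (b : nat -> {poly K}) : (n < size z)%N ->
  \sum_(i < n) (b i \Po z) * 'X^i = 0 -> forall i, (i < n)%N -> b i = 0.
Proof.
move=> nz; have [N] : exists N, forall i, (i < n)%N -> (size (b i) <= N)%N.
  exists (\max_(i < n) size (b i)) => i ni.
  exact: (@leq_bigmax _ (fun i : 'I_n => size (b i)) (Ordinal ni)).
elim: N b => [|N IH] b bN S0 i ni.
  by apply/eqP; rewrite -size_poly_leq0; exact: bN.
pose b' i := drop_poly 1 (b i); pose c i := (b i)`_0.
have bE j : b j = b' j * 'X + (c j)%:P.
  rewrite -[LHS](poly_take_drop 1) expr1 addrC; congr (_ + _).
  by apply/polyP => -[|k]; rewrite coef_take_poly coefC.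
pose S' := \sum_(i < n) (b' i \Po z) * 'X^i.
have SE : z * S' + \poly_(j < n) c j = 0.
  rewrite -S0 poly_def mulr_sumr -big_split /=; apply: eq_bigr => j _.
  by rewrite [in RHS](bE j) comp_polyD comp_polyM comp_polyX comp_polyC -mul_polyC; ring.
have S'0 : S' = 0.
  (* Otherwise z S' has size greater than n, while it is the opposite of a polynomial of size at
     most n. *)
  apply/eqP; apply: contraT => S'0; have z0 : z != 0 by rewrite -size_poly_gt0 (leq_trans _ nz).
  have := size_mul z0 S'0; move/eqP: SE; rewrite addr_eq0 => /eqP ->; rewrite size_polyN => E.
  have := size_poly n c; rewrite E.
  case: (size S') (size_poly_gt0 S') => [|k]; rewrite ?S'0 // => _.
  by rewrite addnS /= leqNgt (leq_trans nz) ?leq_addr.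
rewrite bE; have -> : c i = 0.
  by have := congr1 (fun r : {poly K} => r`_i) SE; rewrite S'0 mulr0 add0r coef_poly ni coef0.
rewrite addr0 (IH b') ?mul0r // => j nj.
by rewrite size_drop_poly leq_subLR add1n; exact: bN.
Qed.

Notation tA := (tA K).
Notation tB := (tB K).
Notation tC := (tC K).
Definition subT : {mpoly K[7]} -> T K := subst7 (constT K) (chart tA tB tC).
Definition subD : {mpoly K[7]} -> T K := subst7 (constT K) (bdry tA tB tC).
HB.instance Definition _ := GRing.RMorphism.copy subT
  (mmap (constT K) (fun j : 'I_7 => (chart tA tB tC)`_j)).
HB.instance Definition _ := GRing.RMorphism.copy subD
  (mmap (constT K) (fun j : 'I_7 => (bdry tA tB tC)`_j)).

Lemma evT_subT a b c p : evT a b c (subT p) = ev7 (vec7 (chart a b c)) p.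
Proof. by rewrite /subT subst7E ?map_chart ?evTA ?evTB ?evTC //; exact: constTK. Qed.

Lemma evT_subD a b c p : evT a b c (subD p) = ev7 (vec7 (bdry a b c)) p.
Proof. by rewrite /subD subst7E ?map_bdry ?evTA ?evTB ?evTC //; exact: constTK. Qed.

(** Fix r = x_1 nonzero and w = x_5. Along [bdry r v w] the coefficients of the normal form are
    polynomials in x_6 = z(v), with z of degree 5, and the five basis elements are nonzero multiples
    of 1, v, ..., v^4; [comp_poly_free] makes the coefficients vanish and leaves the multiple of
    x_0. *)
Lemma subD_eq0 p : subD p = 0 ->
  exists p' : {mpoly K[7]}, forall x, V x -> co x 1 != 0 -> ev7 x p = co x 0 * ev7 x p'.
Proof.
move=> p0; have [p' [a0 [a1 [a2 [a3 [a4 [[d0 d1 d2 d3 d4] pE]]]]]]] := nf_all p.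
exists p' => x Vx x1; pose r := co x 1; pose w := co x 5.
(* [A a] is a as a polynomial in x_6, once x_1 and x_5 are fixed. *)
pose A (a : {mpoly K[7]}) := subst7 polyC [:: 0; r%:P; 0; 0; 0; w%:P; 'X] a.
have AE (a : {mpoly K[7]}) (y : 'rV[K]_7) : depends156 a -> co y 1 = r -> co y 5 = w ->
    ev7 y a = (A a).[co y 6].
  move=> da y1 y5; rewrite -[RHS]/(horner_eval (co y 6) (A a)) /A subst7E; last exact: hornerCK.
  by apply: da; rewrite ?y1 ?y5 co_vec7 //= /horner_eval ?hornerC ?hornerX.
pose z : {poly K} := (- 24 * r)%:P * 'X^5 + (6 * w)%:P * 'X.
have sz : size z = 6.
  have s5 : size ((- 24 * r)%:P * 'X^5) = 6.
    by rewrite size_Cmul ?size_polyXn // mulf_neq0 // oppr_eq0 pnatr_eq0.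
  rewrite /z size_polyDl s5 //.
  have [->|w0] := eqVneq (6 * w) 0; first by rewrite mul0r size_poly0.
  by rewrite size_Cmul ?size_polyX.
have zE v : 6 * v * w - 24 * r * v ^+ 5 = z.[v].
  by rewrite /z hornerD !hornerCM hornerXn hornerX; ring.
clearbody z; pose b i := nth 0 [:: A a0; (2 * r) *: A a1; (3 * r) *: A a2; (4 * r) *: A a3;
                      (8 * r ^+ 2) *: A a4] i.
have b0 : forall i, (i < 5)%N -> b i = 0.
  apply: (@comp_poly_free z); first by rewrite sz.
  apply: horner_eq0 => v; rewrite !big_ord_recl big_ord0 /= /bump /= addr0.
  pose y := vec7 (bdry r v w); have := pE y (V_bdry r v w).
  have y1 : co y 1 = r by rewrite co_vec7.
  have y5 : co y 5 = w by rewrite co_vec7.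
  rewrite (AE a0) // (AE a1) // (AE a2) // (AE a3) // (AE a4) //.
  have -> : ev7 y p = 0 by rewrite -evT_subD p0 rmorph0.
  have -> : co y 6 = z.[v].
    by rewrite co_vec7 //= zE.
  rewrite !co_vec7 //= => E; rewrite [RHS]E.
  by rewrite /b /= !(hornerXn, hornerD, hornerZ, horner_comp, hornerM); ring.
have Aa0 (a : {mpoly K[7]}) c : c != 0 -> c *: A a = 0 -> A a = 0.
  by move=> c0 /eqP; rewrite scaler_eq0 (negPf c0) => /eqP.
rewrite (pE _ Vx) (AE a0) // (AE a1) // (AE a2) // (AE a3) // (AE a4) //.
have -> : A a0 = 0 := b0 0 isT.
have -> : A a1 = 0 by apply: (Aa0 _ (2 * r)); rewrite ?mulf_neq0 ?pnatr_eq0 //; exact: (b0 1 isT).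
have -> : A a2 = 0 by apply: (Aa0 _ (3 * r)); rewrite ?mulf_neq0 ?pnatr_eq0 //; exact: (b0 2 isT).
have -> : A a3 = 0 by apply: (Aa0 _ (4 * r)); rewrite ?mulf_neq0 ?pnatr_eq0 //; exact: (b0 3 isT).
have -> : A a4 = 0 by apply: (Aa0 _ (8 * r ^+ 2)); rewrite ?mulf_neq0 ?pnatr_eq0 //; exact: (b0 4 isT).
by rewrite !horner0; ring.
Qed.

(* Where p = x_0 p', comparing both sides along the lines through the origin
   isolates the component of degree k - 1 of p'. *)
Lemma form_bdry (k : nat) p : p \is k.-homog -> subD p = 0 ->
  subT p = 0 \/ exists k' p', [/\ k = k'.+1, p' \is k'.-homog & subT p = subT p'].
Proof.
move=> hp /subD_eq0[p' p'E].
pose N := maxn (msize p') k.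
have p'S : p' = \sum_(d < N) pihomog mdeg d p' by apply: pihomog_partitionE; exact: leq_maxl.
have key a b c : a != 0 -> let x := vec7 (chart a b c) in
    (ev7 x p)%:P * 'X^k = \poly_(d < N) (ev7 x (pihomog mdeg d p')) * 'X.
  move=> a0 x; apply: (mulIf (negbT (polyX_eq0 K))); apply/eqP; rewrite -subr_eq0.
  apply/eqP/horner_eq0 => t.
  rewrite hornerD hornerN !(hornerXn, hornerX, hornerC, horner_poly, hornerM).
  have [->|t0] := eqVneq t 0; first by rewrite !mulr0 subrr.
  have y1 : co (t *: x : 'rV[K]_7) 1 = t * a by rewrite mxE co_vec7.
  have y0 : co (t *: x : 'rV[K]_7) 0 = t by rewrite mxE co_vec7 //= mulr1.
  have := p'E (t *: x) (VZ _ (V_chart a b c)).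
  rewrite y1 y0 mulf_neq0 // (ev7_homog _ _ hp) => /(_ isT) E.
  rewrite [_ * t ^+ k]mulrC E; apply/eqP; rewrite subr_eq0; apply/eqP; congr (_ * _).
  rewrite mulrC; congr (_ * _); rewrite [in LHS]p'S /ev7 raddf_sum; apply: eq_bigr => d _.
  by rewrite -[LHS]/(ev7 (t *: x) (pihomog mdeg d p')) (ev7_homog _ _ (pihomogP _ _ _)) mulrC.
(* The restriction x_1 != 0 of [subD_eq0] is a != 0 on the chart; the factor [tA] absorbs it. *)
have eqT q r : (forall a b c, a != 0 ->
    ev7 (vec7 (chart a b c)) q = ev7 (vec7 (chart a b c)) r) -> subT q = subT r.
  move=> qr; have tA0 : tA != 0 by rewrite !polyC_eq0 polyX_eq0.
  apply: (mulIf tA0); apply: evT_inj => a b c; rewrite !evTM !evTA !evT_subT.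
  by have [->|/qr ->] := eqVneq a 0; rewrite ?mulr0.
(* In degree 0 the right-hand side of [key] has no constant term, because of the factor x_0; so p
   vanishes there. *)
case: k => [|k] in hp N p'S key *.
  left; rewrite -(rmorph0 subT); apply: eqT => a b c a0.
  have := congr1 (fun r : {poly K} => r`_0) (key a b c a0).
  by rewrite coefMX expr0 mulr1 coefC /= ev7_0.
right; exists k, (pihomog mdeg k p'); split=> //; first exact: pihomogP.
apply: eqT => a b c a0.
have := congr1 (fun r : {poly K} => r`_k.+1) (key a b c a0).
by rewrite coefMX /= coefCM coefXn eqxx mulr1 coef_poly leq_max ltnS leqnn orbT.
Qed.

End Forms.

(** * Regular maps of the cone *)

Section Global.
Variable K : numClosedFieldType.
Implicit Types x y : 'rV[K]_7.
Notation tA := (tA K).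
Notation tB := (tB K).
Notation tC := (tC K).

Definition tform k (F : T K) := exists2 p, p \is k.-homog & F = @subT K p.

Lemma tform0 k : tform k 0.
Proof. by exists 0; [exact: dhomog0 | rewrite [RHS]rmorph0]. Qed.

Lemma tformD k F G : tform k F -> tform k G -> tform k (F + G).
Proof.
move=> [p hp ->] [q hq ->]; exists (p + q); last by rewrite [RHS]rmorphD.
exact: rpredD.
Qed.

Lemma tformM k l F G : tform k F -> tform l G -> tform (k + l) (F * G).
Proof.
move=> [p hp ->] [q hq ->]; exists (p * q); last by rewrite [RHS]rmorphM.
exact: dhomogM.
Qed.

Lemma X_homog (i : 'I_7) : ('X_i : {mpoly K[7]}) \is 1.-homog.
Proof. by rewrite dhomogX; apply/eqP; exact: mdeg1. Qed.

Lemma tformX i : tform 1 (chart tA tB tC)`_(nat_of_ord (i : 'I_7)).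
Proof.
exists 'X_i; first exact: X_homog.
by apply/esym; rewrite /subT /subst7 [LHS]mmapX mmap1U.
Qed.

(** x_0 restricts to 1 on the chart, so multiplying by it raises the degree and leaves the function
    unchanged. *)
Lemma tform_leq k l F : (k <= l)%N -> tform k F -> tform l F.
Proof.
move=> /subnKC <-; elim: (l - k)%N => [|n IH] hF; first by rewrite addn0.
rewrite addnS -addn1 -[F]mulr1; apply: tformM; first exact: IH.
by have := tformX (inord 0); rewrite inordK.
Qed.

Lemma tform_exists F : exists k, tform k F.
Proof.
have cst (c : K) : exists k, tform k (constT K c).
  exists 0, c%:MP; first by rewrite -[c%:MP]mulr1 mul_mpolyC dhomogZ ?dhomog1.
  by apply/esym; rewrite /subT /subst7 [LHS]mmapC.
have add F1 F2 : (exists k, tform k F1) -> (exists k, tform k F2) -> exists k, tform k (F1 + F2).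
  move=> [k hk] [l hl]; exists (maxn k l).
  by apply: tformD; [apply: tform_leq hk; exact: leq_maxl | apply: tform_leq hl; exact: leq_maxr].
have mul F1 F2 : (exists k, tform k F1) -> tform 1 F2 -> exists k, tform k (F1 * F2).
  by move=> [k hk] h2; exists (k + 1)%N; exact: tformM.
have hA : tform 1 tA by have := tformX (inord 1); rewrite inordK.
have hB : tform 1 tB by have := tformX (inord 2); rewrite inordK.
have hC : tform 1 tC by have := tformX (inord 3); rewrite inordK.
elim/poly_ind: F => [|F c IH]; first by exists 0; exact: tform0.
apply: (add _ _ _); first exact: mul.
elim/poly_ind: c => [|c d IHc]; first by rewrite polyC0; exists 0; exact: tform0.
have -> : (c * 'X + d%:P)%:P = c%:P * tB + d%:P%:P :> T K by rewrite rmorphD rmorphM.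
apply: (add _ _ _); first exact: mul.
elim/poly_ind: d => [|d e IHd]; first by rewrite !polyC0; exists 0; exact: tform0.
have -> : (d * 'X + e%:P)%:P%:P = d%:P%:P * tA + e%:P%:P%:P :> T K.
  by rewrite !(rmorphD, rmorphM).
by apply: (add _ _ _); [exact: mul | exact: cst].
Qed.

(** A common degree k is chosen minimal: if all the forms vanished on x_0 = 0, [form_bdry] would
    give the same functions in degree k - 1. *)
Lemma tform_minimal (I : finType) (P : I -> T K) : (exists i, P i != 0) ->
  exists k (p : I -> {mpoly K[7]}), [/\ forall i, p i \is k.-homog, forall i, P i = subT (p i) &
                  exists i, subD (p i) != 0].
Proof.
move=> [i0 Pi0].
have exk : exists k, `[< forall i, tform k (P i) >].
  pose k i := sval (cid (tform_exists (P i))).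
  exists (\max_i k i); apply/asboolP => i.
  by apply: (@tform_leq (k i)); [exact: leq_bigmax | rewrite /k; case: cid].
case: (ex_minnP exk) => k /asboolP hk kmin.
pose p i := sval (cid2 (hk i)).
have hp i : p i \is k.-homog by rewrite /p; case: cid2.
have pE i : P i = subT (p i) by rewrite /p; case: cid2.
exists k, p; split=> //; apply: contrapT => np.
have pD i : subD (p i) = 0 by apply/eqP; apply: contrapT => /negP ni; apply: np; exists i.
have [k' kE] : exists k', k = k'.+1.
  have [E|[k' [p' [-> _ _]]]] := form_bdry (hp i0) (pD i0); last by exists k'.
  by move: Pi0; rewrite pE E eqxx.
have /kmin : `[< forall i, tform k' (P i) >].
  apply/asboolP => i; have [E|[k'' [p' [kE' hp' E]]]] := form_bdry (hp i) (pD i).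
    by rewrite pE E; exact: tform0.
  by exists p'; rewrite ?pE //; move: kE'; rewrite kE => -[->].
by rewrite kE ltnn.
Qed.

(** F stands for a map of projective varieties, lifted to vectors arbitrarily; hence the scalar c
    depending on x. The common zeros of q are left out. *)
Definition represents (F : 'rV[K]_7 -> 'rV[K]_7) d (q : 'I_7 -> {mpoly K[7]}) :=
  (forall j, q j \is d.-homog) /\
  forall x, V x -> x != 0 -> mpoly_map q x != 0 ->
    exists2 c, c != 0 & mpoly_map q x = c *: F x.

Definition regular_cone F := forall x, V x -> x != 0 ->
  exists d q, represents F d q /\ mpoly_map q x != 0.

Lemma mpoly_mapE (q : 'I_7 -> {mpoly K[7]}) x i : mpoly_map q x 0 i = ev7 x (q i).
Proof. by rewrite mxE. Qed.

Lemma represents_cross F d e q r x i j : represents F d q -> represents F e r ->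
  V x -> x != 0 -> ev7 x (q i) * ev7 x (r j) = ev7 x (q j) * ev7 x (r i).
Proof.
move=> [_ hq] [_ hr] Vx x0; rewrite -!mpoly_mapE.
have [->|/(hq _ Vx x0)[c _ ->]] := eqVneq (mpoly_map q x) 0; first by rewrite !mxE !mul0r.
have [->|/(hr _ Vx x0)[c' _ ->]] := eqVneq (mpoly_map r x) 0; first by rewrite !mxE !mulr0.
by rewrite !mxE; ring.
Qed.

Lemma chart_neq0 a b c : vec7 (chart a b c) != 0 :> 'rV[K]_7.
Proof.
apply/eqP => /rowP/(_ (inord 0)); rewrite co_vec7 // mxE /= => /eqP.
by rewrite oner_eq0.
Qed.

Lemma T_factorial : factorial_ring (T K).
Proof. by do 3![apply: poly_factorial]; exact: field_factorial. Qed.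

Lemma represented_on_chart F : regular_cone F -> exists P : 'I_7 -> T K,
  [/\ exists i, P i != 0 & forall d q, represents F d q -> exists h, forall i, subT (q i) = h * P i].
Proof.
move=> regF; have [d [q [rq q0]]] := regF _ (V_chart 0 0 0) (chart_neq0 0 0 0).
have [i0 qi0] := rV0Pn _ q0.
have Q0 : subT (q i0) != 0.
  apply: contraNneq qi0 => E; rewrite mpoly_mapE -evT_subT E; apply/eqP; exact: rmorph0.
have [g [P [g0 QE hP]]] := factorial_proportional (Q := fun i => subT (q i)) T_factorial Q0.
exists P; split=> [|e r re].
  by exists i0; apply: contraNneq Q0 => E; rewrite QE E mulr0.
apply: hP => i j; apply: (mulfI g0); rewrite mulrCA -QE [RHS]mulrCA -QE.
apply: evT_inj => a b c; rewrite !evTM !evT_subT.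
exact: (represents_cross _ _ re rq (V_chart a b c) (chart_neq0 a b c)).
Qed.

Lemma cone_dense_eq (p q : {mpoly K[7]}) : (forall x, V x -> co x 0 != 0 -> ev7 x p = ev7 x q) ->
  forall x, V x -> x != 0 -> ev7 x p = ev7 x q.
Proof.
move=> pq x Vx x0; apply/eqP; rewrite -subr_eq0 -ev7N -ev7D; apply/eqP.
by apply: cone_dense Vx x0 => y Vy y0; rewrite ev7D ev7N pq // subrr.
Qed.

Lemma ev7_chart d p x : p \is d.-homog -> V x -> co x 0 != 0 ->
  ev7 x p = co x 0 ^+ d *
    evT (co x 1 / co x 0) (co x 2 / co x 0) (co x 3 / co x 0) (subT p).
Proof.
by move=> hp Vx x0; rewrite evT_subT -(ev7_homog _ _ hp) -chartP.
Qed.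

Lemma ev7Xn x i n : ev7 x ('X_i ^+ n) = x 0 i ^+ n.
Proof. by rewrite [LHS]rmorphXn /= -/(ev7 _ _) ev7X. Qed.

(** Let q, of degree d, represent F near y, and q = h P on the chart, with h coming from a form u of
    degree m. Then x_0^(m + k) q = x_0^d u p on the cone. If d >= m + k, q is a multiple of p, and
    q(y) != 0 forces p(y) != 0. The opposite case contradicts the choice of p and u as not
    identically zero on x_0 = 0. *)
Theorem regular_cone_form F : (forall x, V x -> x != 0 -> F x != 0) -> regular_cone F ->
  exists k (p : 'I_7 -> {mpoly K[7]}), (forall j, p j \is k.-homog) /\
    forall x, V x -> x != 0 -> exists2 c, c != 0 & mpoly_map p x = c *: F x.
Proof.
move=> F0 regF; have [P [P0 hP]] := represented_on_chart regF.
have [k [p [hp pE [i1 pi1]]]] := tform_minimal P0.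
exists k, p; split=> // y Vy y0; have [d [q [rq qy]]] := regF y Vy y0.
have [h hE] := hP _ _ rq; have [qh _] := rq.
have h0 : h != 0.
  apply: contraNneq qy => h0; apply/eqP/rowP => i; rewrite mpoly_mapE mxE.
  apply: cone_dense Vy y0 => x Vx x0; rewrite (ev7_chart (qh i) Vx x0) hE h0 mul0r.
  by rewrite rmorph0 mulr0.
(* h is homogenized like P, as a tuple with one entry, so that u is not identically zero on x_0 =
   0. *)
have [|m [u' [hu' uE' [j uD]]]] := @tform_minimal unit (fun=> h); first by exists tt.
set u := u' j in uD; have hu : u \is m.-homog := hu' j; have uE : h = subT u := uE' j.
have qpu i x : V x -> co x 0 != 0 ->
    co x 0 ^+ (m + k) * ev7 x (q i) = co x 0 ^+ d * ev7 x (u * p i).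
  move=> Vx x0; rewrite (ev7_chart (qh i) Vx x0) (ev7_chart (dhomogM hu (hp i)) Vx x0).
  rewrite mulrCA; congr (_ * (_ * _)); rewrite hE pE uE; congr (evT _ _ _ _).
  by rewrite [RHS]rmorphM.
suff [c cE] : exists c, forall i, ev7 y (q i) = c * ev7 y (p i).
  have qpE : mpoly_map q y = c *: mpoly_map p y.
    by apply/rowP => i; rewrite [RHS]mxE !mpoly_mapE.
  have c0 : c != 0 by apply: contraNneq qy => c0; rewrite qpE c0 scale0r.
  have [_ /(_ y Vy y0 qy)[e e0 eE]] := rq; exists (c^-1 * e).
    by rewrite mulf_neq0 ?invr_eq0.
  by rewrite -scalerA -eE qpE scalerA mulVf ?scale1r.
have [mkd|dmk] := leqP (m + k) d.
  exists (co y 0 ^+ (d - (m + k)) * ev7 y u) => i.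
  have E x : V x -> co x 0 != 0 ->
      ev7 x (q i) = ev7 x ('X_(inord 0) ^+ (d - (m + k)) * (u * p i)).
    move=> Vx x0; apply: (mulfI (expf_neq0 (m + k) x0)).
    by rewrite qpu // [in RHS]ev7M ev7Xn [RHS]mulrA -exprD subnKC.
  by rewrite (cone_dense_eq E Vy y0) !ev7M ev7Xn mulrA.
(* Here u p is x_0 to a positive power times q, so it vanishes on the boundary; but [T] is a domain.
   The factor [tA] discards r = 0, where the vector of [bdry] may be zero. *)
have tA0 : tA != 0 by rewrite !polyC_eq0 polyX_eq0.
suff /eqP : subD u * subD (p i1) * tA = 0.
  by rewrite !mulf_eq0 (negPf uD) (negPf pi1) (negPf tA0).
apply: evT_eq0 => r v w; rewrite !evTM !evT_subD evTA -ev7M.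
have [->|r0] := eqVneq r 0; first by rewrite mulr0.
set z := vec7 _; have Vz : V z := V_bdry r v w.
have z0 : z != 0.
  by apply: contraNneq r0 => E0; apply/eqP; have := congr1 (fun x : 'rV_7 => co x 1) E0; rewrite co_vec7 // mxE. 
have E x : V x -> co x 0 != 0 ->
    ev7 x (u * p i1) = ev7 x ('X_(inord 0) ^+ (m + k - d) * q i1).
  move=> Vx x0; apply: (mulfI (expf_neq0 d x0)); rewrite -qpu // ev7M ev7Xn mulrA -exprD.
  by rewrite subnKC // ltnW.
rewrite (cone_dense_eq E Vz z0) ev7M ev7Xn co_vec7 //=.
by rewrite expr0n subn_eq0 leqNgt dmk !mul0r.
Qed.

End Global.

(** * Automorphisms are linear *)

Section Linear.
Variable K : numClosedFieldType.
Implicit Types x y : 'rV[K]_7.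

Lemma form1_linear (p : {mpoly K[7]}) : p \is 1.-homog ->
  exists a : 'cV[K]_7, forall x, ev7 x p = (x *m a) 0 0.
Proof.
move=> /dhomogP hp; rewrite [p]mpolyE big_seq.
apply: (big_ind (fun q => exists a : 'cV_7, forall x, ev7 x q = (x *m a) 0 0)).
- by exists 0 => x; rewrite mulmx0 mxE ev7_0.
- move=> q r [a qE] [b rE]; exists (a + b) => x.
  by rewrite ev7D qE rE mulmxDr [RHS]mxE.
move=> m /hp /eqP /mdeg1P[i /eqP ->]; exists (p@_U_(i) *: delta_mx i 0) => x.
by rewrite ev7Z ev7X -scalemxAr -colE !mxE.
Qed.

Definition nu (s t : K) : 'rV[K]_7 := \row_i (s ^+ (6 - i) * t ^+ i).

(** Linear maps on K^7 can thus be compared on the rational normal sextic alone. *)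
Lemma nu_span m (A : 'M[K]_(7, m)) : (forall t, nu 1 t *m A = 0) -> A = 0.
Proof.
move=> A0; apply/matrixP => i j; rewrite mxE.
suff P0 : \poly_(k < 7) A (inord k) j = 0.
  by have := congr1 (fun r : {poly K} => r`_i) P0; rewrite coef_poly ltn_ord inord_val coef0.
apply: horner_eq0 => t; have /rowP/(_ j) := A0 t; rewrite !mxE => E.
rewrite horner_poly -[RHS]E; apply: eq_bigr => k _.
by rewrite mxE inord_val expr1n mul1r mulrC.
Qed.

Lemma V_nu s t : V (nu s t).
Proof. by split; rewrite /q4 /q5 /q6 /q7 /q8 !mxE !inordK //=; ring. Qed.

Lemma nu_chart t : nu 1 t = vec7 (chart t (t ^+ 2) (t ^+ 3)).
Proof.
by apply/rowP => -[[|[|[|[|[|[|[|//]]]]]]] h]; rewrite !mxE /=; ring.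
Qed.

(** On the line from the origin of the chart to (a, b, c), a polynomial without zeros over a closed
    field is constant. *)
Lemma nonvanishing_const (p : {mpoly K[7]}) :
  (forall a b c, ev7 (vec7 (chart a b c)) p != 0) ->
  forall a b c, ev7 (vec7 (chart a b c)) p = ev7 (vec7 (chart 0 0 0)) p.
Proof.
move=> p0 a b c.
pose H := subst7 polyC (chart (a%:P * 'X) (b%:P * 'X) (c%:P * 'X)) p.
have HE t : H.[t] = ev7 (vec7 (chart (a * t) (b * t) (c * t))) p.
  rewrite -[LHS]/(horner_eval t H) /H subst7E; last exact: hornerCK.
  have hX (u : K) : horner_eval t (u%:P * 'X) = u * t.
    by rewrite /horner_eval hornerCM hornerX.
  by rewrite map_chart; congr (ev7 (vec7 (chart _ _ _)) p); exact: hX.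
have /size_poly1P[d _ Hd] : size H == 1.
  by apply: contraT => /closed_rootP[t /rootP]; rewrite HE => E; have := p0 (a * t) (b * t) (c * t); rewrite E eqxx.
have := HE 1; rewrite !mulr1 => <-; have := HE 0; rewrite !mulr0 => <-.
by rewrite Hd !hornerC.
Qed.

Definition e6 : 'rV[K]_7 := nu 0 1.

Lemma e6_neq0 : e6 != 0.
Proof.
apply/eqP => /rowP/(_ (inord 6)); rewrite !mxE inordK // subnn expr1n expr0 mulr1.
by move/eqP; rewrite oner_eq0.
Qed.

Lemma e6_0 : co e6 0 = 0.
Proof. by rewrite mxE inordK // expr0n /= mul0r. Qed.

(** The composite n of the two tuples is a form of degree k k' proportional to the identity. Its
    entry of index 0 has no zero on the chart, so it is a constant c0 there, and homogenizing gives
    x_0 n_j = c0 x_0^(k k') x_j on the cone. *)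
Theorem regular_cone_linear F G :
  (forall x, V x -> x != 0 -> V (F x) /\ F x != 0) ->
  (forall x, V x -> x != 0 -> V (G x) /\ G x != 0) ->
  (forall x c, V x -> x != 0 -> c != 0 -> exists2 e, e != 0 & G (c *: x) = e *: G x) ->
  (forall x, V x -> x != 0 -> exists2 e, e != 0 & G (F x) = e *: x) ->
  regular_cone F -> regular_cone G ->
  exists2 L : 'M[K]_7, L \in unitmx &
    forall x, V x -> x != 0 -> exists2 e, e != 0 & x *m L = e *: F x.
Proof.
move=> FV GV GZ GF rF rG.
have F0 x : V x -> x != 0 -> F x != 0 by move=> Vx /(FV x Vx)[].
have G0 x : V x -> x != 0 -> G x != 0 by move=> Vx /(GV x Vx)[].
have [k [p [hp pE]]] := regular_cone_form F0 rF.
have [k' [p' [hp' p'E]]] := regular_cone_form G0 rG.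
pose n j := p' j \mPo [tuple p i | i < 7].
have hn j : n j \is (k * k').-homog.
  by apply: dhomog_comp => // i; rewrite tnth_mktuple.
have nE x j : ev7 x (n j) = mpoly_map p' (mpoly_map p x) 0 j.
  rewrite mpoly_mapE /ev7 comp_mpoly_meval.
  by apply: meval_eq => i; rewrite tnth_mktuple mxE.
have NE x : V x -> x != 0 -> exists2 e, e != 0 & mpoly_map p' (mpoly_map p x) = e *: x.
  move=> Vx x0; have [c c0 ->] := pE x Vx x0; have [VF Fx0] := FV x Vx x0.
  have cF0 : c *: F x != 0 by rewrite scaler_eq0 negb_or c0.
  have [d d0 ->] := p'E _ (VZ c VF) cF0.
  have [e e0 ->] := GZ _ _ VF Fx0 c0; have [u u0 ->] := GF x Vx x0.
  by exists (d * e * u); rewrite ?mulf_neq0 // !scalerA.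
have nn a b c : ev7 (vec7 (chart a b c)) (n (inord 0)) != 0.
  have [e e0 eE] := NE _ (V_chart a b c) (chart_neq0 a b c).
  by rewrite nE eE mxE co_vec7 //= mulr1.
set c0 := ev7 (vec7 (chart 0 0 0)) (n (inord 0)).
have nc a b c j : ev7 (vec7 (chart a b c)) (n j) = c0 * vec7 (chart a b c) 0 j.
  rewrite /c0 -(nonvanishing_const nn a b c) !nE.
  have [e e0 ->] := NE _ (V_chart a b c) (chart_neq0 a b c).
  by rewrite mxE [in RHS]mxE co_vec7 //= mulr1.
have c00 : c0 != 0 := nn 0 0 0.
have nx x j : V x -> co x 0 != 0 -> co x 0 * ev7 x (n j) = c0 * co x 0 ^+ (k * k') * x 0 j.
  move=> Vx x0; have := chartP Vx x0; set y := vec7 _ => xE.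
  have -> : ev7 x (n j) = co x 0 ^+ (k * k') * (c0 * y 0 j).
    by rewrite [in LHS]xE (ev7_homog _ _ (hn j)) nc.
  have -> : x 0 j = co x 0 * y 0 j by rewrite [in LHS]xE mxE.
  by ring.
have kk1 : (k * k' = 1)%N.
  (* At [e6], where x_0 = 0, degree 0 would give c0 x_6 = 0, and degree at least 2 would make all
     the n_j vanish. *)
  case kk : (k * k')%N nx => [|[|m]] // nx; exfalso.
    have E x : V x -> co x 0 != 0 -> ev7 x ('X_(inord 0) * n (inord 6)) = ev7 x (c0 *: 'X_(inord 6)).
      by move=> Vx x0; rewrite ev7M ev7Z !ev7X nx // expr0 mulr1.
    have := cone_dense_eq E (V_nu 0 1) e6_neq0; rewrite -/e6 ev7M ev7Z !ev7X e6_0 mul0r.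
    rewrite mxE inordK // subnn expr1n expr0 !mulr1 => /esym/eqP.
    by rewrite (negPf c00).
  have E j x : V x -> co x 0 != 0 -> ev7 x (n j) = ev7 x (c0 *: ('X_(inord 0) ^+ m.+1 * 'X_j)).
    move=> Vx x0; apply: (mulfI x0); rewrite nx // ev7Z ev7M ev7Xn ev7X exprS; ring.
  have [e e0 eE] := NE _ (V_nu 0 1) e6_neq0; case/eqP: e6_neq0.
  apply: (scalerI e0); rewrite scaler0 -eE; apply/rowP => j.
  rewrite -nE (cone_dense_eq (E j) (V_nu 0 1) e6_neq0) ev7Z ev7M ev7Xn -/e6 e6_0.
  by rewrite expr0n /= mul0r mulr0 mxE.
have k1 : k = 1%N by move/eqP: kk1; rewrite muln_eq1 => /andP[/eqP].
have k'1 : k' = 1%N by move/eqP: kk1; rewrite muln_eq1 => /andP[_ /eqP].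
rewrite k1 in hp; rewrite k'1 in hp'.
have lin (q : 'I_7 -> {mpoly K[7]}) : (forall j, q j \is 1.-homog) ->
    exists L : 'M_7, forall x, mpoly_map q x = x *m L.
  move=> hq; pose a j := sval (cid (form1_linear (hq j))).
  have aE j x : ev7 x (q j) = (x *m a j) 0 0 by rewrite /a; case: cid.
  exists (\matrix_(i, j) a j i 0) => x; apply/rowP => j; rewrite mpoly_mapE aE !mxE.
  by apply: eq_bigr => i _; rewrite mxE.
have [L LE] := lin p hp; have [L' L'E] := lin p' hp'.
exists L; last by move=> x Vx x0; have [c cc0 cE] := pE x Vx x0; exists c; rewrite // -LE.
have LL : L *m L' = c0%:M.
  apply/eqP; rewrite -subr_eq0; apply/eqP/nu_span => t; rewrite mulmxBr mul_mx_scalar.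
  rewrite mulmxA -LE -L'E nu_chart; apply/eqP; rewrite subr_eq0; apply/eqP/rowP => j.
  by rewrite -nE nc [RHS]mxE.
have [//] : L \in unitmx /\ c0^-1 *: L' \in unitmx.
by apply: mulmx1_unit; rewrite -scalemxAr LL -mul_scalar_mx -scalar_mxM mulVf.
Qed.
End Linear.

(** * Linear automorphisms of the cone *)

Section SymmetricPower.
Variable K : numClosedFieldType.
Implicit Types (x y z : 'rV[K]_7) (g h : 'M[K]_2).

(* The action of GL_2 on the row space Sym^6: nu (s, t) g = nu ((s, t) g). *)
Definition symM g : 'M[K]_7 := \matrix_(j, i)
  (((g 0 0)%:P + (g 1 0) *: 'X) ^+ (6 - i) * ((g 0 1)%:P + (g 1 1) *: 'X) ^+ i)`_j.

Lemma expr6 (u : K) (j : 'I_7) : u ^+ 6 = u ^+ (6 - j) * u ^+ j.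
Proof. by rewrite -exprD subnK // -ltnS. Qed.

Lemma size_linear (a b : K) : (size (a%:P + b *: 'X : {poly K})%R <= 2)%N.
Proof.
rewrite (leq_trans (size_polyD _ _)) // geq_max size_polyC (leq_trans (leq_b1 _)) //.
by rewrite (leq_trans (size_scale_leq _ _)) // size_polyX.
Qed.

(** [symM] is defined by expanding at s = 1. Homogeneity extends the formula to s != 0, and both
    sides being polynomials in s, to s = 0. *)
Lemma nu_symM s t g : nu s t *m symM g = nu (s * g 0 0 + t * g 1 0) (s * g 0 1 + t * g 1 1).
Proof.
apply/rowP => i; rewrite !mxE.
pose P := ((g 0 0)%:P + (g 1 0) *: 'X) ^+ (6 - i) * ((g 0 1)%:P + (g 1 1) *: 'X) ^+ i.
have sP : (size P <= 7)%N.
  have sX (q : {poly K}) n : (size q <= 2)%N -> (size (q ^+ n)%R <= n.+1)%N.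
    move=> q2; rewrite (leq_trans (size_poly_exp_leq _ _)) // ltnS.
    by case: (size q) q2 => [|[|[|]]] //= _; rewrite mul1n.
  rewrite (leq_trans (size_polyMleq _ _)) // -subn1 leq_subLR.
  apply: (leq_trans (leq_add (sX _ _ (size_linear _ _)) (sX _ _ (size_linear _ _)))).
  by rewrite addSn addnS subnK // -ltnS.
pose Q := \sum_(j < 7) (P`_j * t ^+ j) *: 'X^(6 - j).
pose Q' := ((g 0 0) *: 'X + (t * g 1 0)%:P) ^+ (6 - i) * ((g 0 1) *: 'X + (t * g 1 1)%:P) ^+ i.
have QE u : Q.[u] = \sum_j nu u t 0 j * symM g j i.
  rewrite /Q horner_sum; apply: eq_bigr => j _; rewrite !mxE hornerZ hornerXn -/P; ring.
have Q'E u : Q'.[u] = (u * g 0 0 + t * g 1 0) ^+ (6 - i) * (u * g 0 1 + t * g 1 1) ^+ i.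
  by rewrite /Q' hornerM !horner_exp !hornerD !hornerZ hornerX !hornerC !(mulrC u).
have QQ' u : u != 0 -> Q.[u] = Q'.[u].
  move=> u0; rewrite Q'E /Q horner_sum; transitivity (u ^+ 6 * P.[t / u]).
    rewrite (horner_coef_wide _ sP) mulr_sumr; apply: eq_bigr => j _.
    rewrite hornerZ hornerXn expr_div_n (expr6 u j).
    by field; rewrite expf_neq0.
  rewrite /P hornerM !horner_exp !hornerD !hornerZ hornerX !hornerC.
  by rewrite (expr6 u i) mulrACA -!exprMn; congr (_ ^+ _ * _ ^+ _); field.
rewrite -Q'E -QE; clearbody Q Q'; congr (_.[s]); apply: (mulIf (negbT (polyX_eq0 K))).
apply/eqP; rewrite -subr_eq0; apply/eqP/horner_eq0 => u.
rewrite hornerD hornerN !hornerM hornerX -mulrBl.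
have [->|/QQ' ->] := eqVneq u 0; first by rewrite mulr0.
by rewrite subrr mul0r.
Qed.

Lemma mx2P (A B : 'M[K]_2) : A 0 0 = B 0 0 -> A 0 1 = B 0 1 -> A 1 0 = B 1 0 ->
  A 1 1 = B 1 1 -> A = B.
Proof.
move=> h00 h01 h10 h11; apply/matrixP => i j.
have o2 (k : 'I_2) : k = 0 \/ k = 1.
  by case: k => [[|[|//]]] h; [left | right]; apply: val_inj.
by case: (o2 i) (o2 j) => -> [] ->.
Qed.

(** Identities about [symM] are checked on the curve [nu], where they become substitutions in two
    variables. *)
Lemma symM_eq g (N : 'M[K]_7) :
  (forall t, nu 1 t *m N = nu (g 0 0 + t * g 1 0) (g 0 1 + t * g 1 1)) -> symM g = N.
Proof.
move=> gN; apply/eqP; rewrite -subr_eq0; apply/eqP/nu_span => t.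
by rewrite mulmxBr nu_symM gN !mul1r subrr.
Qed.

Lemma mul2E (g h : 'M[K]_2) i j : (g *m h) i j = g i 0 * h 0 j + g i 1 * h 1 j.
Proof.
rewrite mxE !big_ord_recl big_ord0 addr0; congr (_ * _ + _ * _);
  congr (_ _ _); exact: val_inj.
Qed.

Lemma symM_mul g h : symM (g *m h) = symM g *m symM h.
Proof.
apply: symM_eq => t; rewrite mulmxA !nu_symM !mul2E.
by congr nu; ring.
Qed.

Lemma symM1 : symM 1%:M = 1%:M.
Proof. by apply: symM_eq => t; rewrite mulmx1 !mxE /= ; congr nu; ring. Qed.

Lemma symMZ c g : symM (c *: g) = c ^+ 6 *: symM g.
Proof.
apply: symM_eq => t; rewrite -scalemxAr nu_symM; apply/rowP => i.
rewrite !mxE (expr6 c i) mulrACA -!exprMn.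
by congr (_ ^+ _ * _ ^+ _); ring.
Qed.

Lemma symM_unit g : g \in unitmx -> symM g \in unitmx.
Proof.
move=> gU; have [] : symM g \in unitmx /\ symM (invmx g) \in unitmx; last by [].
by apply: mulmx1_unit; rewrite -symM_mul mulmxV // symM1.
Qed.

Lemma symM_inv g : g \in unitmx -> symM (invmx g) = invmx (symM g).
Proof.
move=> gU; rewrite -[LHS](mulmxK (symM_unit gU)) -symM_mul mulVmx // symM1.
exact: mul1mx.
Qed.

Definition mx2 (a b c d : K) : 'M[K]_2 :=
  \matrix_(i, j) if i == 0 then (if j == 0 then a else b) else (if j == 0 then c else d).

Lemma mx2E a b c d : (mx2 a b c d 0 0 = a) * (mx2 a b c d 0 1 = b) *
  (mx2 a b c d 1 0 = c) * (mx2 a b c d 1 1 = d).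
Proof. by rewrite !mxE. Qed.

Lemma det2 g : \det g = g 0 0 * g 1 1 - g 0 1 * g 1 0.
Proof.
rewrite (expand_det_row _ 0) !big_ord_recl big_ord0 /cofactor !det_mx11 !mxE /=.
rewrite !(expr0, expr1) addr0 mul1r mulN1r mulrN.
by congr (g _ _ * g _ _ - g _ _ * g _ _); apply: val_inj.
Qed.

Lemma mx2_unit a b c d : (mx2 a b c d \in unitmx) = (a * d - b * c != 0).
Proof. by rewrite unitmxE det2 !mx2E unitfE. Qed.

Definition lowf (t : K) x : 'rV[K]_7 := vec7 (lower t (coords x)).

Lemma lowf_is_linear t : linear (lowf t).
Proof.
move=> c x y; apply/rowP => -[[|[|[|[|[|[|[|//]]]]]]] h];
  rewrite !mxE /= !mxE; ring.
Qed.

HB.instance Definition _ t := GRing.isLinear.Build K 'rV[K]_7 'rV[K]_7 _ (lowf t)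
  (lowf_is_linear t).

Lemma mul_symM_lower t x : x *m symM (mx2 1 0 t 1) = vec7 (lower t (coords x)).
Proof.
rewrite -/(lowf t x) -mul_rV_lin1; congr (_ *m _); apply: symM_eq => u.
rewrite mul_rV_lin1 /= !mx2E; apply/rowP => -[[|[|[|[|[|[|[|//]]]]]]] h];
  rewrite !mxE /= !mxE !inordK //=; ring.
Qed.

Lemma mul_symM_swap x : x *m symM (mx2 0 1 1 0) = vec7 (rev (coords x)).
Proof.
pose f (y : 'rV[K]_7) := \row_i y 0 (rev_ord i).
have fE : f x = vec7 (rev (coords x)).
  apply/rowP => -[[|[|[|[|[|[|[|//]]]]]]] h]; rewrite !mxE /=; congr (x 0 _);
    by apply: val_inj; rewrite /= inordK.
rewrite -fE; pose N : 'M[K]_7 := \matrix_(j, i) (j == rev_ord i)%:R.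
have NE y : y *m N = f y.
  apply/rowP => i; rewrite !mxE (bigD1 (rev_ord i)) //= mxE eqxx mulr1 big1 ?addr0 //.
  by move=> j ji; rewrite mxE (negPf ji) mulr0.
rewrite -NE; congr (_ *m _); apply: symM_eq => u; rewrite NE !mx2E.
by apply/rowP => -[[|[|[|[|[|[|[|//]]]]]]] h]; rewrite !mxE /=; ring.
Qed.

Lemma mul_symM_diag a d x i : (x *m symM (mx2 a 0 0 d)) 0 i = a ^+ (6 - i) * d ^+ i * x 0 i.
Proof.
pose N : 'M[K]_7 := diag_mx (\row_i (a ^+ (6 - i) * d ^+ i)).
rewrite (_ : symM _ = N); first by rewrite mul_mx_diag !mxE mulrC.
apply: symM_eq => u; rewrite mul_mx_diag !mx2E; apply/rowP => j; rewrite !mxE.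
by rewrite expr1n mul1r mulr0 addr0 add0r exprMn; ring.
Qed.

(** GL_2 is generated by [lower] translations, diagonal matrices and the swap: when g 0 0 != 0 this
    is a factorization into triangular matrices, the upper one being a lower one conjugated by the
    swap; otherwise the columns are exchanged beforehand. *)
Lemma V_symM g x : g \in unitmx -> V x -> V (x *m symM g).
Proof.
have low t y : V y -> V (y *m symM (mx2 1 0 t 1)) by rewrite mul_symM_lower; exact: V_lower.
have swap y : V y -> V (y *m symM (mx2 0 1 1 0)).
  case; rewrite /q4 /q5 /q6 /q7 /q8 => E4 E5 E6 E7 E8; rewrite mul_symM_swap.
  split; rewrite /q4 /q5 /q6 /q7 /q8 !co_vec7 //= /rev /=.
  - by rewrite -E8; ring.
  - by rewrite -E7; ring.
  - by rewrite -E6; ring.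
  - by rewrite -E5; ring.
  - by rewrite -E4; ring.
have diag a d y : V y -> V (y *m symM (mx2 a 0 0 d)).
  case; rewrite /q4 /q5 /q6 /q7 /q8 => E4 E5 E6 E7 E8.
  split; rewrite /q4 /q5 /q6 /q7 /q8 !mul_symM_diag !inordK //=.
  - by rewrite -[RHS](mulr0 (a ^+ 8 * d ^+ 4)) -E4; ring.
  - by rewrite -[RHS](mulr0 (a ^+ 7 * d ^+ 5)) -E5; ring.
  - by rewrite -[RHS](mulr0 (a ^+ 6 * d ^+ 6)) -E6; ring.
  - by rewrite -[RHS](mulr0 (a ^+ 5 * d ^+ 7)) -E7; ring.
  - by rewrite -[RHS](mulr0 (a ^+ 4 * d ^+ 8)) -E8; ring.
have main h y : h \in unitmx -> h 0 0 != 0 -> V y -> V (y *m symM h).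
  rewrite unitmxE det2 unitfE => hU h00 Vy.
  pose u := mx2 1 0 (h 1 0 / h 0 0) 1.
  pose dd := mx2 (h 0 0) 0 0 ((h 0 0 * h 1 1 - h 0 1 * h 1 0) / h 0 0).
  pose w := mx2 0 1 1 0; pose l := mx2 1 0 (h 0 1 / h 0 0) 1.
  have -> : h = u *m dd *m w *m l *m w.
    by apply: mx2P; rewrite !mul2E !mx2E; field.
  rewrite !symM_mul !mulmxA.
  exact: (swap _ (low _ _ (swap _ (diag _ _ _ (low _ _ Vy))))).
move=> gU Vx; have [g00|] := eqVneq (g 0 0) 0; last by move=> h; exact: main.
have -> : g = g *m mx2 0 1 1 0 *m mx2 0 1 1 0.
  by apply: mx2P; rewrite !mul2E !mx2E; ring.
rewrite symM_mul mulmxA; apply: swap; apply: main => //.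
  by rewrite unitmx_mul gU mx2_unit mul0r mulr1 sub0r oppr_eq0 oner_eq0.
rewrite mul2E !mx2E mulr0 add0r mulr1; move: gU; rewrite unitmxE det2 unitfE g00.
by rewrite mul0r sub0r oppr_eq0 mulf_eq0 negb_or => /andP[].
Qed.

End SymmetricPower.

(** * Lines of the threefold and orbits of its points *)

Section LinearGroup.
Variable K : numClosedFieldType.
Implicit Types (x y z : 'rV[K]_7) (g h : 'M[K]_2).

Lemma coD x y k : (x + y) 0 k = x 0 k + y 0 k. Proof. by rewrite mxE. Qed.
Lemma coZ a x k : (a *: x) 0 k = a * x 0 k. Proof. by rewrite mxE. Qed.

Definition line_at x y := forall s t : K, V (s *: x + t *: y).

(* The lines of V through x span at most a plane, that is, at most one line of
   the projectivized cone passes through x; this singles out the curve nu. *)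
Definition single_line x := forall y z, line_at x y -> line_at x z ->
  exists a b c : K, [|| a != 0, b != 0 | c != 0] /\ a *: x + b *: y + c *: z = 0.

Lemma single_lineZ c x : c != 0 -> single_line (c *: x) -> single_line x.
Proof.
move=> c0 sx y z ly lz; have [||a [b [d [abd E]]]] := sx y z.
- by move=> s t; rewrite scalerA; exact: ly.
- by move=> s t; rewrite scalerA; exact: lz.
exists (a * c), b, d; rewrite -scalerA; split=> //.
by case/or3P: abd => abd; rewrite ?(mulf_neq0 abd c0) ?abd ?orbT.
Qed.

Lemma single_lineM (L : 'M[K]_7) x : L \in unitmx ->
  (forall y, V y -> V (y *m L)) -> single_line (x *m L) -> single_line x.
Proof.
move=> LU LV sx y z ly lz; have [||a [b [d [abd E]]]] := sx (y *m L) (z *m L).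
- by move=> s t; rewrite !scalemxAl -mulmxDl; apply: LV; exact: ly.
- by move=> s t; rewrite !scalemxAl -mulmxDl; apply: LV; exact: lz.
exists a, b, d; split=> //; apply: (can_inj (mulmxK LU)).
by rewrite mul0mx !mulmxDl -!scalemxAl.
Qed.

Local Notation e k := (delta_mx 0 (inord k) : 'rV[K]_7).

Lemma e6E : e6 K = e 6.
Proof.
by apply/rowP => -[[|[|[|[|[|[|[|//]]]]]]] h]; rewrite !mxE /= -val_eqE /= inordK //=; ring.
Qed.

Lemma eE (i j : nat) : (i < 7)%N -> (j < 7)%N -> co (e i) j = (i == j)%:R.
Proof. by move=> hi hj; rewrite mxE eqxx /= -val_eqE /= !inordK // eq_sym. Qed.

Lemma e_neq0 i : e i != 0.
Proof.
by apply/eqP => /rowP/(_ (inord i)); rewrite !mxE !eqxx => /eqP; rewrite oner_eq0.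
Qed.

(** The polar forms of [q6], [q7], [q8] at e_6 are x_0, x_1, x_2; with these zero, the quadrics
    force x_3 = x_4 = 0. So all the lines through e_6 lie in the span of e_5 and e_6. *)
Lemma single_e6 : single_line (e 6).
Proof.
have key y : line_at (e 6) y ->
    [/\ co y 0 = 0, co y 1 = 0, co y 2 = 0, co y 3 = 0 & co y 4 = 0].
  move=> ly; have := ly 0 1; rewrite scale0r add0r scale1r.
  case; rewrite /q4 /q5 /q6 /q7 /q8 => E4 E5 E6 E7 E8.
  have := ly 1 1; rewrite !scale1r.
  case; rewrite /q4 /q5 /q6 /q7 /q8 => F4 F5 F6 F7 F8.
  move: F4 F5 F6 F7 F8; rewrite !coD !eE //= => F4 F5 F6 F7 F8.
  have y0 : co y 0 = 0.
    have := congr2 (fun a b => a - b) F6 E6; rewrite subrr => <-; ring.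
  have y1 : co y 1 = 0.
    have := congr2 (fun a b => a - b) F7 E7; rewrite subrr => <-; ring.
  have y2 : co y 2 = 0.
    have := congr2 (fun a b => a - b) F8 E8; rewrite subrr => <-; ring.
  have y3 : co y 3 = 0.
    have /eqP : 8 * co y 3 ^+ 2 = 0 by rewrite -E6 y0 y2; ring.
    by rewrite mulf_eq0 pnatr_eq0 /= expf_eq0 /= => /eqP.
  have /eqP : 3 * co y 4 ^+ 2 = 0 by rewrite -E8 y3 y2; ring.
  by rewrite mulf_eq0 pnatr_eq0 /= expf_eq0 /= => /eqP.
move=> y z /key[y0 y1 y2 y3 y4] /key[z0 z1 z2 z3 z4].
have [/andP[/eqP y5 /eqP z5]|n] := boolP ((co y 5 == 0) && (co z 5 == 0)).
  exists (- co y 6), 1, 0; rewrite oner_eq0 orbT; split=> //.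
  apply/rowP => k; rewrite -(inord_val k); case: k => [[|[|[|[|[|[|[|//]]]]]]] h] /=;
    rewrite !(coD, coZ) !eE // mxE ?y0 ?y1 ?y2 ?y3 ?y4 ?y5 /=; ring.
exists (- (co y 5 * co z 6 - co z 5 * co y 6)), (- co z 5), (co y 5); split.
  by rewrite !oppr_eq0; move: n; rewrite negb_and => /orP[] ->; rewrite !orbT.
apply/rowP => k; rewrite -(inord_val k); case: k => [[|[|[|[|[|[|[|//]]]]]]] h] /=;
  rewrite !(coD, coZ) !eE // mxE ?y0 ?y1 ?y2 ?y3 ?y4 ?z0 ?z1 ?z2 ?z3 ?z4 /=; ring.
Qed.

Lemma not_single_e5 : ~ single_line (e 5).
Proof.
move=> /(_ (e 6) (e 1))[||a [b [c [abc E]]]].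
- by move=> s t; split; rewrite /q4 /q5 /q6 /q7 /q8 !(coD, coZ) !eE //=; ring.
- by move=> s t; split; rewrite /q4 /q5 /q6 /q7 /q8 !(coD, coZ) !eE //=; ring.
have E' k := congr1 (fun x => co x k) E.
move: (E' 5) (E' 6) (E' 1); rewrite !(coD, coZ) !eE // !mxE /=.
rewrite !(mulr0, mulr1, add0r, addr0) => a0 b0 c0.
by move: abc; rewrite a0 b0 c0 eqxx.
Qed.

Lemma not_single_e15 : ~ single_line (e 1 + e 5).
Proof.
(* The polar forms at e_1 + e_5 leave vectors (3 d, *, b, 0, d, *, 3 b), for which [q4] requires b^2
   = - d^2 when the free entries are 0; here d = 1 and b = 'i. *)
pose z : 'rV[K]_7 := vec7 [:: 3; 0; 'i; 0; 1; 0; 3 * 'i].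
move=> /(_ (e 1) z)[||a [b [c [abc E]]]].
- by move=> s t; split; rewrite /q4 /q5 /q6 /q7 /q8 !coD
    !(coZ, coD) !eE //=; ring.
- have ii : 'i ^+ 2 = -1 :> K := sqrCi K.
  move=> s t; split; rewrite /q4 /q5 /q6 /q7 /q8 !coD
    !(coZ, coD) !eE // !co_vec7 //=.
  + by ring: ii.
  + by ring.
  + by ring.
  + by ring.
  + by ring: ii.
have E' k := congr1 (fun x => co x k) E.
move: (E' 0) (E' 1) (E' 5); rewrite !coD !(coZ, coD) !eE // !co_vec7 // !mxE /=.
rewrite !(mulr0, mulr1, add0r, addr0) => /eqP.
rewrite mulf_eq0 pnatr_eq0 orbF => c0 b0 a0.
by move: abc; rewrite a0 (eqP c0) eqxx orbF /=; move: b0; rewrite a0 add0r => ->; rewrite eqxx.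
Qed.
End LinearGroup.

Section Orbits.
Variable K : numClosedFieldType.
Implicit Types (x y z : 'rV[K]_7) (g h : 'M[K]_2).
Local Notation e k := (delta_mx 0 (inord k) : 'rV[K]_7).

Definition moves x y := exists2 g, g \in unitmx &
  exists2 c, c != 0 & x *m symM g = c *: y.

Lemma moves_trans x g y : g \in unitmx -> moves (x *m symM g) y -> moves x y.
Proof.
move=> gU [h hU [c c0 E]]; exists (g *m h); first by rewrite unitmx_mul gU.
by exists c; rewrite // symM_mul mulmxA.
Qed.

Definition swap := mx2 0 1 1 0 : 'M[K]_2.
Lemma swap_unit : swap \in unitmx.
Proof. by rewrite mx2_unit mul0r mulr1 sub0r oppr_eq0 oner_eq0. Qed.
Lemma low_unit (t : K) : mx2 1 0 t 1 \in unitmx.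
Proof. by rewrite mx2_unit mul0r mulr1 subr0 oner_eq0. Qed.

Lemma mulf3_eq0 (n : nat) (a b : K) : n.+1%:R * a * b = 0 -> a != 0 -> b = 0.
Proof. by move=> /eqP; rewrite !mulf_eq0 pnatr_eq0 /= => /orP[->|/eqP]. Qed.

Lemma mulf2_eq0 (a b : K) : a * b = 0 -> a != 0 -> b = 0.
Proof. by move=> /eqP; rewrite !mulf_eq0 => /orP[->|/eqP]. Qed.

Lemma natsqr_eq0 (n : nat) (a : K) : n.+1%:R * a ^+ 2 = 0 -> a = 0.
Proof. by move=> /eqP; rewrite mulf_eq0 pnatr_eq0 /= expf_eq0 /= => /eqP. Qed.

(* A root of the sextic x is moved to infinity, then a second coefficient is
   removed by translation. *)
Lemma orbits x : V x -> x != 0 -> [\/ moves x (e 6), moves x (e 5) | moves x (e 1 + e 5)].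
Proof.
have gen g y : g \in unitmx ->
    [\/ moves (y *m symM g) (e 6), moves (y *m symM g) (e 5) | moves (y *m symM g) (e 1 + e 5)] ->
    [\/ moves y (e 6), moves y (e 5) | moves y (e 1 + e 5)].
  by move=> gU [] /(moves_trans gU) H; [constructor 1 | constructor 2 | constructor 3].
have neq0 g y : g \in unitmx -> y != 0 -> y *m symM g != 0.
  move=> gU; apply: contra_neq => E; rewrite -[y](mulmxK (symM_unit gU)) E mul0mx //.
have id2 c y : c != 0 -> y = c *: e 6 -> moves y (e 6).
  move=> c0 ->; exists 1%:M; first exact: unitmx1.
  by exists c; rewrite // symM1 mulmx1.
have byswap c y i j : c != 0 -> (i < 7)%N -> (j < 7)%N -> (i + j = 6)%N -> y = c *: e i -> moves y (e j).
  move=> c0 hi hj ij ->; exists swap; first exact: swap_unit.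
  exists c => //; rewrite -scalemxAl mul_symM_swap; congr (_ *: _).
  apply/rowP => k; rewrite -(inord_val k); case: k => [[|[|[|[|[|[|[|//]]]]]]] h];
  rewrite co_vec7 //= !eE //=; congr (_%:R); congr (nat_of_bool _); lia.
have main y : V y -> y != 0 -> co y 6 = 0 ->
    [\/ moves y (e 6), moves y (e 5) | moves y (e 1 + e 5)].
  move=> Vy y0 y6.
  have [y5|y5] := eqVneq (co y 5) 0.
    case: (Vy); rewrite /q4 /q5 /q6 /q7 /q8 y5 y6 => E4 E5 E6 E7 E8.
    have y4 : co y 4 = 0 by apply: (@natsqr_eq0 2); rewrite -E8; ring.
    have y3 : co y 3 = 0 by apply: (@natsqr_eq0 7); rewrite -E6 y4; ring.
    have y2 : co y 2 = 0 by apply: (@natsqr_eq0 2); rewrite -E4 y4 y3; ring.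
    have [y1|y1] := eqVneq (co y 1) 0.
      have yE : y = co y 0 *: e 0.
        by apply/rowP => k; rewrite -(inord_val k); case: k => [[|[|[|[|[|[|[|//]]]]]]] h];
          rewrite coZ eE //= ?y1 ?y2 ?y3 ?y4 ?y5 ?y6; ring.
      constructor 1; apply: (byswap (co y 0) y 0 6) => //.
      by apply: contraNneq y0 => y00; rewrite yE y00 scale0r.
    constructor 2; pose t := - co y 0 / (6 * co y 1).
    apply: (moves_trans (low_unit t)); rewrite mul_symM_lower.
    apply: (byswap (co y 1) _ 1 5) => //.
    apply/rowP => k; rewrite -(inord_val k); case: k => [[|[|[|[|[|[|[|//]]]]]]] h];
      rewrite co_vec7 //= coZ eE //= ?y2 ?y3 ?y4 ?y5 ?y6 /t; by field.
  pose t := - co y 4 / (2 * co y 5); pose z := y *m symM (mx2 1 0 t 1).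
  have zE := mul_symM_lower t y; have Vz : V z := V_symM (low_unit t) Vy.
  have z6 : co z 6 = 0 by rewrite /z zE co_vec7.
  have z5 : co z 5 = co y 5 by rewrite /z zE co_vec7 //= y6; ring.
  have z4 : co z 4 = 0 by rewrite /z zE co_vec7 //= y6 /t; field.
  case: (Vz); rewrite /q4 /q5 /q6 /q7 /q8 z4 z5 z6 => E4 E5 E6 E7 E8.
  have z3 : co z 3 = 0 by apply: (@mulf3_eq0 3 _ _ _ y5); rewrite -[RHS]oppr0 -E8; ring.
  have z2 : co z 2 = 0 by apply: (@mulf3_eq0 2 _ _ _ y5); rewrite -[RHS]oppr0 -E7 z3; ring.
  have z0 : co z 0 = 0 by apply: (mulf2_eq0 _ y5); rewrite -E5 z3; ring.
  have [z1|z1] := eqVneq (co z 1) 0.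
    constructor 2; apply: (moves_trans (low_unit t)); rewrite -/z.
    exists 1%:M; first exact: unitmx1.
    exists (co y 5) => //; rewrite symM1 mulmx1; apply/rowP => k.
    rewrite -(inord_val k); case: k => [[|[|[|[|[|[|[|//]]]]]]] h];
      rewrite coZ eE //= ?z1 ?z2 ?z3 ?z4 ?z5 ?z6 ?z0; ring.
  constructor 3; apply: (moves_trans (low_unit t)); rewrite -/z.
  (* diag(1, d) multiplies x_1 by d and x_5 by d^5, so this fourth root makes the two coordinates
     equal. *)
  have [d dE] : exists d : K, d ^+ 4 = co z 1 / co z 5.
    by exists (4.-root (co z 1 / co z 5)); rewrite rootCK.
  have d0 : d != 0.
    by apply/eqP => d0; move/eqP: dE; rewrite d0 expr0n eq_sym mulf_eq0 invr_eq0 z5 (negPf z1) (negPf y5).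
  exists (mx2 1 0 0 d); first by rewrite mx2_unit mul0r subr0 mul1r.
  exists (co z 1 * d); first by rewrite mulf_neq0.
  apply/rowP => k; rewrite mul_symM_diag -(inord_val k) expr1n mul1r.
  have z15 : co z 1 = d ^+ 4 * co z 5 by rewrite dE z5; field.
  case: k => [[|[|[|[|[|[|[|//]]]]]]] h];
    rewrite coZ coD !eE //= ?inordK // ?z2 ?z3 ?z4 ?z6 ?z0 ?z15; ring.
move=> Vx x0.
pose P := \poly_(k < 7) (nth 0 [:: 1; 6; 15; 20; 15; 6; 1] k * co x k).
have PE t : co (x *m symM (mx2 1 0 t 1)) 0 = P.[t].
  rewrite mul_symM_lower co_vec7 //= horner_poly !big_ord_recl big_ord0 /= /bump /=; ring.
(* P is the sextic of x. If it is a nonzero constant its only root is at infinity, and x is a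
   multiple of e_0. *)
have [sP|/closed_rootP[t /rootP t0]] := eqVneq (size P) 1.
  apply: (gen swap x swap_unit).
  have ck k : (0 < k < 7)%N -> co x k = 0.
    move=> /andP[k0 k7]; have : P`_k = 0 by rewrite nth_default ?sP.
    rewrite coef_poly k7 => /eqP; rewrite mulf_eq0 => /orP[|/eqP //].
    by case: k k0 k7 => [|[|[|[|[|[|[|]]]]]]] //= _ _; rewrite ?pnatr_eq0 ?oner_eq0.
  constructor 1; have xE : x = co x 0 *: e 0.
    apply/rowP => k; rewrite coZ -(inord_val k); case: k => [[|[|[|[|[|[|[|//]]]]]]] h] /=;
      rewrite eE //= ?mulr1 // mulr0; exact: ck.
  apply: (id2 (co x 0)); first by apply: contraNneq x0 => x00; rewrite xE x00 scale0r.
  rewrite mul_symM_swap; apply/rowP => k; rewrite coZ -(inord_val k); case: k => [[|[|[|[|[|[|[|//]]]]]]] h] /=;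
      rewrite eE // co_vec7 //= ?mulr1 // mulr0; exact: ck.
apply: (gen _ x (low_unit t)); apply: (gen swap _ swap_unit); apply: main.
- exact: V_symM swap_unit (V_symM (low_unit t) Vx).
- exact: neq0 swap_unit (neq0 _ _ (low_unit t) x0).
- by rewrite mul_symM_swap co_vec7 //= PE.
Qed.

End Orbits.

(** * Linear automorphisms come from GL_2 *)

Section Group.
Variable K : numClosedFieldType.
Implicit Types (x y z : 'rV[K]_7) (g h : 'M[K]_2).
Local Notation e k := (delta_mx 0 (inord k) : 'rV[K]_7).

Lemma single_line_moves x : V x -> x != 0 -> single_line x -> moves x (e 6).
Proof.
move=> Vx x0 sx.
have inv y : moves x y -> single_line y.
  move=> [g gU [c c0 E]]; apply: (single_lineZ c0); rewrite -E.
  have giU : invmx g \in unitmx by rewrite unitmx_inv.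
  apply: (@single_lineM _ (symM (invmx g))); first exact: symM_unit.
    by move=> z; exact: V_symM.
  by rewrite symM_inv // mulmxK ?symM_unit.
by have [//|/inv /not_single_e5|/inv /not_single_e15] := orbits Vx x0.
Qed.

Lemma single_line_nu x : V x -> x != 0 -> single_line x ->
  exists c s t, c != 0 /\ x = c *: nu s t.
Proof.
move=> Vx x0 /(single_line_moves Vx x0)[g gU [c c0 E]].
exists c, (invmx g 1 0), (invmx g 1 1); split=> //.
rewrite -[x](mulmxK (symM_unit gU)) E -symM_inv // -scalemxAl; congr (_ *: _).
by rewrite -e6E nu_symM !mul0r !add0r !mul1r.
Qed.

Lemma nu1_neq0 t : nu 1 t != 0 :> 'rV[K]_7.
Proof.
apply/eqP => /rowP/(_ (inord 0)); rewrite !mxE inordK // expr1n expr0 mulr1.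
by move/eqP; rewrite oner_eq0.
Qed.

Lemma single_nu1 t : single_line (nu 1 t : 'rV[K]_7).
Proof.
pose g := mx2 (- t) 1 1 0 : 'M[K]_2.
have gU : g \in unitmx by rewrite mx2_unit mulr0 mul1r sub0r oppr_eq0 oner_eq0.
apply: (@single_lineM _ (symM g)); first exact: symM_unit.
  by move=> y; exact: V_symM.
rewrite nu_symM !mx2E !mul1r mulr0 addr0 mulr1 addNr -/(e6 K) e6E.
exact: single_e6.
Qed.

(** Composing with an element of GL_2, one may assume that e_6 is fixed. Then A maps the affine part
    nu(1, t) of the curve into itself, and an injective polynomial map of the affine line given by
    entries of degree at most 6 in t turns out to be t -> (a + b t) / d. *)
Theorem linear_symM (L : 'M[K]_7) : L \in unitmx ->
  (forall x, V x -> V (x *m L)) -> (forall x, V x -> V (x *m invmx L)) ->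
  exists2 g, g \in unitmx & exists2 c, c != 0 & L = c *: symM g.
Proof.
have single (A : 'M[K]_7) x : A \in unitmx -> (forall y, V y -> V (y *m invmx A)) ->
    single_line x -> single_line (x *m A).
  move=> AU AV sx; apply: (@single_lineM _ (invmx A)); rewrite ?unitmx_inv //.
  by rewrite mulmxK.
have neq0 (A : 'M[K]_7) x : A \in unitmx -> x != 0 -> x *m A != 0.
  by move=> AU; apply: contra_neq => E; rewrite -[x](mulmxK AU) E mul0mx.
move=> LU LV LiV.
have Ve6 : V (e 6 : 'rV[K]_7) by rewrite -e6E; exact: V_nu.
have [g gU [c c0 gE]] := single_line_moves (LV _ Ve6) (neq0 _ _ LU (e_neq0 K 6))
  (single _ _ LU LiV (@single_e6 K)).
pose A := L *m symM g; have AU : A \in unitmx by rewrite unitmx_mul LU symM_unit.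
have AV x : V x -> V (x *m A) by move=> Vx; rewrite mulmxA; apply: V_symM => //; exact: LV.
have AiV x : V x -> V (x *m invmx A).
  have -> : invmx A = symM (invmx g) *m invmx L.
    apply: (can_inj (mulKmx AU)); rewrite mulmxV // /A symM_inv //.
    by rewrite -mulmxA mulKVmx ?symM_unit // mulmxV.
  by move=> Vx; rewrite mulmxA; apply: LiV; apply: V_symM; rewrite ?unitmx_inv.
have Ae6 : e 6 *m A = c *: e 6 by rewrite mulmxA.
have nuA t : exists d u v, d != 0 /\ nu 1 t *m A = d *: nu u v.
  apply: single_line_nu; first exact: AV (V_nu _ _).
    exact: neq0 _ _ AU (nu1_neq0 t).
  exact: single _ _ AU AiV (@single_nu1 t).
pose Y i := \poly_(j < 7) A (inord j) (inord i).
have YE t i : (i < 7)%N -> (Y i).[t] = (nu 1 t *m A) 0 (inord i).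
  move=> i7; rewrite horner_poly mxE; apply: eq_bigr => j _.
  by rewrite !mxE inord_val expr1n mul1r mulrC.
(* [(Y 0).[t]] is d u^6; u = 0 would send nu(1, t) to a multiple of e_6, whose line A already
   fixes. *)
have Y0 t : (Y 0).[t] != 0.
  apply/eqP; rewrite YE //; have [d [u [v [d0 E]]]] := nuA t; rewrite E !mxE inordK //.
  rewrite subn0 expr0 mulr1 => /eqP; rewrite mulf_eq0 (negPf d0) expf_eq0 /= => /eqP u0.
  have : nu 1 t *m A = (d * v ^+ 6 / c) *: e 6 *m A.
    rewrite -scalemxAl Ae6 scalerA E u0; apply/rowP => i.
    rewrite -e6E !mxE divfK // !expr0n subn_eq0.
    have [i6|i6] := leqP 6 i; last by rewrite !mul0r !mulr0.
    have -> : nat_of_ord i = 6 by apply/eqP; rewrite eqn_leq i6 -ltnS ltn_ord.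
    by rewrite expr1n; ring.
  move/(can_inj (mulmxK AU))/rowP/(_ (inord 0)); rewrite coZ eE // mulr0 mxE inordK //.
  by rewrite expr1n expr0 mulr1 => /eqP; rewrite oner_eq0.
have /size_poly1P[d d0 Yd] : size (Y 0) == 1.
  by apply: contraT => /closed_rootP[t /rootP t0]; have := Y0 t; rewrite t0 eqxx.
have Yi i : (i < 7)%N -> d ^+ i *: Y i = d *: Y 1 ^+ i.
  move=> i7; apply/eqP; rewrite -subr_eq0; apply/eqP/horner_eq0 => t.
  have dE : d = (Y 0).[t] by rewrite Yd hornerC.
  rewrite hornerD hornerN !hornerZ horner_exp dE !YE //.
  have [b [u [v [b0 ->]]]] := nuA t; rewrite !mxE !inordK // subn0 !expr0 !expr1 mulr1.
  apply/eqP; rewrite subr_eq0; apply/eqP; rewrite !exprMn.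
  have -> : u ^+ 6 = u ^+ (6 - i) * u ^+ i by rewrite -exprD subnK.
  by ring.
(* The sixth power of [Y 1] is proportional to [Y 6], of degree at most 6. *)
have sY1 : (size (Y 1) <= 2)%N.
  have : (size (Y 1 ^+ 6) <= 7)%N.
    rewrite -(size_scale _ d0) -Yi // size_scale ?expf_neq0 //; exact: size_poly.
  have := size_exp (Y 1) 6; move: (size (Y 1 ^+ 6)) (size (Y 1)) => m n; lia.
pose a := (Y 1)`_0; pose b := (Y 1)`_1.
have Y1E t : (Y 1).[t] = a + b * t.
  by rewrite (horner_coef_wide _ sY1) !big_ord_recl big_ord0 /= expr0 expr1 addr0 mulr1.
pose h := mx2 1 (a / d) 0 (b / d).
have AE : A = d *: symM h.
  apply/eqP; rewrite -subr_eq0; apply/eqP/nu_span => t.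
  rewrite mulmxBr -scalemxAr nu_symM !mx2E; apply/rowP => k.
  rewrite -(inord_val k) [LHS]mxE [in X in _ + X]mxE -YE // coZ [RHS]mxE.
  apply/eqP; rewrite subr_eq0; apply/eqP; rewrite mxE inord_val !mul1r mulr0 addr0 expr1n mul1r.
  apply: (mulfI (expf_neq0 k d0)); rewrite -hornerZ Yi // hornerZ horner_exp Y1E.
  by rewrite mulrCA -exprMn; congr (_ * _ ^+ _); field.
have b0 : b != 0.
  apply/eqP => b0; have : nu 1 0 *m A = nu 1 1 *m A.
    by rewrite AE -!scalemxAr !nu_symM !mx2E b0; congr (_ *: nu _ _); ring.
  move/(can_inj (mulmxK AU))/rowP/(_ (inord 1)); rewrite !mxE inordK // !expr1 !expr1n.
  by rewrite mulr0 mulr1 => /eqP; rewrite eq_sym oner_eq0.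
have hU : h \in unitmx by rewrite mx2_unit mul1r mulr0 subr0 mulf_neq0 ?invr_eq0.
exists (h *m invmx g); first by rewrite unitmx_mul hU unitmx_inv.
exists d => //; rewrite symM_mul symM_inv // scalemxAl -AE mulmxK //.
exact: symM_unit.
Qed.

(** The points of [nu] are fixed, which gives an identity in t; its values at 0, 1 and -1 determine
    g up to a scalar. *)
Lemma symM_scalar g : g \in unitmx ->
  (forall x, V x -> x != 0 -> exists2 c, c != 0 & x *m symM g = c *: x) ->
  exists c, g = c *: 1%:M.
Proof.
move=> gU gx; have gt t : g 0 1 + t * g 1 1 = t * (g 0 0 + t * g 1 0).
  have [c c0] := gx _ (V_nu 1 t) (nu1_neq0 t); rewrite nu_symM !mul1r.
  set p := g 0 0 + _; set q := g 0 1 + _ => /rowP E.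
  have := E (inord 0); rewrite !mxE inordK // subn0 expr1n !expr0 !mulr1 => E0.
  have p0 : p != 0 by apply: contra_neq c0 => p0; rewrite -E0 p0 expr0n.
  have := E (inord 1); rewrite !mxE inordK // expr1n !expr1 mul1r -E0 (exprSr p 5).
  by rewrite -mulrA => /(mulfI (expf_neq0 5 p0)) ->; rewrite mulrC.
have h0 := gt 0; have h1 := gt 1; have h2 := gt (-1).
move: h0; rewrite !mul0r addr0 => h01; move: h1 h2; rewrite h01 !add0r !mul1r => h1 h2.
have h10 : g 1 0 = 0.
  have /eqP : 2 * g 1 0 = 0.
    have -> : 2 * g 1 0 = -1 * (g 0 0 + -1 * g 1 0) - -1 * (g 0 0 + g 1 0) by ring.
    by rewrite -h2 h1 subrr.
  by rewrite mulf_eq0 pnatr_eq0 /= => /eqP.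
exists (g 0 0); rewrite scalemx1; apply: mx2P; rewrite !mxE /= ?mulr1n ?mulr0n //.
by rewrite h1 h10 addr0.
Qed.
End Group.

(** * Nets of alternating matrices *)

Section Pfaffian.
Variable R : comNzRingType.
Implicit Types A B C : 'M[R]_5.

Definition entry A (i j : nat) : R := A (inord i) (inord j).

Definition pf4 A B (i j k l : nat) : R :=
  entry A i j * entry B k l + entry B i j * entry A k l.

(* The polar form of the vector of signed 4 x 4 Pfaffians. *)
Definition pf A B : 'rV[R]_5 :=
  \row_i [:: pf4 A B 1 2 3 4 - pf4 A B 1 3 2 4 + pf4 A B 1 4 2 3;
            - (pf4 A B 0 2 3 4 - pf4 A B 0 3 2 4 + pf4 A B 0 4 2 3);
            pf4 A B 0 1 3 4 - pf4 A B 0 3 1 4 + pf4 A B 0 4 1 3;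
            - (pf4 A B 0 1 2 4 - pf4 A B 0 2 1 4 + pf4 A B 0 4 1 2);
            pf4 A B 0 1 2 3 - pf4 A B 0 2 1 3 + pf4 A B 0 3 1 2]`_i.

Definition alternating A := (forall i, A i i = 0) /\ forall i j, A j i = - A i j.

Lemma pfC A B : pf A B = pf B A.
Proof. by apply/rowP => -[[|[|[|[|[|//]]]]] h]; rewrite !mxE /= /pf4 /entry ?mxE; ring. Qed.

Lemma pfD A B C : pf (A + B) C = pf A C + pf B C.
Proof. by apply/rowP => -[[|[|[|[|[|//]]]]] h]; rewrite !mxE /= /pf4 /entry ?mxE; ring. Qed.

Lemma pfZ a A B : pf (a *: A) B = a *: pf A B.
Proof. by apply/rowP => -[[|[|[|[|[|//]]]]] h]; rewrite !mxE /= /pf4 /entry ?mxE; ring. Qed.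

Lemma pf0 A : pf 0 A = 0.
Proof. by rewrite -(scale0r A) pfZ scale0r. Qed.

Lemma sum5 (V : nmodType) (F : 'I_5 -> V) :
  \sum_i F i = F (inord 0) + F (inord 1) + F (inord 2) + F (inord 3) + F (inord 4).
Proof.
rewrite !big_ord_recl big_ord0 addr0 !addrA; congr (_ + _ + _ + _ + _);
  congr (F _); apply: val_inj; by rewrite /= inordK.
Qed.

Lemma alternatingE A : alternating A ->
  (((entry A 1 0 = - entry A 0 1) * (entry A 2 0 = - entry A 0 2) *
    (entry A 3 0 = - entry A 0 3) * (entry A 4 0 = - entry A 0 4) *
    (entry A 2 1 = - entry A 1 2) * (entry A 3 1 = - entry A 1 3) *
    (entry A 4 1 = - entry A 1 4) * (entry A 3 2 = - entry A 2 3) *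
    (entry A 4 2 = - entry A 2 4) * (entry A 4 3 = - entry A 3 4)) *
   ((entry A 0 0 = 0) * (entry A 1 1 = 0) * (entry A 2 2 = 0) *
    (entry A 3 3 = 0) * (entry A 4 4 = 0)))%type.
Proof. by case=> A0 AN; do !split; rewrite /entry ?A0 -?AN. Qed.

Lemma coD3 (X Y Z : 'rV[R]_5) k : (X + Y + Z) 0 k = X 0 k + Y 0 k + Z 0 k.
Proof. by rewrite !mxE. Qed.

Lemma mul_entry (X : 'rV[R]_5) A k : (X *m A) 0 (inord k) =
  X 0 (inord 0) * entry A 0 k + X 0 (inord 1) * entry A 1 k + X 0 (inord 2) * entry A 2 k
  + X 0 (inord 3) * entry A 3 k + X 0 (inord 4) * entry A 4 k.
Proof. by rewrite mxE sum5. Qed.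

Lemma pf_entry A B k : (k < 5)%N -> pf A B 0 (inord k) =
         [:: pf4 A B 1 2 3 4 - pf4 A B 1 3 2 4 + pf4 A B 1 4 2 3;
            - (pf4 A B 0 2 3 4 - pf4 A B 0 3 2 4 + pf4 A B 0 4 2 3);
            pf4 A B 0 1 3 4 - pf4 A B 0 3 1 4 + pf4 A B 0 4 1 3;
            - (pf4 A B 0 1 2 4 - pf4 A B 0 2 1 4 + pf4 A B 0 4 1 2);
            pf4 A B 0 1 2 3 - pf4 A B 0 2 1 3 + pf4 A B 0 3 1 2]`_k.
Proof. by move=> k5; rewrite mxE inordK. Qed.

(* Polarization of the identity pf(A, A) A = 0. *)
Lemma pf_mul A B C : alternating A -> alternating B -> alternating C ->
  pf B C *m A + pf A C *m B + pf A B *m C = 0.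
Proof.
move=> /alternatingE sA /alternatingE sB /alternatingE sC; apply/rowP => j.
rewrite -(inord_val j); case: j => [[|[|[|[|[|//]]]]] h] /=;
rewrite !coD3 !mul_entry !pf_entry //= [RHS]mxE.
all: rewrite /pf4 !sA !sB !sC; ring.
Qed.
End Pfaffian.

Section NetInvariant.
Variable R : comNzRingType.
Implicit Types A : 'I_3 -> 'M[R]_5.

Definition pair6 (t : nat) : 'I_3 * 'I_3 :=
  nth (inord 0, inord 0) [:: (inord 0, inord 0); (inord 0, inord 1); (inord 0, inord 2);
    (inord 1, inord 1); (inord 1, inord 2); (inord 2, inord 2)] t.

Definition pfW A : 'M[R]_(6, 5) :=
  \matrix_(t < 6) pf (A (pair6 t).1) (A (pair6 t).2).

(* The maximal minors of pfW A; by Cramer's rule they form the linear relation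
   among its rows. *)
Definition relC A : 'rV[R]_6 :=
  row 0 (\adj (row_mx 0 (pfW A) : 'M_(6, 1 + 5))).

(** Twice the Gram matrix of the quadratic form with coefficients c, so that no denominators occur
    over a polynomial ring. *)
Definition sym6 (c : 'rV[R]_6) : 'M[R]_3 :=
  let c' k := c 0 (inord k) in \matrix_(i, j)
  (nth [::] [:: [:: c' 0%N + c' 0%N; c' 1%N; c' 2%N]; [:: c' 1%N; c' 3%N + c' 3%N; c' 4%N];
             [:: c' 2%N; c' 4%N; c' 5%N + c' 5%N]] i)`_j.

Definition netS A : 'M[R]_3 := sym6 (relC A).

(** The determinant expresses that the conic is smooth. The other factor serves twice: as a pivot in
    [sym6_congr], and, being a maximal minor of [pfW A] up to a factor -2, to make the relation
    unique. *)
Definition net_inv A : R := netS A (inord 1) (inord 1) * \det (netS A).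

Lemma relC_mul A : relC A *m pfW A = 0.
Proof.
rewrite /relC -row_mul; have := mul_adj_mx (row_mx 0 (pfW A) : 'M_(6, 1 + 5)).
set B := \adj _; move=> E.
have d0 : \det (row_mx 0 (pfW A) : 'M_(6, 1 + 5)) = 0.
  rewrite (expand_det_col _ 0) big1 // => i _.
  have -> : (row_mx (0 : 'cV_6) (pfW A) : 'M_(6, 1 + 5)) i 0 = (0 : 'cV_6) i 0.
    by rewrite -[RHS](row_mxEl _ (pfW A)); congr (row_mx _ _ _ _); exact: val_inj.
  by rewrite mxE mul0r.
have E' : B *m row_mx (0 : 'cV_6) (pfW A) = 0 :> 'M_(6, 1 + 5).
  by rewrite -[RHS](raddf0 (@scalar_mx R 6)) -d0.
move: E'; rewrite mul_mx_row => /(congr1 (@rsubmx _ _ _ _)).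
by rewrite row_mxKr linear0 => ->; exact: row0.
Qed.
End NetInvariant.

Section NetField.
Variable K : numClosedFieldType.
Implicit Types A : 'I_3 -> 'M[K]_5.

Lemma sum3 (V : nmodType) (F : 'I_3 -> V) :
  \sum_i F i = F (inord 0) + F (inord 1) + F (inord 2).
Proof.
rewrite !big_ord_recl big_ord0 addr0 !addrA; congr (_ + _ + _);
  congr (F _); apply: val_inj; by rewrite /= inordK.
Qed.

Lemma sum6 (V : nmodType) (F : 'I_6 -> V) :
  \sum_i F i = F (inord 0) + F (inord 1) + F (inord 2) + F (inord 3) + F (inord 4) + F (inord 5).
Proof.
rewrite !big_ord_recl big_ord0 addr0 !addrA; congr (_ + _ + _ + _ + _ + _);
  congr (F _); apply: val_inj; by rewrite /= inordK.
Qed.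

Lemma relC3 A : relC A 0 (inord 3) =
  - \det (row' (inord 3) (pfW A)).
Proof.
rewrite /relC !mxE /cofactor inordK // addn0 -signr_odd expr1 mulN1r; congr (- \det _).
apply/matrixP => i j; rewrite [LHS]mxE [LHS]mxE [LHS]mxE [RHS]mxE; case: splitP => [k|k] /=.
  by rewrite ord1.
by rewrite /bump /= add1n => -[jk]; congr (pfW A _ _); exact: val_inj.
Qed.

Lemma relC_unique A (d : 'rV[K]_6) : relC A 0 (inord 3) != 0 -> d *m pfW A = 0 ->
  exists s, d = s *: relC A.
Proof.
set c := relC A; move=> c3 dW; exists (d 0 (inord 3) / c 0 (inord 3)).
pose e := d - (d 0 (inord 3) / c 0 (inord 3)) *: c.
suff : e = 0 by move/eqP; rewrite subr_eq0 => /eqP.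
have coE (u v : 'rV[K]_6) a k : (u - a *: v) 0 k = u 0 k - a * v 0 k by rewrite !mxE.
have e3 : e 0 (inord 3) = 0 by rewrite coE divfK // subrr.
have eW : e *m pfW A = 0 by rewrite mulmxBl dW -scalemxAl relC_mul scaler0 subr0.
have U : row' (inord 3) (pfW A) \in unitmx.
  rewrite unitmxE unitfE; apply: contraNneq c3 => d0.
  by rewrite /c relC3 d0 oppr0.
have : col' (inord 3) e *m row' (inord 3) (pfW A) = 0.
  rewrite -eW; apply/rowP => j; rewrite [LHS]mxE [RHS]mxE [RHS](bigD1_ord (inord 3)) //= e3 mul0r add0r.
  by apply: eq_bigr => i _; rewrite [in LHS]mxE [X in _ * X]mxE.
move/(congr1 (mulmx^~ (invmx (row' (inord 3) (pfW A))))); rewrite mulmxK // mul0mx => e0.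
apply/rowP => t; rewrite [RHS]mxE; have [->|t3] := eqVneq t (inord 3); first exact: e3.
have [u ->] : exists u, t = lift (inord 3) u.
  by rewrite eq_sym in t3; case: (unlift_some t3) => u tu _; exists u.
by have /rowP/(_ u) := e0; rewrite [LHS]mxE [RHS]mxE.
Qed.

Definition antidiag : 'M[K]_3 := \matrix_(i, j) (i + j == 2)%N%:R.

(** The pivot splits off a square. The remaining binary form al x^2 + 2 be x y + ga y^2 is the
    product of al x + ep y and x + (ga / ep) y, where ep is a root of ep^2 - 2 be ep + al ga. The
    three linear forms, scaled, are the rows of C. *)
Lemma sym6_congr (S : 'M[K]_3) : S^T = S -> S (inord 1) (inord 1) != 0 -> \det S != 0 ->
  exists2 C : 'M[K]_3, C \in unitmx & S = C^T *m antidiag *m C.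
Proof.
move=> ST S11 detS.
have Ss (i j : nat) : S (inord i) (inord j) = S (inord j) (inord i) by rewrite -[in LHS]ST mxE.
pose s i j := S (inord i) (inord j).
have S11' : s 1%N 1%N != 0 := S11.
pose al := s 0%N 0%N - s 0%N 1%N ^+ 2 / s 1%N 1%N.
pose be := s 0%N 2%N - s 0%N 1%N * s 1%N 2%N / s 1%N 1%N.
pose ga := s 2%N 2%N - s 1%N 2%N ^+ 2 / s 1%N 1%N.
have s10 : s 1%N 0%N = s 0%N 1%N := Ss 1%N 0%N.
have s20 : s 2%N 0%N = s 0%N 2%N := Ss 2%N 0%N.
have s21 : s 2%N 1%N = s 1%N 2%N := Ss 2%N 1%N.
have detE : \det S = s 1%N 1%N * (al * ga - be ^+ 2).
  rewrite (expand_det_row _ (inord 0)) sum3 /cofactor !inordK // !(expand_det_row _ 0).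
  rewrite !big_ord_recl !big_ord0 /cofactor !det_mx11 !mxE /=.
  have E (i j : 'I_3) : S i j = s i j by rewrite /s !inord_val.
  rewrite !E /= /bump /= !inordK //= ?s10 ?s20 ?s21 /al /be /ga.
  by field.
have disc : al * ga - be ^+ 2 != 0.
  by apply: contraNneq detS => d0; rewrite detE d0 mulr0.
(* As ep is a denominator, a nonzero root is chosen; both roots are zero only if be = al ga = 0,
   against [disc]. *)
have [ep ep0 epE] : exists2 ep : K, ep != 0 & ep ^+ 2 - 2 * be * ep + al * ga = 0.
  pose de := sqrtC (be ^+ 2 - al * ga); have deE : de ^+ 2 = be ^+ 2 - al * ga by rewrite sqrtCK.
  have [e0|e0] := eqVneq (be + de) 0.
    exists (be - de); last by rewrite -[al * ga](subKr (be ^+ 2)) -deE; ring.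
    apply: contra_neq disc => e1; have b0 : be = 0.
      have /eqP : 2 * be = 0.
        have -> : 2 * be = (be - de) + (be + de) by ring.
        by rewrite e1 e0 addr0.
      by rewrite mulf_eq0 pnatr_eq0 /= => /eqP.
    by move: e0 deE; rewrite b0 add0r => ->; rewrite expr0n /= sub0r => /esym/eqP; rewrite oppr_eq0 => /eqP ->; rewrite subrr.
  by exists (be + de); rewrite // -[al * ga](subKr (be ^+ 2)) -deE; ring.
pose si := sqrtC (s 1%N 1%N); have siE : si ^+ 2 = s 1%N 1%N by rewrite sqrtCK.
have si0 : si != 0 by rewrite sqrtC_eq0.
pose C : 'M[K]_3 := \matrix_(i, j) (nth [::] [:: [:: al; 0; ep];
   [:: s 0%N 1%N / si; s 1%N 1%N / si; s 1%N 2%N / si]; [:: 2^-1; 0; ga / (2 * ep)]] i)`_j.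
have CE i j : (C^T *m antidiag *m C) i j = C (inord 0) i * C (inord 2) j
    + C (inord 1) i * C (inord 1) j + C (inord 2) i * C (inord 0) j.
  have JE (k : 'I_3) : (C^T *m antidiag) i k = C (rev_ord k) i.
    have kk : (rev_ord k + k == 2)%N by have := ltn_ord k => /=; lia.
    rewrite mxE (bigD1 (rev_ord k)) //= mxE [antidiag _ _]mxE kk mulr1 big1 ?addr0 // => l lk.
    rewrite [antidiag _ _]mxE (_ : (l + k == 2)%N = false) ?mulr0 //.
    by apply: contraNF lk => lk; apply/eqP/val_inj => /=; lia.
  have r (a b : nat) : (a + b = 2)%N -> rev_ord (inord a : 'I_3) = inord b.
    by move=> ab; apply: val_inj; rewrite /= !inordK; lia.
  by rewrite mxE sum3 !JE (r 0%N 2%N) // (r 1%N 1%N) // (r 2%N 0%N) //; ring.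
have H02 : al * (ga / (2 * ep)) + 2^-1 * ep = be.
  have -> : al * (ga / (2 * ep)) + 2^-1 * ep = (ep ^+ 2 - 2 * be * ep + al * ga) / (2 * ep) + be by field.
  by rewrite epE mul0r add0r.
have H00 : s 0%N 0%N = al + s 0%N 1%N ^+ 2 / si ^+ 2 by rewrite siE /al; ring.
have H22 : s 2%N 2%N = ga + s 1%N 2%N ^+ 2 / si ^+ 2 by rewrite siE /ga; ring.
have H02' : s 0%N 2%N = al * (ga / (2 * ep)) + 2^-1 * ep + s 0%N 1%N * s 1%N 2%N / si ^+ 2.
  by rewrite H02 siE /be; ring.
have SE : S = C^T *m antidiag *m C.
  apply/matrixP => i j; rewrite CE; clearbody al be ga.
  have -> : S i j = s i j by rewrite /s !inord_val.
  rewrite !mxE !inordK //=.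
  case: i => [[|[|[|//]]] hi]; case: j => [[|[|[|//]]] hj] /=;
    rewrite ?s10 ?s20 ?s21 ?H00 ?H22 ?H02' -?siE; field; rewrite ?ep0 ?si0 //.
exists C => //.
have : S \in unitmx by rewrite unitmxE unitfE.
by rewrite SE unitmx_mul => /andP[].
Qed.
End NetField.

(** * Normal form of a net *)

Section NetNormal.
Variable K : numClosedFieldType.
Implicit Types A : 'I_3 -> 'M[K]_5.

Definition act (C : 'M[K]_3) A k : 'M[K]_5 := \sum_l C k l *: A l.

Definition tens A (X : 'M[K]_3) : 'rV[K]_5 := \sum_m \sum_n X m n *: pf (A m) (A n).

Lemma pf_suml (I : finType) (F : I -> 'M[K]_5) B : pf (\sum_i F i) B = \sum_i pf (F i) B.
Proof. by apply: (big_morph (fun X => pf X B)) => [x y|]; rewrite ?pfD ?pf0. Qed.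

Lemma pf_act C A k l :
  pf (act C A k) (act C A l) = \sum_m \sum_n (C k m * C l n) *: pf (A m) (A n).
Proof.
rewrite pf_suml; apply: eq_bigr => m _; rewrite pfZ pfC pf_suml scaler_sumr.
by apply: eq_bigr => n _; rewrite pfZ scalerA pfC.
Qed.

Lemma tens_act C A X : tens (act C A) X = tens A (C^T *m X *m C).
Proof.
rewrite /tens; under eq_bigr => k _ do under eq_bigr => l _ do rewrite pf_act scaler_sumr.
transitivity (\sum_k \sum_l \sum_m \sum_n (X k l * (C k m * C l n)) *: pf (A m) (A n)).
  by do 3![apply: eq_bigr => ? _]; rewrite scaler_sumr; apply: eq_bigr => n _; rewrite scalerA.
transitivity (\sum_m \sum_n \sum_k \sum_l (X k l * (C k m * C l n)) *: pf (A m) (A n)).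
  rewrite pair_bigA /= exchange_big /=.
  under eq_bigr => m _ do rewrite exchange_big /=.
  apply: eq_bigr => m _; apply: eq_bigr => n _; by rewrite pair_bigA.
apply: eq_bigr => m _; apply: eq_bigr => n _; rewrite mxE scaler_suml exchange_big /=.
apply: eq_bigr => l _; rewrite mxE !mulr_suml scaler_suml; apply: eq_bigr => k _.
by rewrite mxE; congr (_ *: _); ring.
Qed.

Definition entry3 (X : 'M[K]_3) (i j : nat) : K := X (inord i) (inord j).

(** Off-diagonal entries are doubled because the corresponding products occur twice in [tens]. *)
Definition row_of_sym (X : 'M[K]_3) : 'rV[K]_6 :=
  \row_t [:: entry3 X 0 0; 2 * entry3 X 0 1; 2 * entry3 X 0 2; entry3 X 1 1; 2 * entry3 X 1 2; entry3 X 2 2]`_t.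

Lemma pfW_row A (d : 'rV[K]_6) : d *m pfW A =
  d 0 (inord 0) *: pf (A (inord 0)) (A (inord 0)) + d 0 (inord 1) *: pf (A (inord 0)) (A (inord 1))
  + d 0 (inord 2) *: pf (A (inord 0)) (A (inord 2)) + d 0 (inord 3) *: pf (A (inord 1)) (A (inord 1))
  + d 0 (inord 4) *: pf (A (inord 1)) (A (inord 2)) + d 0 (inord 5) *: pf (A (inord 2)) (A (inord 2)).
Proof. by rewrite mulmx_sum_row sum6 /pfW !rowK !inordK. Qed.

Lemma tensE A X : X^T = X -> tens A X = row_of_sym X *m pfW A.
Proof.
move=> XT; have Xs (i j : 'I_3) : X i j = X j i by rewrite -[in LHS]XT mxE.
rewrite /tens !sum3 pfW_row !mxE !inordK //= /entry3.
rewrite (Xs (inord 1) (inord 0)) (Xs (inord 2) (inord 0)) (Xs (inord 2) (inord 1)).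
rewrite (pfC (A (inord 1)) (A (inord 0))) (pfC (A (inord 2)) (A (inord 0))).
rewrite (pfC (A (inord 2)) (A (inord 1))).
by apply/rowP => j; rewrite !mxE; ring.
Qed.

Lemma netS_sym A : (netS A)^T = netS A.
Proof.
apply/matrixP => i j; rewrite -(inord_val i) -(inord_val j) !mxE !inordK //.
by case: i => [[|[|[|//]]] hi]; case: j => [[|[|[|//]]] hj].
Qed.

Lemma row_of_sym6 (c : 'rV[K]_6) : row_of_sym (sym6 c) = 2 *: c.
Proof.
apply/rowP => t; rewrite -(inord_val t) !mxE !inordK //.
by case: t => [[|[|[|[|[|[|//]]]]]] h]; rewrite /= /entry3 !mxE !inordK //=; ring.
Qed.

Lemma row_of_symZ a X : row_of_sym (a *: X) = a *: row_of_sym X.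
Proof.
apply/rowP => t; rewrite -(inord_val t) !mxE !inordK //.
by case: t => [[|[|[|[|[|[|//]]]]]] h]; rewrite /= /entry3 !mxE; ring.
Qed.

Lemma row_of_sym_inj X Y : X^T = X -> Y^T = Y -> row_of_sym X = row_of_sym Y -> X = Y.
Proof.
move=> XT YT E; have E' t : (t < 6)%N -> row_of_sym X 0 (inord t) = row_of_sym Y 0 (inord t).
  by rewrite E.
have two : (2 : K) != 0 by rewrite pnatr_eq0.
have := E' 0%N isT; have := E' 1%N isT; have := E' 2%N isT; have := E' 3%N isT.
have := E' 4%N isT; have := E' 5%N isT; rewrite !mxE !inordK //= /entry3.
move=> h5 /(mulfI two) h4 h3 /(mulfI two) h2 /(mulfI two) h1 h0.
have Xs (i j : 'I_3) : X i j = X j i by rewrite -[in LHS]XT mxE.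
have Ys (i j : 'I_3) : Y i j = Y j i by rewrite -[in LHS]YT mxE.
apply/matrixP => i j; rewrite -(inord_val i) -(inord_val j).
case: i => [[|[|[|//]]] hi]; case: j => [[|[|[|//]]] hj] //=; by rewrite Xs Ys.
Qed.

(** The Gram matrices forced by [gram_determined], with the free parameter set to 1. *)
Definition stdnet (k : 'I_3) : 'M[K]_5 := \matrix_(i, j)
  (nth [::] (nth [::] [::
    [:: [:: 0; 0; 0; 0; 0]; [:: 0; 0; 0; 0; 1]; [:: 0; 0; 0; 1; 0];
        [:: 0; 0; -1; 0; 0]; [:: 0; -1; 0; 0; 0]];
    [:: [:: 0; 0; 0; 0; -2]; [:: 0; 0; 0; - 2^-1; 0]; [:: 0; 0; 0; 0; 0];
        [:: 0; 2^-1; 0; 0; 0]; [:: 2; 0; 0; 0; 0]];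
    [:: [:: 0; 0; 0; 1; 0]; [:: 0; 0; 1; 0; 0]; [:: 0; -1; 0; 0; 0];
        [:: -1; 0; 0; 0; 0]; [:: 0; 0; 0; 0; 0]]] k) i)`_j.

Lemma alternating_sum (I : finType) (c : I -> K) (F : I -> 'M[K]_5) :
  (forall i, alternating (F i)) -> alternating (\sum_i c i *: F i).
Proof.
move=> sF; split=> [i|i j]; rewrite !summxE.
  by rewrite big1 // => k _; have [F0 _] := sF k; rewrite mxE F0 mulr0.
by rewrite -sumrN; apply: eq_bigr => k _; have [_ FN] := sF k; rewrite !mxE FN mulrN.
Qed.

Lemma alternating_congr (M X : 'M[K]_5) : alternating X -> alternating (M *m X *m M^T).
Proof.
move=> [X0 XN]; have XT : X^T = - X by apply/matrixP => i j; rewrite !mxE XN.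
have N (i j : 'I_5) : (M *m X *m M^T) j i = - (M *m X *m M^T) i j.
  have -> : (M *m X *m M^T) j i = (M *m X *m M^T)^T i j by rewrite [RHS]mxE.
  by rewrite !trmx_mul trmxK XT mulNmx mulmxN mulmxA mxE.
split=> // i; have /eqP := N i i; rewrite -addr_eq0 -mulr2n mulrn_eq0 /=.
by move/eqP.
Qed.

(* For the Gram matrices g k of the net in the basis of quadratic covariants, the
   polarized identities pf(A) A = 0 leave a single free parameter g 0 2 3. *)
Lemma gram_determined (g : nat -> nat -> nat -> K) :
  (forall k i j, g k j i = - g k i j) ->
  (forall j, g 0%N 0%N j = 0) -> (forall j, g 1%N 2%N j = 0) -> (forall j, g 2%N 4%N j = 0) ->
  (forall j, g 1%N 0%N j = - 2 * g 0%N 1%N j) -> (forall j, g 2%N 0%N j = g 0%N 2%N j) ->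
  (forall j, g 0%N 2%N j = - 2 * g 1%N 1%N j) -> (forall j, g 2%N 2%N j = - 2 * g 1%N 3%N j) ->
  (forall j, g 0%N 4%N j = g 2%N 2%N j) -> (forall j, g 1%N 4%N j = - 2 * g 2%N 3%N j) ->
  (forall j, g 0%N 3%N j = - g 2%N 1%N j) ->
  forall k i j : nat, (k < 3)%N -> (i < 5)%N -> (j < 5)%N ->
    g k i j = g 0%N 2%N 3%N * stdnet (inord k) (inord i) (inord j).
Proof.
move=> gs a0 a1 a2 ra rb rc rd re rf rh.
have half (x : K) : 2 * x = 0 -> x = 0 by move/eqP; rewrite mulf_eq0 pnatr_eq0 /= => /eqP.
have gd k i : g k i i = 0 by apply: (half _); have := gs k i i => E; rewrite mulr_natl mulr2n {1}E addNr.
set be := g 0%N 2%N 3%N.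
have h012 : g 0%N 1%N 2%N = 0 by rewrite gs rc gd mulr0 oppr0.
have h022 : g 2%N 0%N 2%N = 0 by rewrite rb gd.
have h013 : g 0%N 1%N 3%N = 0.
  apply: (half _); rewrite -[LHS]opprK -mulNr -ra gs opprK; apply: half.
  by rewrite -[LHS]opprK -mulNr -rd gs h022 !oppr0.
have h024 : g 0%N 2%N 4%N = 0 by rewrite -rb gs a2 oppr0.
have h034 : g 0%N 3%N 4%N = 0 by rewrite rh gs a2 !oppr0.
have h101 : g 1%N 0%N 1%N = 0 by rewrite ra gd mulr0.
have h103 : g 1%N 0%N 3%N = 0 by rewrite ra h013 mulr0.
have h113 : g 1%N 1%N 3%N = - 2^-1 * be.
  rewrite /be rc; by field.
have h114 : g 1%N 1%N 4%N = 0.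
  by apply: (half _); rewrite -[LHS]opprK -mulNr -rc h024 oppr0.
have h134 : g 1%N 3%N 4%N = 0.
  by apply: (half _); rewrite -[LHS]opprK -mulNr -rd gs a2 !oppr0.
have h201 : g 2%N 0%N 1%N = 0 by rewrite rb gs h012 oppr0.
have h203 : g 2%N 0%N 3%N = be by rewrite rb.
have h212 : g 2%N 1%N 2%N = be by rewrite -[LHS]opprK -rh gs opprK.
have h213 : g 2%N 1%N 3%N = 0 by rewrite -[LHS]opprK -rh gd oppr0.
have h223 : g 2%N 2%N 3%N = 0 by rewrite rd gd mulr0.
have h014 : g 0%N 1%N 4%N = be by rewrite gs re gs h212 opprK.
have h104 : g 1%N 0%N 4%N = - 2 * be by rewrite ra h014.
have up k i j : (i < j)%N -> (k < 3)%N -> (j < 5)%N -> 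
    g k i j = be * stdnet (inord k) (inord i) (inord j).
  move=> ij k3 j5; have i5 := ltn_trans ij j5; rewrite mxE !inordK //.
  case: k k3 => [|[|[|//]]] _; case: j j5 ij => [|[|[|[|[|//]]]]] _;
   case: i i5 => [|[|[|[|//]]]] _ //= _;
   rewrite ?h012 ?h022 ?h013 ?h024 ?h034 ?h101 ?h103 ?h113 ?h114 ?h134 ?h201 ?h203 ?h212 ?h213 ?h223 ?h014 ?h104 ?a0 ?a1 -/be;
   first [by ring | rewrite gs ?a1 ?a2; by ring].
move=> k i j k3 i5 j5; case: (ltngtP i j) => [ij|ij|->]; first exact: up.
  rewrite gs up // -mulrN; congr (_ * _); rewrite !mxE !inordK //.
  case: k k3 => [|[|[|//]]] _; case: j j5 ij => [|[|[|[|[|//]]]]] _;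
   case: i i5 => [|[|[|[|[|//]]]]] _ //= _; by ring.
rewrite gd mxE !inordK //.
by case: k k3 => [|[|[|//]]] _; case: j j5 => [|[|[|[|[|//]]]]] _ /=; ring.
Qed.

(** After the change of basis C the relation reads 2 pf(B_0, B_2) + pf(B_1, B_1) = 0, and it is the
    only one. So the five products other than pf(B_0, B_2) form a basis of K^5, the rows of M, and
    the identities [pf_mul] become the hypotheses of [gram_determined]. *)
Theorem net_normal_form A : (forall k, alternating (A k)) -> net_inv A != 0 ->
  exists (C : 'M[K]_3) (M : 'M[K]_5) (be : K),
    [/\ C \in unitmx, M \in unitmx, be != 0 &
        forall k, M *m act C A k *m M^T = be *: stdnet k].
Proof.
move=> sA; rewrite /net_inv mulf_eq0 negb_or => /andP[S11 dS].
have [C CU SC] := sym6_congr (netS_sym A) S11 dS.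
have two : (2 : K) != 0 by rewrite pnatr_eq0.
have c3 : relC A 0 (inord 3) != 0.
  apply: contraNneq S11; rewrite /netS; set c := relC A => c3.
  by rewrite mxE !inordK //= c3 addr0.
pose B := act C A; have sB k : alternating (B k) by exact: alternating_sum.
have JT : (antidiag K)^T = antidiag K.
  by apply/matrixP => i j; rewrite !mxE addnC.
have BS : tens B (antidiag K) = 0.
  by rewrite tens_act -SC tensE ?netS_sym // row_of_sym6 -scalemxAl relC_mul scaler0.
have Bker X : X^T = X -> tens B X = 0 -> exists s, X = s *: antidiag K.
  move=> XT; pose Y := C^T *m X *m C; have YT : Y^T = Y by rewrite !trmx_mul trmxK XT mulmxA.
  rewrite tens_act -/Y tensE // => /(relC_unique c3)[s sE].
  have YE : Y = (s / 2) *: netS A.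
    apply: row_of_sym_inj => //; first by rewrite linearZ /= netS_sym.
    by rewrite row_of_symZ row_of_sym6 sE scalerA divfK.
  exists (s / 2); have CTU : C^T \in unitmx by rewrite unitmx_tr.
  apply: (can_inj (mulKmx CTU)); apply: (can_inj (mulmxK CU)).
  by rewrite -/Y YE SC -scalemxAr -scalemxAl.
pose q i j := pf (B (inord i)) (B (inord j)).
have q02 : q 0%N 2%N = (- 2^-1) *: q 1%N 1%N.
  move: BS; rewrite tensE // pfW_row !mxE !inordK //= /entry3 !mxE !inordK //=.
  rewrite !mulr0 !scale0r !addr0 !add0r mulr1 scale1r => /eqP; rewrite addr_eq0 => /eqP E.
  by rewrite /q -[LHS]scale1r -[X in X *: _ = _](mulVf two) -scalerA E scalerN scaleNr.
pose M : 'M[K]_5 := \matrix_i (nth 0 [:: q 0%N 0%N; q 0%N 1%N; q 1%N 1%N; q 1%N 2%N; q 2%N 2%N] i).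
pose b i := nth 0 [:: q 0%N 0%N; q 0%N 1%N; q 1%N 1%N; q 1%N 2%N; q 2%N 2%N] i.
have rM (i : 'I_5) : row i M = b i by rewrite rowK.
(* A relation among the rows of M is a symmetric X with [tens B X = 0] and entry (0, 2) equal to 0;
   by [Bker] it is a multiple of [antidiag], whose entry there is 1. *)
have MU : M \in unitmx.
  rewrite -row_free_unit -kermx_eq0; apply/eqP/row_matrixP => i; rewrite row0.
  have : row i (kermx M) *m M = 0 by rewrite -row_mul mulmx_ker row0.
  move: (row i (kermx M)) => v.
  pose X : 'M[K]_3 := \matrix_(i, j) (nth [::] [::
    [:: v 0 (inord 0); v 0 (inord 1) / 2; 0]; [:: v 0 (inord 1) / 2; v 0 (inord 2); v 0 (inord 3) / 2];
    [:: 0; v 0 (inord 3) / 2; v 0 (inord 4)]] i)`_j.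
  have XT : X^T = X.
    apply/matrixP => k l; rewrite -(inord_val k) -(inord_val l) !mxE !inordK //.
    by case: k => [[|[|[|//]]] hk]; case: l => [[|[|[|//]]] hl].
  have -> : v *m M = tens B X.
    rewrite mulmx_sum_row sum5 !rM /b !inordK //= tensE // pfW_row -/(q _ _).
    rewrite ![row_of_sym _ _ _]mxE !inordK //= /entry3 ![X _ _]mxE !inordK //=.
    have h2 (x : K) : 2 * (x / 2) = x by field.
    by rewrite !h2 mulr0 scale0r addr0.
  move=> /(Bker X XT)[t tE].
  have t0 : t = 0.
    have /matrixP/(_ (inord 0) (inord 2)) := tE; rewrite !mxE !inordK //= mulr1 => <- //.
  move: tE; rewrite t0 scale0r => /matrixP XE.
  have E (k l : nat) : X (inord k) (inord l) = 0 by rewrite XE mxE.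
  move: (E 0 0)%N (E 0 1)%N (E 1 1)%N (E 1 2)%N (E 2 2)%N; rewrite !mxE !inordK //=.
  move=> v0 /eqP; rewrite mulf_eq0 invr_eq0 (negPf two) orbF => /eqP v1 v2 /eqP.
  rewrite mulf_eq0 invr_eq0 (negPf two) orbF => /eqP v3 v4.
  by apply/rowP => k; rewrite [RHS]mxE -(inord_val k); case: k => [[|[|[|[|[|//]]]]] hk].
clearbody M; pose f (x : 'rV_5) k j := (x *m B (inord k) *m (b j)^T) 0 0.
have fZ a x k j : f (a *: x) k j = a * f x k j by rewrite /f -!scalemxAl mxE.
have fD x y k j : f (x + y) k j = f x k j + f y k j by rewrite /f !mulmxDl mxE.
have gM k (i j : 'I_5) : (M *m B (inord k) *m M^T) i j = f (b i) k j.
  rewrite /f -!rM -row_mul mxE [RHS]mxE; apply: eq_bigr => l _.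
  by rewrite [row _ _ _ _]mxE [M^T _ _]mxE [_^T _ _]mxE [row _ _ _ _]mxE.
have R k l m j : f (q l m) k j + f (q k m) l j + f (q k l) m j = 0.
  have e3 (x y z : 'M[K]_1) : x + y + z = 0 -> x 0 0 + y 0 0 + z 0 0 = 0.
    by move=> /matrixP/(_ 0 0); rewrite !mxE.
  by apply: e3; rewrite -!mulmxDl pf_mul ?mul0mx.
have qC k l : q k l = q l k by exact: pfC.
have gs k i j : f (b j) k i = - f (b i) k j.
  have [B0 BN] := sB (inord k); have BT : (B (inord k))^T = - B (inord k).
    by apply/matrixP => u v; rewrite !mxE BN.
  rewrite /f; have -> : (b i *m B (inord k) *m (b j)^T) 0 0 = (b i *m B (inord k) *m (b j)^T)^T 0 0.
    by rewrite [RHS]mxE.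
  by rewrite !trmx_mul trmxK BT mulNmx mulmxN mulmxA [in RHS]mxE opprK.
have three x : x + x + x = 0 :> K -> x = 0.
  by rewrite -mulr2n -mulrSr => /eqP; rewrite mulrn_eq0 => /eqP.
have gram := @gram_determined (fun k i j => f (b i) k j) gs.
have {gram}gE : forall k i j : nat, (k < 3)%N -> (i < 5)%N -> (j < 5)%N ->
    f (b i) k j = f (b 2%N) 0%N 3%N * stdnet (inord k) (inord i) (inord j).
  apply: gram => j; rewrite /b /=.
  - by apply: three; exact: (R 0 0 0 j)%N.
  - by apply: three; exact: (R 1 1 1 j)%N.
  - by apply: three; exact: (R 2 2 2 j)%N.
  - have E := R 0%N 0%N 1%N j; apply/eqP; rewrite -subr_eq0 -[X in _ == X]E; apply/eqP; by field.
  - have E := R 0%N 0%N 2%N j; rewrite q02 !fZ in E; apply/eqP; rewrite -subr_eq0 -[X in _ == X]E; apply/eqP; by field.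
  - have E := R 0%N 1%N 1%N j; apply/eqP; rewrite -subr_eq0 -[X in _ == X]E; apply/eqP; by field.
  - have E := R 1%N 1%N 2%N j; apply/eqP; rewrite -subr_eq0 -[X in _ == X]E; apply/eqP; by field.
  - have E := R 0%N 2%N 2%N j; rewrite q02 !fZ in E; apply/eqP; rewrite -subr_eq0 -[X in _ == X]E; apply/eqP; by field.
  - have E := R 1%N 2%N 2%N j; apply/eqP; rewrite -subr_eq0 -[X in _ == X]E; apply/eqP; by field.
  - have E := R 0%N 1%N 2%N j; rewrite q02 fZ in E.
    have E' : f (q 1%N 1%N) 1%N j = 0 by apply: three; exact: (R 1 1 1 j)%N.
    by apply/eqP; rewrite -subr_eq0 -[X in _ == X]E E'; apply/eqP; by field.
exists C, M, (f (b 2%N) 0%N 3%N).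
have key k : M *m B k *m M^T = f (b 2%N) 0%N 3%N *: stdnet k.
  rewrite -(inord_val k); apply/matrixP => i j; rewrite gM gE // [RHS]mxE !inord_val //.
(* A zero parameter would kill the net, hence its Pfaffian vectors and a row of the invertible M. *)
split=> //; apply/eqP => be0.
have Bz k : B k = 0.
  apply: (can_inj (mulKmx MU)); have MTU : M^T \in unitmx by rewrite unitmx_tr.
  by apply: (can_inj (mulmxK MTU)); rewrite key be0 scale0r mulmx0 mul0mx.
have b00 : b 0%N = 0 by rewrite /b /= /q Bz pf0.
have := rM 0; rewrite b00 => r0.
have : delta_mx 0 0 *m M = (0 : 'rV_5) by rewrite -rowE r0.
move/(congr1 (mulmx^~ (invmx M))); rewrite (mulmxK MU) mul0mx => /rowP/(_ 0).
by rewrite !mxE eqxx => /eqP; rewrite oner_eq0.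
Qed.
End NetNormal.

(** * Plücker coordinates of lines as alternating matrices *)

Lemma ltn_tuple_sorted k n (i : 'I_'C(n, k)) : sorted ltn [seq val j | j <- ltn_tuple i].
Proof. by have := enum_valP (cast_ord (esym (card_ltn_sorted_tuples k n)) i); rewrite inE. Qed.

Lemma ltn_tuple_inj k n : injective (@ltn_tuple k n).
Proof. by move=> i j /enum_val_inj /cast_ord_inj. Qed.

Lemma ltn_tuple_surj k n (t : k.-tuple 'I_n) : sorted ltn [seq val j | j <- t] ->
  exists i, ltn_tuple i = t.
Proof.
move=> st; have tS : t \in [set t : k.-tuple 'I_n | sorted ltn [seq val j | j <- t]] by rewrite inE.
exists (cast_ord (card_ltn_sorted_tuples k n) (enum_rank_in tS t)).
by rewrite /ltn_tuple cast_ordK enum_rankK_in.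
Qed.

Section Pairs.
Local Notation NN := 'C(5, 2).

Definition fst2 (t : 'I_NN) : 'I_5 := tnth (ltn_tuple t) ord0.
Definition snd2 (t : 'I_NN) : 'I_5 := tnth (ltn_tuple t) (lift ord0 ord0).

Lemma ltn_tuple2 t : ltn_tuple t = [tuple fst2 t; snd2 t].
Proof.
apply: eq_from_tnth => -[[|[|//]]] h; rewrite [RHS](tnth_nth (fst2 t)) /=;
  by congr (tnth _ _); exact: val_inj.
Qed.

Lemma fst_lt_snd t : (fst2 t < snd2 t)%N.
Proof. by have := ltn_tuple_sorted t; rewrite ltn_tuple2 /= andbT. Qed.

Lemma pair_inj s t : fst2 s = fst2 t -> snd2 s = snd2 t -> s = t.
Proof. by move=> e1 e2; apply: ltn_tuple_inj; rewrite !ltn_tuple2 e1 e2. Qed.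

Lemma pair_surj (i j : 'I_5) : (i < j)%N -> exists t, fst2 t = i /\ snd2 t = j.
Proof.
move=> ij; have [|t tE] := @ltn_tuple_surj 2 5 [tuple i; j]; first by rewrite /= andbT.
by exists t; rewrite /fst2 /snd2 tE !(tnth_nth i).
Qed.

(** The default index is an arbitrary one, never reached when i < j. *)
Definition pidx (i j : 'I_5) : 'I_NN :=
  odflt (cast_ord (erefl 10%N : 10%N = NN) ord0) [pick t | (fst2 t == i) && (snd2 t == j)].

Lemma pidxP (i j : 'I_5) : (i < j)%N -> fst2 (pidx i j) = i /\ snd2 (pidx i j) = j.
Proof.
move=> /pair_surj[t [ti tj]]; rewrite /pidx; case: pickP => [s /andP[/eqP ? /eqP ?] //|/(_ t)].
by rewrite ti tj !eqxx.
Qed.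

Variable R : comNzRingType.

Definition skm (p : 'rV[R]_NN) : 'M[R]_5 := \matrix_(i, j)
  (if (i < j)%N then p 0 (pidx i j) else if (j < i)%N then - p 0 (pidx j i) else 0).

Definition upr (Z : 'M[R]_5) : 'rV[R]_NN := \row_t Z (fst2 t) (snd2 t).

Lemma skm_alternating p : alternating (skm p).
Proof.
split=> [i|i j]; rewrite !mxE ?ltnn //.
by case: (ltngtP i j) => _; rewrite ?opprK ?oppr0.
Qed.

Lemma skmK p : upr (skm p) = p.
Proof.
apply/rowP => t; rewrite !mxE fst_lt_snd; congr (p 0 _).
by have [e1 e2] := pidxP (fst_lt_snd t); exact: pair_inj.
Qed.

Lemma uprK Z : alternating Z -> skm (upr Z) = Z.
Proof.
move=> [Z0 ZN]; apply/matrixP => i j; rewrite !mxE.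
case: (ltngtP i j) => [ij|ij|/val_inj ->]; last by rewrite Z0.
  by have [-> ->] := pidxP ij.
by have [-> ->] := pidxP ij; rewrite ZN opprK.
Qed.

Lemma upr_linear : linear upr.
Proof. by move=> a X Y; apply/rowP => t; rewrite !mxE. Qed.

HB.instance Definition _ := GRing.isLinear.Build R 'M[R]_5 'rV[R]_NN _ upr upr_linear.

Lemma skm_linear : linear skm.
Proof.
move=> a X Y; apply/matrixP => i j; rewrite !mxE.
by case: (ltngtP i j) => _; ring.
Qed.

HB.instance Definition _ := GRing.isLinear.Build R 'rV[R]_NN 'M[R]_5 _ skm skm_linear.

(** The pairing of points with hyperplanes becomes a trace, in which a congruence by M on one side
    is balanced by the inverse congruence on the other. *)
Lemma trace_pairing (n p : 'rV[R]_NN) :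
  \tr (skm n *m skm p) = - ((\sum_t n 0 t * p 0 t) *+ 2).
Proof.
have -> : \tr (skm n *m skm p) = - \sum_i \sum_j skm n i j * skm p i j.
  rewrite /mxtrace -sumrN; apply: eq_bigr => i _; rewrite mxE -sumrN.
  by apply: eq_bigr => j _; rewrite -mulrN; have [_ ->] := skm_alternating p; rewrite opprK.
congr (- _); rewrite pair_bigA /=.
have half : \sum_(ij : 'I_5 * 'I_5 | (ij.1 < ij.2)%N) skm n ij.1 ij.2 * skm p ij.1 ij.2
    = \sum_t n 0 t * p 0 t.
  rewrite (reindex (fun t => (fst2 t, snd2 t))) /=.
    apply: eq_big => [t|t _]; first by rewrite fst_lt_snd.
    by rewrite -[in RHS](skmK n) -[in RHS](skmK p) ![upr _ _ _]mxE.
  exists (fun ij => pidx ij.1 ij.2) => [t _|[i j] /= ij].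
    by have [e1 e2] := pidxP (fst_lt_snd t); exact: pair_inj.
  by have [-> ->] := pidxP ij.
rewrite (bigID (fun ij : 'I_5 * 'I_5 => (ij.1 < ij.2)%N)) /= half mulr2n; congr (_ + _).
rewrite (bigID (fun ij : 'I_5 * 'I_5 => (ij.2 < ij.1)%N)) /= [X in _ + X]big1 ?addr0.
  pose sw (ij : 'I_5 * 'I_5) := (ij.2, ij.1); have swK : involutive sw by case.
  rewrite -half (reindex_inj (inv_inj swK)); apply: eq_big => [[i j]|[i j] _] /=.
    by case: (ltngtP i j).
  have [_ Nn] := skm_alternating n; have [_ Np] := skm_alternating p.
  by rewrite (Nn i j) (Np i j) mulrNN.
move=> [i j] /= /andP[]; rewrite -!leqNgt => ij ji.
have -> : i = j by apply/val_inj/eqP; rewrite eqn_leq ji ij.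
by have [Nn _] := skm_alternating n; rewrite Nn mul0r.
Qed.

End Pairs.

(** * The Grassmannian of lines *)

Section GrassBasis.
Variables (F : fieldType) (k n : nat).
Implicit Types U : grass F k n.

Definition grass_mx U : 'M[F]_(k, n) := \matrix_(i < k) (vbasis (val U))`_i.

Lemma grass_mx_in U i : row i (grass_mx U) \in val U.
Proof.
rewrite rowK; apply/vbasis_mem/mem_nth.
by rewrite size_tuple (eqP (valP U)).
Qed.

Lemma grass_mx_span U (v : 'rV[F]_n) : v \in val U -> exists a, v = a *m grass_mx U.
Proof.
case: U => V dV; rewrite /grass_mx /=; case: k / (eqP dV) => vV.
exists (\row_i coord (vbasis V) i v); rewrite {1}(coord_vbasis vV) mulmx_sum_row.
by apply: eq_bigr => i _; rewrite rowK mxE.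
Qed.

Lemma grass_mx_factor U m (A : 'M[F]_(m, n)) : (forall i, row i A \in val U) ->
  exists G, A = G *m grass_mx U.
Proof.
move=> AU; have [G GE] := choice (fun i => grass_mx_span (AU i)).
by exists (\matrix_i G i); apply/row_matrixP => i; rewrite row_mul rowK.
Qed.

Lemma grass_mx_free U : row_free (grass_mx U).
Proof.
rewrite -kermx_eq0; apply/eqP/row_matrixP => i; rewrite row0.
have : row i (kermx (grass_mx U)) *m grass_mx U = 0 by rewrite -row_mul mulmx_ker row0.
move: (row i _) => v; case: U => V dV; rewrite /grass_mx /=.
case: k / (eqP dV) v => v E; apply/rowP => j; rewrite mxE.
have := basis_free (vbasisP V) => /freeP/(_ (fun i => v 0 i)); apply.
rewrite -[RHS]E mulmx_sum_row; apply: eq_bigr => l _; by rewrite rowK.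
Qed.
End GrassBasis.

Section Decomposable.
Variable K : numClosedFieldType.
Local Notation NN := 'C(5, 2).

Lemma wedge2 (A : 'M[K]_(2, 5)) : wedge A =
  upr ((row 0 A)^T *m row 1 A - (row 1 A)^T *m row 0 A).
Proof.
apply/rowP => t; rewrite !mxE !big_ord_recl !big_ord0 /=.
rewrite (expand_det_row _ 0) !big_ord_recl !big_ord0 /cofactor !det_mx11 !mxE /= /bump /=.
rewrite /fst2 /snd2 !(expr0, expr1) !addr0 mul1r mulN1r mulrN.
have o2 (i j : 'I_2) : nat_of_ord i = j -> i = j by move/val_inj.
by congr (A _ _ * A _ _ - _); rewrite 1?mulrC; do ?congr (_ * _); do ?congr (A _ _); do ?congr (tnth _ _); apply: o2.
Qed.

Lemma alternating_wedge (u v : 'rV[K]_5) : alternating (u^T *m v - v^T *m u).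
Proof.
have E (i j : 'I_5) : (u^T *m v - v^T *m u) i j = u 0 i * v 0 j - v 0 i * u 0 j.
  by rewrite !mxE !big_ord1 !mxE.
by split=> [i|i j]; rewrite !E; ring.
Qed.

Lemma pf_wedge (u v : 'rV[K]_5) : pf (u^T *m v - v^T *m u) (u^T *m v - v^T *m u) = 0.
Proof.
have E (i j : 'I_5) : (u^T *m v - v^T *m u) i j = u 0 i * v 0 j - v 0 i * u 0 j.
  by rewrite !mxE !big_ord1 !mxE.
apply/rowP => k; rewrite -(inord_val k) [RHS]mxE.
by case: k => [[|[|[|[|[|//]]]]] h]; rewrite pf_entry //= /pf4 /entry !E; ring.
Qed.

(** The Pfaffians are the Plücker relations, up to a factor 2: Z_ab Z_ij = Z_ai Z_bj - Z_bi Z_aj. If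
    Z_ab is nonzero, Z is therefore the wedge of its rows a and b, divided by Z_ab. *)
Lemma pf_decomposable (Z : 'M[K]_5) : alternating Z -> pf Z Z = 0 ->
  exists u v : 'rV[K]_5, Z = u^T *m v - v^T *m u.
Proof.
move=> aZ pZ; have sZ := alternatingE aZ.
have P k : (k < 5)%N -> pf Z Z 0 (inord k) = 0 by rewrite pZ mxE.
have P0 := P 0%N isT; have P1 := P 1%N isT; have P2 := P 2%N isT.
have P3 := P 3%N isT; have P4 := P 4%N isT.
rewrite pf_entry //= /pf4 in P0; rewrite pf_entry //= /pf4 in P1.
rewrite pf_entry //= /pf4 in P2; rewrite pf_entry //= /pf4 in P3.
rewrite pf_entry //= /pf4 in P4.
have two : (2 : K) != 0 by rewrite pnatr_eq0.
have key a b i j : (a < b < 5)%N -> (i < j < 5)%N ->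
    entry Z a b * entry Z i j - entry Z a i * entry Z b j + entry Z a j * entry Z b i = 0.
  move=> /andP[ab b5] /andP[ij j5]; apply: (mulfI two); rewrite mulr0.
  case: b b5 ab => [|[|[|[|[|//]]]]] _; case: a => [|[|[|[|//]]]] //= _;
  case: j j5 ij => [|[|[|[|[|//]]]]] _; case: i => [|[|[|[|//]]]] //= _;
  rewrite ?sZ; first
   [ by ring | by rewrite -P0; ring | by rewrite -P1; ring | by rewrite -P2; ring
   | by rewrite -P3; ring | by rewrite -P4; ring | by rewrite -oppr0 -P0; ring
   | by rewrite -oppr0 -P1; ring | by rewrite -oppr0 -P2; ring
   | by rewrite -oppr0 -P3; ring | by rewrite -oppr0 -P4; ring ].
have [Z0|/existsNP[a /existsNP[b /eqP Zab]]] := pselect (forall i j : 'I_5, Z i j = 0).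
  exists 0, 0; rewrite mulmx0 subr0; apply/matrixP => i j; rewrite Z0 mxE //.
have [Zd ZN] := aZ.
wlog ab : a b Zab / (a < b)%N.
  move=> H; case: (ltngtP a b) => [|ba|/val_inj E]; first exact: H.
    by apply: (H b a) => //; rewrite ZN oppr_eq0.
  by move: Zab; rewrite E Zd eqxx.
exists ((Z a b)^-1 *: row a Z), (row b Z).
apply/matrixP => i j.
have E (u v : 'rV[K]_5) : (u^T *m v - v^T *m u) i j = u 0 i * v 0 j - v 0 i * u 0 j.
  by rewrite !mxE !big_ord1 !mxE.
rewrite E ![row _ _ _ _]mxE ![(_ *: row _ _ : 'rV_5) _ _]mxE ![row _ _ _ _]mxE.
suff H : Z a b * Z i j = Z a i * Z b j - Z b i * Z a j.
  by apply: (mulfI Zab); rewrite H; field.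
have key' (i' j' : 'I_5) : (i' < j')%N -> Z a b * Z i' j' = Z a i' * Z b j' - Z b i' * Z a j'.
  move=> ij; have := key a b i' j'; rewrite ab ij !ltn_ord /entry !inord_val => /(_ isT isT) /eqP.
  by rewrite -addrA addr_eq0 => /eqP ->; ring.
case: (ltngtP i j) => [ij|ji|/val_inj ->]; first exact: key'.
  by rewrite (ZN j i) mulrN key' //; ring.
by rewrite Zd mulr0; ring.
Qed.

Lemma plucker_imageP (y : proj K NN) (p : 'rV[K]_NN) : val y = <[p]>%VS ->
  @plucker_image K 2 5 y <-> pf (skm p) (skm p) = 0.
Proof.
move=> yE; have p0 : p != 0.
  by apply: contraTneq (valP y) => p0; rewrite yE p0 dim_vline eqxx.
split=> [[U yU]|].
  have : p \in <[plucker U]>%VS by rewrite -yU yE memv_line.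
  case/vlineP => c ->; rewrite /plucker wedge2 linearZ /= uprK; last exact: alternating_wedge.
  by rewrite pfZ pfC pfZ pf_wedge !scaler0.
move=> /(pf_decomposable (skm_alternating p))[u [v uv]].
have uv0 : u^T *m v - v^T *m u != 0.
  by apply: contraNneq p0 => E; rewrite -(skmK p) uv E linear0.
pose A : 'M[K]_(2, 5) := col_mx u v.
have r0 : row 0 A = u.
  transitivity (row (lshift 1 0) (col_mx u v)); first by congr (row _ _); exact: val_inj.
  by rewrite rowKu row_id.
have r1 : row 1 A = v.
  transitivity (row (rshift 1 0) (col_mx u v)); first by congr (row _ _); exact: val_inj.
  by rewrite rowKd row_id.
have pA : p = wedge A by rewrite wedge2 r0 r1 -uv skmK.
have fr : free [:: u; v].
  rewrite free_cons span_seq1 seq1_free; apply/andP; split.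
    apply: contra uv0 => /vlineP[a ->]; apply/eqP.
    by rewrite linearZ /= -scalemxAl -scalemxAr subrr.
  by apply: contraNneq uv0 => ->; rewrite mulmx0 linear0 mul0mx subrr.
have dU : \dim <<[:: u; v]>> == 2 by have := fr; rewrite /free.
pose U : grass K 2 5 := exist _ <<[:: u; v]>>%VS dU.
have [|G GE] := @grass_mx_factor _ _ _ U _ A.
  move=> i; have : i = 0 \/ i = 1 by case: i => [[|[|//]]] h; [left | right]; apply: val_inj.
  by case=> ->; rewrite ?r0 ?r1 memv_span // !inE eqxx ?orbT.
exists U; rewrite yE pA GE wedge_mulmx vlineZ //.
by apply: contraNneq p0 => G0; rewrite pA GE wedge_mulmx G0 scale0r.
Qed.
End Decomposable.

(** * The section defined by the standard net *)

Section StandardSection.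
Variable K : numClosedFieldType.
Implicit Types x : 'rV[K]_7.
Local Notation NN := 'C(5, 2).

(* The alternating matrices annihilated by stdnet; the coefficients are chosen so
   that their Pfaffians are proportional to the quadrics q4, ..., q8. *)
Definition Zx x : 'M[K]_5 :=
  let a := co x 0 in let b := co x 1 in let c := - (2 / 3) * co x 2 in
  let d := 4 / 27 * co x 3 in let e := 4 / 27 * co x 4 in
  let f := 4 / 81 * co x 5 in let g := - (8 / 729) * co x 6 in
  \matrix_(i, j) (nth [::] [::
    [:: 0; a; b; c; d]; [:: - a; 0; - c; - (4 * d); e]; [:: - b; c; 0; - e; f];
    [:: - c; 4 * d; e; 0; g]; [:: - d; - e; - f; - g; 0]] i)`_j.

Lemma entry_Zx x (i j : nat) : (i < 5)%N -> (j < 5)%N -> entry (Zx x) i j =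
  let a := co x 0 in let b := co x 1 in let c := - (2 / 3) * co x 2 in
  let d := 4 / 27 * co x 3 in let e := 4 / 27 * co x 4 in
  let f := 4 / 81 * co x 5 in let g := - (8 / 729) * co x 6 in
  (nth [::] [::
    [:: 0; a; b; c; d]; [:: - a; 0; - c; - (4 * d); e]; [:: - b; c; 0; - e; f];
    [:: - c; 4 * d; e; 0; g]; [:: - d; - e; - f; - g; 0]] i)`_j.
Proof. by move=> hi hj; rewrite /entry mxE !inordK. Qed.

Lemma matrix5P (X Y : 'M[K]_5) :
  (forall i j : nat, (i < 5)%N -> (j < 5)%N -> entry X i j = entry Y i j) -> X = Y.
Proof.
move=> XY; apply/matrixP => i j; have := XY i j (ltn_ord i) (ltn_ord j).
by rewrite /entry !inord_val.
Qed.

Lemma Zx_linear : linear Zx.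
Proof.
move=> s x y; apply/matrixP => i j; rewrite -(inord_val i) -(inord_val j).
rewrite -/(entry (Zx (s *: x + y)) i j) [RHS]mxE [X in _ = X + _]mxE.
rewrite -/(entry (Zx x) i j) -/(entry (Zx y) i j) !entry_Zx //= !mxE.
case: i => [[|[|[|[|[|//]]]]] hi]; case: j => [[|[|[|[|[|//]]]]] hj] /=; ring.
Qed.

Lemma Zx_alternating x : alternating (Zx x).
Proof.
have E (i j : 'I_5) : Zx x i j = entry (Zx x) i j by rewrite /entry !inord_val.
split=> [i|i j]; rewrite !E !entry_Zx //=.
  by case: i => [[|[|[|[|[|//]]]]] hi].
by case: i => [[|[|[|[|[|//]]]]] hi]; case: j => [[|[|[|[|[|//]]]]] hj] /=; ring.
Qed.

Lemma Zx_eq0 x : Zx x = 0 -> x = 0.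
Proof.
move=> Z0; have E (i j : nat) : entry (Zx x) i j = 0 by rewrite Z0 /entry mxE.
move: (E 0%N 1%N) (E 0%N 2%N) (E 0%N 3%N) (E 0%N 4%N) (E 1%N 4%N) (E 2%N 4%N) (E 3%N 4%N).
rewrite !entry_Zx //= => x0 x1 x2 x3 x4 x5 x6.
have nz (u v : K) : u * v = 0 -> u != 0 -> v = 0.
  by move=> /eqP; rewrite mulf_eq0 => /orP[/eqP ->|/eqP //]; rewrite eqxx.
have nn (a b : nat) : (a.+1%:R / b.+1%:R : K) != 0 by rewrite mulf_neq0 ?invr_eq0 ?pnatr_eq0.
have y2 := nz _ _ x2; have y3 := nz _ _ x3; have y4 := nz _ _ x4.
have y5 := nz _ _ x5; have y6 := nz _ _ x6.
rewrite [x]vec7P /coords x0 x1 y2 ?y3 ?y4 ?y5 ?y6 ?oppr_eq0 ?(nn 3 26) ?(nn 3 80) ?(nn 1 2) ?(nn 7 728) //.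
by apply/rowP => -[[|[|[|[|[|[|[|//]]]]]]] h]; rewrite !mxE.
Qed.

Lemma trace5 (X Y : 'M[K]_5) : \tr (X *m Y) = \sum_i \sum_j X i j * Y j i.
Proof. by apply: eq_bigr => i _; rewrite mxE. Qed.

Lemma stdnet_trace k (Z : 'M[K]_5) : alternating Z -> \tr (stdnet K k *m Z) =
  nth 0 [:: - 2 * (entry Z 1 4 + entry Z 2 3); 4 * entry Z 0 4 + entry Z 1 3;
            - 2 * (entry Z 0 3 + entry Z 1 2)] k.
Proof.
move=> /alternatingE aZ; rewrite trace5 !sum5 -!/(entry _ _ _) !aZ.
rewrite /entry ![stdnet K k _ _]mxE !inordK //.
by case: k => [[|[|[|//]]] hk] /=; field.
Qed.

Lemma Zx_surj (Z : 'M[K]_5) : alternating Z -> (forall k, \tr (stdnet K k *m Z) = 0) ->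
  exists x, Z = Zx x.
Proof.
move=> aZ tZ; exists (vec7 [:: entry Z 0 1; entry Z 0 2; - (3 / 2) * entry Z 0 3;
  27 / 4 * entry Z 0 4; 27 / 4 * entry Z 1 4; 81 / 4 * entry Z 2 4; - (729 / 8) * entry Z 3 4]).
have := tZ (inord 0); have := tZ (inord 1); have := tZ (inord 2).
rewrite !stdnet_trace // !inordK //= => t2 t1 t0.
have two : (- 2 : K) != 0 by rewrite oppr_eq0 pnatr_eq0.
have z12 : entry Z 1 2 = - entry Z 0 3.
  by move/eqP: t2; rewrite mulf_eq0 (negPf two) /= addrC addr_eq0 => /eqP.
have z23 : entry Z 2 3 = - entry Z 1 4.
  by move/eqP: t0; rewrite mulf_eq0 (negPf two) /= addrC addr_eq0 => /eqP.
have z13 : entry Z 1 3 = - (4 * entry Z 0 4).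
  by move/eqP: t1; rewrite addrC addr_eq0 => /eqP.
apply: matrix5P => i j hi hj; rewrite entry_Zx // !co_vec7 //=.
by case: i hi => [|[|[|[|[|//]]]]] _; case: j hj => [|[|[|[|[|//]]]]] _ /=;
  rewrite ?(alternatingE aZ) ?z12 ?z23 ?z13; field.
Qed.

Lemma Zx_pf x : pf (Zx x) (Zx x) = 0 <-> V x.
Proof.
have c0 (a b : nat) : (a.+1%:R / b.+1%:R : K) != 0 by rewrite mulf_neq0 ?invr_eq0 ?pnatr_eq0.
have P0 : pf (Zx x) (Zx x) 0 (inord 0) = - (32 / 2187) * q8 x.
  by rewrite pf_entry // /pf4 !entry_Zx //= /q8; field.
have P1 : pf (Zx x) (Zx x) 0 (inord 1) = 16 / 729 * q7 x.
  by rewrite pf_entry // /pf4 !entry_Zx //= /q7; field.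
have P2 : pf (Zx x) (Zx x) 0 (inord 2) = - (16 / 729) * q6 x.
  by rewrite pf_entry // /pf4 !entry_Zx //= /q6; field.
have P3 : pf (Zx x) (Zx x) 0 (inord 3) = - (8 / 81) * q5 x.
  by rewrite pf_entry // /pf4 !entry_Zx //= /q5; field.
have P4 : pf (Zx x) (Zx x) 0 (inord 4) = - (8 / 27) * q4 x.
  by rewrite pf_entry // /pf4 !entry_Zx //= /q4; field.
have nz (u v : K) : u != 0 -> u * v = 0 -> v = 0.
  by move=> u0 /eqP; rewrite mulf_eq0 (negPf u0) => /eqP.
split=> [E|[E4 E5 E6 E7 E8]].
  split; [move: P4|move: P3|move: P2|move: P1|move: P0]; rewrite E mxE => /esym; apply: nz;
    by rewrite ?oppr_eq0 ?(c0 31 2186) ?(c0 15 728) ?(c0 7 80) ?(c0 7 26).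
apply/rowP => k; rewrite [RHS]mxE -(inord_val k).
by case: k => [[|[|[|[|[|//]]]]] h] /=; rewrite ?P0 ?P1 ?P2 ?P3 ?P4 ?E4 ?E5 ?E6 ?E7 ?E8 mulr0.
Qed.

Definition psif (M : 'M[K]_5) x : 'rV[K]_NN := upr (M^T *m Zx x *m M).

Lemma psif_linear M : linear (psif M).
Proof.
move=> a x y; rewrite /psif Zx_linear mulmxDr -scalemxAr mulmxDl -scalemxAl.
by rewrite linearP.
Qed.

HB.instance Definition _ M := GRing.isLinear.Build K 'rV[K]_7 'rV[K]_NN _ (psif M) (psif_linear M).

Definition psi (M : 'M[K]_5) : 'M[K]_(7, NN) := lin1_mx (psif M).

Lemma skm_psi M x : skm (x *m psi M) = M^T *m Zx x *m M.
Proof.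
rewrite mul_rV_lin1 /= uprK // -[X in _ *m X]trmxK.
exact: alternating_congr (Zx_alternating x).
Qed.

Lemma psi_inj M x : M \in unitmx -> x *m psi M = 0 -> x = 0.
Proof.
move=> MU E; apply: Zx_eq0; have MTU : M^T \in unitmx by rewrite unitmx_tr.
apply: (can_inj (mulKmx MTU)); apply: (can_inj (mulmxK MU)).
by rewrite -skm_psi E linear0 mulmx0 mul0mx.
Qed.

(** Vanishing of the Pfaffians means being decomposable, and a congruence maps wedges of vectors to
    wedges of vectors. *)
Lemma psi_pf M x : M \in unitmx -> pf (skm (x *m psi M)) (skm (x *m psi M)) = 0 <-> V x.
Proof.
have congr_pf (N X : 'M[K]_5) : alternating X -> pf X X = 0 ->
    pf (N^T *m X *m N) (N^T *m X *m N) = 0.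
  move=> aX /(pf_decomposable aX)[u [v ->]].
  rewrite mulmxBr mulmxBl !mulmxA -!(mulmxA _ u) -!(mulmxA _ v) -!trmx_mul.
  exact: pf_wedge.
move=> MU; rewrite skm_psi -Zx_pf; split; last exact: congr_pf (Zx_alternating x).
have aM : alternating (M^T *m Zx x *m M).
  by rewrite -[X in _ *m X]trmxK; exact: alternating_congr (Zx_alternating x).
have MTU : M^T \in unitmx by rewrite unitmx_tr.
move/(congr_pf (invmx M) _ aM).
by rewrite trmx_inv !mulmxA mulVmx // mul1mx mulmxK.
Qed.

(** Transporting p by the inverse congruence turns the equations of the net n into those of
    [stdnet], whose solutions are the [Zx x]. *)
Lemma psi_range (n : 'I_3 -> 'rV[K]_NN) (C : 'M[K]_3) (M : 'M[K]_5) (be : K) (p : 'rV[K]_NN) :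
  M \in unitmx -> be != 0 ->
  (forall k, M *m act C (fun l => skm (n l)) k *m M^T = be *: stdnet K k) ->
  (forall k, \sum_t n k 0 t * p 0 t = 0) -> exists x, p = x *m psi M.
Proof.
move=> MU be0 CM np; have MTU : M^T \in unitmx by rewrite unitmx_tr.
pose Z := (invmx M)^T *m skm p *m invmx M.
have aZ : alternating Z.
  by rewrite /Z -[X in _ *m X]trmxK; exact: alternating_congr (skm_alternating p).
have tB k : \tr (act C (fun l => skm (n l)) k *m skm p) = 0.
  rewrite /act mulmx_suml raddf_sum big1 // => l _.
  by rewrite -scalemxAl /= mxtraceZ trace_pairing np mul0rn oppr0 mulr0.
have [|x xE] := Zx_surj aZ.
  move=> k; apply: (mulfI be0); rewrite mulr0 -mxtraceZ scalemxAl -CM /Z trmx_inv.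
  by rewrite !mulmxA mulmxK // mxtrace_mulC !mulmxA mulVmx // mul1mx.
exists x; rewrite -(skmK p) -[RHS]skmK; congr upr; rewrite skm_psi -xE /Z trmx_inv.
by rewrite !mulmxA mulmxV // mul1mx mulmxKV.
Qed.

End StandardSection.

(** * The general codimension 3 subspace *)

Section PluckerPolynomials.
Variables (F : fieldType) (k n : nat).

(** Sorting the columns f gives a Plücker coordinate up to the sign of a permutation; the minor is 0
    if a column is repeated. *)
Lemma minor_plucker (f : 'I_k -> 'I_n) : exists2 p : {mpoly F['C(n, k)]},
  p \is 1.-homog & forall A : 'M[F]_(k, n), p.@[fun i => wedge A 0 i] = \det (colsub f A).
Proof.
have [inj|ninj] := pselect (injective f); last first.
  exists 0; first exact: dhomog0.
  have [i [j [ij fij]]] : exists i j, i != j /\ f i = f j.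
    apply: contrapT => H; apply: ninj => i j fij; apply/eqP; apply: contrapT => /negP ij.
    by apply: H; exists i, j.
  move=> A; rewrite meval0 -det_tr (determinant_alternate ij) // => l.
  by rewrite !mxE fij.
pose tf : k.-tuple 'I_n := [tuple f i | i < k].
pose r := relpre (val : 'I_n -> nat) leq; pose s := [tuple of sort r tf].
have : perm_eq s tf by rewrite /= perm_sort.
case/tuple_permP => sg sE.
have ss : sorted ltn [seq val j | j <- s].
  rewrite ltn_sorted_uniq_leq map_inj_uniq; last exact: val_inj.
  rewrite sort_uniq map_inj_uniq // enum_uniq /= sorted_map.
  by rewrite sort_sorted // => a b; exact: leq_total.
have [i0 i0E] := ltn_tuple_surj ss.
exists ((-1) ^+ sg *: 'X_i0).
  by rewrite dhomogZ // dhomogX; apply/eqP; exact: mdeg1.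
move=> A; rewrite mevalZ mevalXU mxE i0E.
have -> : colsub (tnth s) A = col_perm sg (colsub f A).
  apply/matrixP => a b; rewrite !mxE; congr (A a _).
  transitivity (tnth tf (sg b)); last by rewrite tnth_mktuple.
  rewrite [in LHS](tnth_nth (f b)) sE -[in RHS](tnth_mktuple (fun i => tnth tf (sg i)) b).
  by rewrite (tnth_nth (f b)).
rewrite col_permE det_mulmx det_perm odd_permV mulrCA -expr2 sqrr_sign mulr1 //.
Qed.

Definition minor_poly f := sval (cid2 (minor_plucker f)).

Lemma minor_poly_homog f : minor_poly f \is 1.-homog.
Proof. by rewrite /minor_poly; case: cid2. Qed.

Lemma minor_polyE f A : (minor_poly f).@[fun i => wedge A 0 i] = \det (colsub f A).
Proof. by rewrite /minor_poly; case: cid2. Qed.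

Definition upd (f : 'I_k -> 'I_n) j m := fun i => if i == j then m else f i.

Lemma cramer (f : 'I_k -> 'I_n) (B : 'M[F]_(k, n)) j m :
  (\adj (colsub f B) *m B) j m = \det (colsub (upd f j m) B).
Proof.
rewrite mxE (expand_det_col _ j); apply: eq_bigr => i _.
rewrite !mxE mulrC /upd eqxx; congr (_ * (_ * \det _)).
by apply/matrixP => a b; rewrite !mxE eq_sym (negPf (neq_lift _ _)).
Qed.

End PluckerPolynomials.

Section MapNet.
Variables (R S : comNzRingType) (h : {rmorphism R -> S}).

Lemma map_skm p : map_mx h (skm p) = skm (map_mx h p).
Proof.
apply/matrixP => i j; rewrite !mxE; case: ifP => _ //; case: ifP => _.
  by rewrite rmorphN.
by rewrite rmorph0.
Qed.

Lemma map_pf A B : map_mx h (pf A B) = pf (map_mx h A) (map_mx h B).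
Proof.
apply/rowP => i; rewrite -(inord_val i) mxE; case: i => [[|[|[|[|[|//]]]]] hi] /=;
by rewrite !pf_entry //= /pf4 /entry !mxE !(rmorphN, rmorphD, rmorphM).
Qed.

Lemma map_pfW A : map_mx h (pfW A) = pfW (fun k => map_mx h (A k)).
Proof. by apply/row_matrixP => i; rewrite -map_row !rowK map_pf. Qed.

Lemma map_relC A : map_mx h (relC A) = relC (fun k => map_mx h (A k)).
Proof.
have E : map_mx h (row_mx (0 : 'cV_6) (pfW A)) = row_mx 0 (pfW (fun k => map_mx h (A k))).
  by rewrite map_row_mx raddf0 map_pfW.
by rewrite /relC map_row map_mx_adj; congr (row 0 (\adj _)).
Qed.

Lemma map_netS A : map_mx h (netS A) = netS (fun k => map_mx h (A k)).
Proof.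
rewrite /netS -map_relC; move: (relC A) => c.
apply/matrixP => i j; rewrite -(inord_val i) -(inord_val j) !mxE !inordK //.
by case: i => [[|[|[|//]]] hi]; case: j => [[|[|[|//]]] hj] /=; rewrite ?mxE ?rmorphD.
Qed.

(** The invariant is formed over polynomials in the Plücker coordinates and evaluated afterwards;
    this is why the net constructions are stated over a commutative ring. *)
Lemma map_net_inv A : h (net_inv A) = net_inv (fun k => map_mx h (A k)).
Proof. by rewrite /net_inv rmorphM -det_map_mx -map_netS [in RHS]mxE. Qed.
End MapNet.

Section Homogeneous.
Variables (F : fieldType) (m : nat).
Local Notation P := {mpoly F[m]}.

Lemma homog_det k d (B : 'M[P]_k) : (forall i j, B i j \is d.-homog) -> \det B \is (k * d).-homog.
Proof.
move=> hB; rewrite /determinant rpred_sum // => s _; rewrite mulr_sign.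
have hp : \prod_i B i (s i) \is (k * d).-homog.
  rewrite -[in X in X.-homog](card_ord k) -sum_nat_const.
  apply: (big_ind2 (fun (q : P) (e : nat) => q \is e.-homog)) => //.
  - exact: dhomog1.
  - by move=> *; exact: dhomogM.
by case: ifP; rewrite ?rpredN.
Qed.

Lemma homog_pf d (A B : 'M[P]_5) i : (forall i j, A i j \is d.-homog) ->
  (forall i j, B i j \is d.-homog) -> pf A B 0 i \is (d + d).-homog.
Proof.
move=> hA hB; have h4 (a b c e : nat) : pf4 A B a b c e \is (d + d).-homog.
  by apply: rpredD; apply: dhomogM; rewrite /entry ?hA ?hB.
rewrite -(inord_val i); case: i => [[|[|[|[|[|//]]]]] hi] /=;
  rewrite pf_entry //= ?rpredN; apply: rpredD; rewrite ?h4 //; apply: rpredB; exact: h4.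
Qed.

Lemma homog_net_inv d (A : 'I_3 -> 'M[P]_5) : (forall k i j, A k i j \is d.-homog) ->
  exists e, net_inv A \is e.-homog.
Proof.
move=> hA.
have hW i j : (row_mx 0 (pfW A) : 'M_(6, 1 + 5)) i j \is (d + d).-homog.
  rewrite mxE; case: split => a; first by rewrite mxE dhomog0.
  have -> : pfW A i a = row i (pfW A) 0 a by rewrite [RHS]mxE.
  by rewrite rowK homog_pf.
have hc i : relC A 0 i \is (5 * (d + d)).-homog.
  rewrite !mxE /cofactor; set X := \det _.
  have hX : X \is (5 * (d + d)).-homog by apply: homog_det => a b; rewrite [row' _ _ _ _]mxE [col' _ _ _ _]mxE.
  by rewrite -signr_odd mulr_sign; case: ifP; rewrite ?rpredN.
have hS i j : netS A i j \is (5 * (d + d)).-homog.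
  rewrite /netS; move: (relC A) hc => c hc.
  rewrite -(inord_val i) -(inord_val j) !mxE !inordK //.
  by case: i => [[|[|[|//]]] hi]; case: j => [[|[|[|//]]] hj] /=; rewrite ?rpredD.
exists (5 * (d + d) + 3 * (5 * (d + d)))%N; apply: dhomogM => //.
exact: homog_det.
Qed.
End Homogeneous.

Section Chart.
Variable K : numClosedFieldType.
Local Notation NN := 'C(5, 2).
Local Notation DD := (NN - 3)%N.
Variables (f : 'I_DD -> 'I_NN) (c : 'I_3 -> 'I_NN).

Definition pivot : {mpoly K['C(NN, DD)]} := minor_poly K f.

(* On the chart of the Grassmannian where the minor with columns f is nonzero, a
   basis of the annihilator, cleared of its denominators. *)
Definition annih (k : 'I_3) : 'rV[{mpoly K['C(NN, DD)]}]_NN := \row_t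
  (pivot * (t == c k)%:R - \sum_j minor_poly K (upd f j (c k)) * (t == f j)%:R).

(** Where the pivot is nonzero the rows [annih] vanish on H; where the second factor is nonzero the
    net they form has a normal form. *)
Definition chart_poly : {mpoly K['C(NN, DD)]} :=
  pivot * net_inv (fun k => skm (annih k)).

Lemma chart_poly_homog : exists d, chart_poly \is d.-homog.
Proof.
have h1 k t : annih k 0 t \is 1.-homog.
  rewrite mxE rpredB //; first by case: eqP => _; rewrite ?mulr1 ?mulr0 ?dhomog0 ?minor_poly_homog.
  apply: rpred_sum => j _.
  by case: eqP => _; rewrite ?mulr1 ?mulr0 ?dhomog0 ?minor_poly_homog.
have [|e he] := @homog_net_inv K _ 1 (fun k => skm (annih k)).
  move=> k i j; rewrite mxE; case: ifP => _; first exact: h1.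
  by case: ifP => _; rewrite ?rpredN ?h1 ?dhomog0.
by exists (1 + e)%N; apply: dhomogM; rewrite ?minor_poly_homog.
Qed.

Definition annih_at (B : 'M[K]_(DD, NN)) k : 'rV[K]_NN := \row_t
  (\det (colsub f B) * (t == c k)%:R - \sum_j \det (colsub (upd f j (c k)) B) * (t == f j)%:R).

Lemma chart_polyE (B : 'M[K]_(DD, NN)) : chart_poly.@[fun i => wedge B 0 i] =
  \det (colsub f B) * net_inv (fun k => skm (annih_at B k)).
Proof.
rewrite /chart_poly mevalM /pivot minor_polyE; congr (_ * _).
rewrite [LHS](map_net_inv (meval (fun i => wedge B 0 i))); congr net_inv; apply/funext => k.
rewrite map_skm; congr skm; apply/rowP => t; rewrite [LHS]mxE [annih _ _ _]mxE [RHS]mxE.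
rewrite rmorphB rmorphM rmorph_nat rmorph_sum; congr (_ * _ - _); first exact: minor_polyE.
by apply: eq_bigr => j _; rewrite rmorphM rmorph_nat; congr (_ * _); exact: minor_polyE.
Qed.

(** Multiplied by the adjugate of its columns f, B has det times the identity there, and by [cramer]
    its column [c k] lists the minors subtracted in [annih_at]. *)
Lemma annih_at_mul (B : 'M[K]_(DD, NN)) k : \det (colsub f B) != 0 -> B *m (annih_at B k)^T = 0.
Proof.
move=> d0; pose X := colsub f B; have XU : X \in unitmx by rewrite unitmxE unitfE.
have aU : \adj X \in unitmx.
  have [] : X \in unitmx /\ (\det X)^-1 *: \adj X \in unitmx; last first.
    by move=> _; rewrite unitmxZ // unitfE invr_eq0.
  by apply: mulmx1_unit; rewrite -scalemxAr mul_mx_adj -mul_scalar_mx -scalar_mxM mulVf.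
apply: (can_inj (mulKmx aU)); rewrite mulmx0 mulmxA.
have Ef j j' : (\adj X *m B) j (f j') = (\det X)%:M j j'.
  by rewrite -mul_adj_mx !mxE; apply: eq_bigr => i _; rewrite [colsub f B _ _ in RHS]mxE.
apply/colP => j; rewrite mxE [RHS]mxE.
have -> : \sum_t (\adj X *m B) j t * (annih_at B k)^T t 0 =
   \sum_t ((\adj X *m B) j t * (\det X * (t == c k)%:R)) -
   \sum_t \sum_j' ((\adj X *m B) j t * ((\adj X *m B) j' (c k) * (t == f j')%:R)).
  rewrite -sumrB; apply: eq_bigr => t _; rewrite [_^T t 0]mxE [annih_at _ _ _ _]mxE mulrBr mulr_sumr.
  by congr (_ - _); apply: eq_bigr => j' _; rewrite -cramer.
rewrite exchange_big /= (bigD1 (c k)) //= eqxx mulr1 big1 => [|t /negPf ->]; last by rewrite !mulr0.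
rewrite addr0 (bigD1 j) //= [X in _ - (_ + X)]big1 => [|j' j'j].
  rewrite (bigD1 (f j)) //= eqxx mulr1 big1 => [|t /negPf ->]; last by rewrite !mulr0.
  by rewrite !addr0 Ef [_%:M _ _]mxE eqxx mulr1n mulrC subrr.
rewrite (bigD1 (f j')) //= eqxx mulr1 big1 => [|t /negPf ->]; last by rewrite !mulr0.
by rewrite addr0 Ef [_%:M _ _]mxE eq_sym (negPf j'j) mulr0n mul0r.
Qed.

(** The interface between the nets and the automorphisms: [psi] identifies K^7 with H and the cone
    [V] with the cone over the section. *)
Definition parametrizes (H : grass K DD NN) (psi : 'M[K]_(7, NN)) :=
  [/\ forall x : 'rV[K]_7, x *m psi = 0 -> x = 0,
      forall p, p \in val H <-> exists x, p = x *m psi &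
      forall x (y : proj K NN), val y = <[x *m psi]>%VS ->
        @plucker_image K 2 5 y <-> V x].

Lemma chart_parametrizes (H : grass K DD NN) :
  chart_poly.@[fun i => plucker H 0 i] != 0 -> exists psi, parametrizes H psi.
Proof.
rewrite [X in X != 0](chart_polyE (grass_mx H)) mulf_eq0 negb_or => /andP[d0 nI].
have [|C [M [be [CU MU be0 CM]]]] := net_normal_form _ nI; first by move=> k; exact: skm_alternating.
have Hpsi p : p \in val H -> exists x, p = x *m psi M.
  move=> /grass_mx_span[a ->]; apply: (psi_range MU be0 CM) => k.
  have : (a *m grass_mx H *m (annih_at (grass_mx H) k)^T) 0 0 = 0.
    by rewrite -mulmxA annih_at_mul // mulmx0 mxE.
  rewrite mxE => E; rewrite -[RHS]E; apply: eq_bigr => t _.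
  by rewrite [_^T _ _]mxE mulrC.
exists (psi M); split=> [x|p|x y yE]; first exact: psi_inj.
  split; first exact: Hpsi.
  have [G GE] := choice (fun i => Hpsi _ (grass_mx_in H i)).
  have BE : grass_mx H = (\matrix_i G i : 'M_(DD, 7)) *m psi M.
    by apply/row_matrixP => i; rewrite [RHS]row_mul [X in _ = X *m _]rowK; exact: GE.
  (* [DD] computes to 7: a basis of H inside the 7-dimensional range of [psi M] spans that range. *)
  have GU : (\matrix_i G i : 'M_7) \in unitmx.
    rewrite -row_free_unit; have := grass_mx_free H; rewrite BE.
    rewrite /row_free => /eqP r7; rewrite eqn_leq rank_leq_row.
    by have := mxrankM_maxl (\matrix_i G i : 'M_(DD, 7)) (psi M); rewrite r7.
  move=> [x ->]; have -> : psi M = invmx (\matrix_i G i : 'M_7) *m grass_mx H.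
    by rewrite BE mulKmx.
  rewrite mulmxA mulmx_sum_row rpred_sum // => i _; rewrite rpredZ //.
  exact: grass_mx_in.
by rewrite (plucker_imageP yE) psi_pf.
Qed.
End Chart.

(** * Nonemptiness of the open set *)

Section Example.
Variable K : numClosedFieldType.
Local Notation NN := 'C(5, 2).
Local Notation DD := (NN - 3)%N.

(** The upper triangles of [stdnet], with the second form multiplied by -1/2, so that the columns
    [ex_c] form an identity matrix. *)
Definition ex_net (k a b : nat) : K := nth 0 (nth [::] (nth [::] [::
  [:: [:: 0; 0; 0; 0; 0]; [:: 0; 0; 0; 0; 1]; [:: 0; 0; 0; 1; 0]];
  [:: [:: 0; 0; 0; 0; 1]; [:: 0; 0; 0; 4^-1; 0]];
  [:: [:: 0; 0; 0; 1; 0]; [:: 0; 0; 1; 0; 0]]] k) a) b.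

Definition ex_W (t i : nat) : K := nth 0 (nth [::] [::
  [:: 2; 0; 0; 0; 0]; [:: 0; -1; 0; 0; 0]; [:: 0; 0; -1; 0; 0]; [:: 0; 0; 2^-1; 0; 0];
  [:: 0; 0; 0; -1; 0]; [:: 0; 0; 0; 0; 2]] t) i.

Lemma ex_pfW (A : 'I_3 -> 'M[K]_5) :
  (forall k a b : nat, (k < 3)%N -> (a < b < 5)%N -> entry (A (inord k)) a b = ex_net k a b) ->
  forall (t : 'I_6) (i : 'I_5), pfW A t i = ex_W t i.
Proof.
move=> AE t i; rewrite mxE -(inord_val i).
case: i => [[|[|[|[|[|//]]]]] hi]; rewrite pf_entry // /pf4 /=;
case: t => [[|[|[|[|[|[|//]]]]]] ht] /=; rewrite !AE //= /ex_net /ex_W /= ?inordK //=; by field.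
Qed.

Lemma det3 (S : 'M[K]_3) (s := entry3 S) : \det S =
  s 0%N 0%N * (s 1%N 1%N * s 2%N 2%N - s 1%N 2%N * s 2%N 1%N)
  - s 0%N 1%N * (s 1%N 0%N * s 2%N 2%N - s 1%N 2%N * s 2%N 0%N)
  + s 0%N 2%N * (s 1%N 0%N * s 2%N 1%N - s 1%N 1%N * s 2%N 0%N).
Proof.
rewrite (expand_det_row _ (inord 0)) sum3 /cofactor !inordK // !(expand_det_row _ 0).
rewrite !big_ord_recl !big_ord0 /cofactor !det_mx11 !mxE /=.
have E (i j : 'I_3) : S i j = s i j by rewrite /s /entry3 !inord_val.
by rewrite !E /= /bump /= !inordK //=; ring.
Qed.

(** No adjugate of size 6 is expanded: [relC A] is found from the linear equations it satisfies, up
    to its entry c_3, which is nonzero because the corresponding minor is diagonal. The invariant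
    equals - c_3^4. *)
Lemma ex_net_inv (A : 'I_3 -> 'M[K]_5) :
  (forall k a b : nat, (k < 3)%N -> (a < b < 5)%N -> entry (A (inord k)) a b = ex_net k a b) ->
  net_inv A != 0.
Proof.
move=> /ex_pfW WE.
have c3 : relC A 0 (inord 3) != 0.
  rewrite relC3 oppr_eq0.
  have -> : row' (inord 3) (pfW A) = diag_mx (\row_i [:: 2; -1; -1; -1; 2]`_i).
    apply/matrixP => i j; rewrite [LHS]mxE WE !mxE.
    case: i => [[|[|[|[|[|//]]]]] hi]; case: j => [[|[|[|[|[|//]]]]] hj];
      by rewrite /ex_W /= /bump inordK.
  rewrite det_diag; apply/prodf_neq0 => i _; rewrite mxE.
  by case: i => [[|[|[|[|[|//]]]]] hi] /=; rewrite ?oppr_eq0 ?oner_eq0 ?pnatr_eq0.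
have cW (i : 'I_5) : \sum_t relC A 0 t * ex_W t i = 0.
  have /rowP/(_ i) := relC_mul A; rewrite mxE [RHS]mxE => E; rewrite -[RHS]E.
  by apply: eq_bigr => t _; rewrite WE.
have := cW (inord 0); have := cW (inord 1); have := cW (inord 2).
have := cW (inord 3); have := cW (inord 4).
rewrite !sum6 /ex_W !inordK //= !mulr0 !addr0 !add0r.
rewrite /net_inv det3 /netS; move: (relC A) c3 => c c3 c5 c4 c23 c1 c0.
rewrite /entry3 !mxE !inordK //=.
have nz (u v : K) : u != 0 -> v * u = 0 -> v = 0.
  by move=> u0 /eqP; rewrite mulf_eq0 (negPf u0) orbF => /eqP.
have n1 : (-1 : K) != 0 by rewrite oppr_eq0 oner_eq0.
have n2 : (2 : K) != 0 by rewrite pnatr_eq0.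
rewrite (nz _ _ n2 c0) (nz _ _ n1 c1) (nz _ _ n1 c4) (nz _ _ n2 c5).
have c2 : c 0 (inord 2) = c 0 (inord 3) / 2.
  by move/eqP: c23; rewrite mulrN1 addrC subr_eq0 => /eqP.
rewrite c2 (_ : _ * _ = - c 0 (inord 3) ^+ 4); last by field.
by rewrite oppr_eq0 expf_neq0.
Qed.

Local Notation pi a b := (pidx (inord a) (inord b)).

Definition ex_f (j : 'I_DD) : 'I_NN :=
  nth (pi 0 1) [:: pi 0 1; pi 0 2; pi 1 2; pi 1 3; pi 2 3; pi 2 4; pi 3 4] j.
Definition ex_c (k : 'I_3) : 'I_NN := nth (pi 0 1) [:: pi 1 4; pi 0 4; pi 0 3] k.

(** The rows are a basis of the vectors annihilated by [ex_net], with an identity matrix in the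
    columns [ex_f]. *)
Definition ex_tab (j a b : nat) : K := nth 0 (nth [::] (nth [::] [::
  [:: [:: 0; 1; 0; 0; 0]];
  [:: [:: 0; 0; 1; 0; 0]];
  [:: [:: 0; 0; 0; -1; 0]; [:: 0; 0; 1; 0; 0]];
  [:: [:: 0; 0; 0; 0; - 4^-1]; [:: 0; 0; 0; 1; 0]];
  [:: [:: 0; 0; 0; 0; 0]; [:: 0; 0; 0; 0; -1]; [:: 0; 0; 0; 1; 0]];
  [:: [::]; [::]; [:: 0; 0; 0; 0; 1]];
  [:: [::]; [::]; [::]; [:: 0; 0; 0; 0; 1]]] j) a) b.

Definition ex_B : 'M[K]_(DD, NN) := \matrix_(j, t) ex_tab j (fst2 t) (snd2 t).

Lemma pi_val (a b : nat) : (a < b < 5)%N ->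
  nat_of_ord (fst2 (pi a b)) = a /\ nat_of_ord (snd2 (pi a b)) = b.
Proof.
move=> /andP[ab b5]; have a5 := ltn_trans ab b5.
by have [|-> ->] := @pidxP (inord a) (inord b); rewrite !inordK.
Qed.

Lemma pi_eq (a b a' b' : nat) : (a < b < 5)%N -> (a' < b' < 5)%N ->
  (pi a b == pi a' b') = (a == a') && (b == b').
Proof.
move=> h h'; apply/eqP/andP => [E|[/eqP -> /eqP ->]] //.
have [e1 e2] := pi_val h; have [e1' e2'] := pi_val h'.
by split; apply/eqP; [rewrite -[LHS]e1 -[RHS]e1' E | rewrite -[LHS]e2 -[RHS]e2' E].
Qed.

Lemma ex_BE (j : 'I_DD) (a b : nat) : (a < b < 5)%N -> ex_B j (pi a b) = ex_tab j a b.
Proof. by move=> h; rewrite mxE; have [-> ->] := pi_val h. Qed.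

Lemma ex_colsub : colsub ex_f ex_B = 1%:M.
Proof.
apply/matrixP => i j; rewrite mxE mxE [RHS]mxE /ex_f -val_eqE /=.
have : (i < 7)%N := ltn_ord i; have : (j < 7)%N := ltn_ord j.
move: (nat_of_ord i) (nat_of_ord j) => a b hb ha.
have T c d : (c < d < 5)%N -> ex_tab a (fst2 (pi c d)) (snd2 (pi c d)) = ex_tab a c d.
  by move=> /pi_val[-> ->].
case: b hb => [|[|[|[|[|[|[|//]]]]]]] _ /=; rewrite T //;
  by case: a ha {T} => [|[|[|[|[|[|[|//]]]]]]].
Qed.

Lemma ex_annih (k a b : nat) : (k < 3)%N -> (a < b < 5)%N ->
  entry (skm (annih_at ex_f ex_c ex_B (inord k))) a b = ex_net k a b.
Proof.
move=> k3 ab; have /andP[ab' b5] := ab; have a5 := ltn_trans ab' b5.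
rewrite /entry mxE !inordK // ab' mxE ex_colsub det1 mul1r.
have -> : \sum_j \det (colsub (upd ex_f j (ex_c (inord k))) ex_B) * (pi a b == ex_f j)%:R
   = \sum_(j < 7) ex_B j (ex_c (inord k)) * (pi a b == ex_f j)%:R.
  by apply: eq_bigr => j _; rewrite -cramer ex_colsub adj1 mul1mx.
rewrite !big_ord_recl big_ord0 /ex_f /ex_c inordK //=.
case: k k3 => [|[|[|//]]] _ /=; rewrite !ex_BE // !pi_eq //=;
  case: b b5 ab ab' => [|[|[|[|[|//]]]]] _ ab ab'; case: a a5 ab ab' => [|[|[|[|[|//]]]]] _ ab ab' //;
  rewrite /ex_tab /ex_net /=; by ring.
Qed.

Lemma ex_chart : (chart_poly K ex_f ex_c).@[fun i => wedge ex_B 0 i] != 0.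
Proof.
rewrite chart_polyE ex_colsub det1 mul1r; apply: ex_net_inv => k a b; exact: ex_annih.
Qed.
End Example.

(** * The automorphism group *)

Local Open Scope classical_set_scope.

Section Automorphisms.
Variable K : numClosedFieldType.
Local Notation NN := 'C(5, 2).
Local Notation DD := (NN - 3)%N.
Variables (H : grass K DD NN) (psi : 'M[K]_(7, NN)).
Hypothesis psiH : parametrizes H psi.
Implicit Types u v w : 'rV[K]_7.

Local Notation X := (linear_section (@plucker_image K 2 5) H).

Lemma psi_right_inv : exists psi', psi *m psi' = 1%:M.
Proof.
have [inj _ _] := psiH; apply/row_freeP; rewrite -kermx_eq0; apply/eqP/row_matrixP => i.
by rewrite row0; apply: inj; rewrite -row_mul mulmx_ker row0.
Qed.

Definition psi' := sval (cid psi_right_inv).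
Lemma psiK : psi *m psi' = 1%:M. Proof. by rewrite /psi'; case: cid. Qed.
Lemma mul_psiK v : v *m psi *m psi' = v. Proof. by rewrite -mulmxA psiK mulmx1. Qed.

Lemma psi_neq0 v : v != 0 -> v *m psi != 0.
Proof. by apply: contra_neq => E; rewrite -(mul_psiK v) E mul0mx. Qed.

Definition at_pt (x : X) v := val (val x) = <[v *m psi]>%VS.

Lemma point_coord (x : X) : exists v, [/\ V v, v != 0 & at_pt x v].
Proof.
have [_ Hp Hi] := psiH; have [vp0 xE] := vpick_proj (val x).
have [xP xH] : X (val x) by exact: set_valP.
have /Hp[v vE] : vpick (val (val x)) \in val H by rewrite memvE xE.
exists v; have v0 : v != 0 by apply: contraNneq vp0 => v0; rewrite vE v0 mul0mx.
have xv : at_pt x v by rewrite /at_pt -xE vE.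
by split=> //; apply/(Hi v _ xv).
Qed.

Definition coord_of (x : X) := sval (cid (point_coord x)).
Lemma coord_ofP x : [/\ V (coord_of x), coord_of x != 0 & at_pt x (coord_of x)].
Proof. by rewrite /coord_of; case: cid. Qed.

Lemma point_exists v : V v -> v != 0 -> exists x : X, at_pt x v.
Proof.
move=> Vv v0; have [_ Hp Hi] := psiH.
have d1 : \dim <[v *m psi]> == 1%N by rewrite dim_vline psi_neq0.
pose y : proj K NN := exist _ <[v *m psi]>%VS d1.
have yX : X y.
  by split; [apply/(Hi v y erefl) | rewrite /= -memvE; apply/Hp; exists v].
by exists (SigSub (mem_set yX)).
Qed.

Lemma at_pt_inj (x y : X) v : at_pt x v -> at_pt y v -> x = y.
Proof. by move=> xv yv; apply: val_inj; apply: val_inj; rewrite xv yv. Qed.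

Lemma at_ptZ (x : X) c v : c != 0 -> at_pt x v -> at_pt x (c *: v).
Proof. by move=> c0; rewrite /at_pt -scalemxAl vlineZ. Qed.

Lemma at_pt_eq (x : X) v w : v != 0 -> at_pt x v -> at_pt x w -> exists2 c, c != 0 & v = c *: w.
Proof.
move=> v0 xv xw; have : v *m psi \in <[w *m psi]>%VS by rewrite -xw xv memv_line.
case/vlineP => c E; have vE : v = c *: w by rewrite -(mul_psiK v) E -scalemxAl mul_psiK.
by exists c => //; apply: contraNneq v0 => c0; rewrite vE c0 scale0r.
Qed.

Definition acts (f : X -> X) (N : 'M[K]_7) :=
  forall x v, V v -> v != 0 -> at_pt x v -> at_pt (f x) (v *m N).

Lemma acts_eq f g N c : acts f N -> acts g (c *: N) -> c != 0 -> f = g.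
Proof.
move=> fN gN c0; apply/funext => x; have [Vv v0 xv] := coord_ofP x.
apply: (at_pt_inj (fN _ _ Vv v0 xv)); have := gN _ _ Vv v0 xv.
rewrite -scalemxAr => /(at_ptZ (c := c^-1)); rewrite invr_eq0 scalerA mulVf // scale1r.
exact.
Qed.

Definition good (N : 'M[K]_7) := forall v, V v -> v != 0 -> V (v *m N) /\ v *m N != 0.

Lemma acts_exists N : good N -> exists f, acts f N.
Proof.
move=> gN; have ex x : exists y, at_pt y (coord_of x *m N).
  by have [Vv v0 _] := coord_ofP x; have [] := gN _ Vv v0; exact: point_exists.
have [f fE] := choice ex; exists f => x v Vv v0 xv.
have [Vc c0 xc] := coord_ofP x; have [c cc0 ->] := at_pt_eq v0 xv xc.
by rewrite -scalemxAl; exact: at_ptZ.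
Qed.

Lemma vpick_at (x : X) v : at_pt x v -> exists2 c, c != 0 & vpick (val (val x)) = c *: (v *m psi).
Proof. by move=> xv; exact: vpick_line. Qed.

(** One tuple of linear forms on the ambient space, with matrix psi' N psi, represents f
    everywhere. *)
Lemma acts_regular f N : good N -> acts f N -> regular f.
Proof.
move=> gN fN x; pose A := psi' *m N *m psi.
pose P j := \sum_i A i j *: ('X_i : {mpoly K[NN]}).
have PE p : mpoly_map P p = p *m A.
  apply/rowP => j; rewrite !mxE /P raddf_sum; apply: eq_bigr => i _.
  by rewrite /= mevalZ mevalXU mulrC.
have act y v : V v -> v != 0 -> at_pt y v ->
    exists2 c, c != 0 & mpoly_map P (vpick (val (val y))) = c *: (v *m N *m psi).
  move=> Vv v0 yv; have [c c0 ->] := vpick_at yv; exists c => //.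
  by rewrite PE -scalemxAl /A !mulmxA mul_psiK.
exists 1%N, P; split=> [j||y _].
- by apply: rpred_sum => i _; rewrite dhomogZ // dhomogX; apply/eqP; exact: mdeg1.
- have [Vv v0 xv] := coord_ofP x; have [c c0 ->] := act _ _ Vv v0 xv.
  by rewrite scaler_eq0 negb_or c0 psi_neq0 //; have [] := gN _ Vv v0.
- have [Vv v0 yv] := coord_ofP y; have [c c0 ->] := act _ _ Vv v0 yv.
  by rewrite vlineZ //; exact: fN.
Qed.

Lemma symM_good (g : 'M[K]_2) : g \in unitmx -> good (symM g).
Proof.
move=> gU v Vv v0; split; first exact: V_symM.
by apply: contra_neq v0 => E; rewrite -(mulmxK (symM_unit gU) v) E mul0mx.
Qed.

(** On row vectors [symM] acts from the right; the inverse turns this into a left action, compatible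
    with composition. *)
Definition GL_fun (g : GL 2 K) : X -> X :=
  sval (cid (acts_exists (symM_good (Defs.GL_unit (g^-1)%g)))).

Lemma GL_fun_acts g : acts (GL_fun g) (symM (GL_mx (g^-1)%g)).
Proof. by rewrite /GL_fun; case: cid. Qed.

Lemma acts_comp f g N M : good N -> acts f M -> acts g N -> acts (f \o g) (N *m M).
Proof.
move=> gN fM gN' x v Vv v0 xv; rewrite mulmxA; have [VN N0] := gN _ Vv v0.
by apply: fM => //; exact: gN'.
Qed.

Lemma acts_id : acts id 1%:M. Proof. by move=> x v _ _; rewrite mulmx1. Qed.

Lemma GL_funM g h : GL_fun (g * h)%g = GL_fun g \o GL_fun h.
Proof.
apply: (@acts_eq _ _ (symM (GL_mx ((g * h)^-1)%g)) 1 _ _ (oner_neq0 _)); first exact: GL_fun_acts.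
rewrite scale1r invgM symM_mul; apply: acts_comp; [|exact: GL_fun_acts..].
exact/symM_good/Defs.GL_unit.
Qed.

Lemma GL_fun1 : GL_fun 1%g = id.
Proof.
apply: (@acts_eq _ _ (symM (GL_mx (1^-1)%g)) 1 _ _ (oner_neq0 _)); first exact: GL_fun_acts.
by rewrite scale1r invg1 symM1; exact: acts_id.
Qed.

Lemma GL_funK g : cancel (GL_fun g) (GL_fun g^-1%g).
Proof. by move=> x; have := congr1 (fun f => f x) (GL_funM g^-1%g g); rewrite mulVg GL_fun1. Qed.

Lemma GL_funVK g : cancel (GL_fun g^-1%g) (GL_fun g).
Proof. by move=> x; have := congr1 (fun f => f x) (GL_funM g g^-1%g); rewrite mulgV GL_fun1. Qed.

Lemma GL_fun_regular g : regular (GL_fun g).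
Proof. exact: acts_regular (symM_good (Defs.GL_unit _)) (GL_fun_acts g). Qed.

Definition GL_autom g : autom X :=
  Autom (GL_funK g) (GL_funVK g) (GL_fun_regular g) (GL_fun_regular g^-1%g).

Lemma GL_autom_eq (g h : GL 2 K) : (GL_autom g = GL_autom h) <-> exists c : K, GL_mx h = c *: GL_mx g.
Proof.
split=> [/(congr1 (@autom_fun _ _ _)) /= gh|[c hE]].
  have [|c cE] := @symM_scalar K (GL_mx (g^-1 * h)%g) (Defs.GL_unit _).
    move=> v Vv v0; have [x xv] := point_exists Vv v0.
    have gv := GL_fun_acts g Vv v0 xv; have hv := GL_fun_acts h Vv v0 xv.
    rewrite gh in gv; have [_ gv0] := symM_good (Defs.GL_unit (g^-1)%g) Vv v0.
    have [c c0 E] := at_pt_eq gv0 gv hv; exists c => //.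
    rewrite /= symM_mul mulmxA E -scalemxAl -mulmxA -symM_mul /= mulVmx ?Defs.GL_unit //.
    by rewrite symM1 mulmx1.
  exists c; move: cE => /= cE.
  by rewrite -(mulKVmx (Defs.GL_unit g) (GL_mx h)) cE -scalemxAr mulmx1.
have c0 : c != 0.
  apply/eqP => c0; have := Defs.GL_unit h; rewrite hE c0 scale0r unitmxE det0 unitr0 //.
apply: autom_eqP => x /=; congr (_ x).
have hiE : GL_mx (h^-1)%g = c^-1 *: GL_mx (g^-1)%g by rewrite /= hE invmxZ ?unitmxZ ?unitfE ?Defs.GL_unit.
apply: (@acts_eq _ _ (symM (GL_mx (g^-1)%g)) (c^-1 ^+ 6)); first exact: GL_fun_acts.
  by rewrite -symMZ -hiE; exact: GL_fun_acts.
by rewrite expf_neq0 // invr_eq0.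
Qed.
End Automorphisms.

Local Open Scope quotient_scope.

(** * Every automorphism comes from GL_2 *)

Section Surjective.
Variable K : numClosedFieldType.
Local Notation NN := 'C(5, 2).
Local Notation DD := (NN - 3)%N.
Variables (H : grass K DD NN) (psi : 'M[K]_(7, NN)).
Hypothesis psiH : parametrizes H psi.
Implicit Types u v w : 'rV[K]_7.
Local Notation X := (linear_section (@plucker_image K 2 5) H).
Local Notation coord := (coord_of psiH).
Local Notation at_pt := (at_pt psi).

(** Made total: a vector that represents no point is sent to the point of [e6]. *)
Definition point_of v : X :=
  match pselect (V v /\ v != 0) with
  | left h => sval (cid (point_exists psiH h.1 h.2))
  | right _ => sval (cid (point_exists psiH (V_nu 0 1) (e6_neq0 K)))
  end.

Lemma point_ofP v : V v -> v != 0 -> at_pt (point_of v) v.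
Proof.
move=> Vv v0; rewrite /point_of; case: pselect => [h|[]]; last by split.
by case: cid.
Qed.

Definition lift_fun (f : X -> X) v := coord (f (point_of v)).

Lemma lift_cone f v : V (lift_fun f v) /\ lift_fun f v != 0.
Proof. by have [Vv v0 _] := coord_ofP psiH (f (point_of v)). Qed.

Lemma lift_at f x v : V v -> v != 0 -> at_pt x v -> at_pt (f x) (lift_fun f v).
Proof.
move=> Vv v0 xv; rewrite /lift_fun -(at_pt_inj xv (point_ofP Vv v0)).
by have [] := coord_ofP psiH (f x).
Qed.

Lemma liftZ f v c : V v -> v != 0 -> c != 0 -> lift_fun f (c *: v) = lift_fun f v.
Proof.
move=> Vv v0 c0; congr (coord (f _)); have cv0 : c *: v != 0 by rewrite scaler_eq0 negb_or c0.
apply: (at_pt_inj (point_ofP (VZ c Vv) cv0)); apply: at_ptZ => //; exact: point_ofP.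
Qed.

Lemma lift_cancel f g v : cancel f g -> V v -> v != 0 ->
  exists2 e, e != 0 & lift_fun g (lift_fun f v) = e *: v.
Proof.
move=> fg Vv v0; have xv := point_ofP Vv v0; have [VF F0] := lift_cone f v.
have [VG G0] := lift_cone g (lift_fun f v).
apply: (at_pt_eq psiH G0 (x := point_of v)) => //.
by rewrite -{1}(fg (point_of v)); apply: lift_at => //; exact: lift_at.
Qed.

(** Local forms for f in the Plücker coordinates are composed with [psi] on the source and with its
    one-sided inverse [psi'] on the target. *)
Lemma lift_regular f : regular f -> regular_cone (lift_fun f).
Proof.
move=> rf v Vv v0; have [d [P [hP Pv Pf]]] := rf (point_of v).
pose S := [tuple \sum_a psi a b *: ('X_a : {mpoly K[7]}) | b < NN].
have SE w (p : {mpoly K[NN]}) : ev7 w (p \mPo S) = p.@[fun i => (w *m psi) 0 i].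
  rewrite /ev7 comp_mpoly_meval; apply: meval_eq => b; rewrite tnth_mktuple raddf_sum mxE.
  by apply: eq_bigr => a _; rewrite /= mevalZ mevalXU mulrC.
pose q j := \sum_i psi' psiH i j *: (P i \mPo S).
have qE w : mpoly_map q w = mpoly_map P (w *m psi) *m psi' psiH.
  apply/rowP => j; rewrite mpoly_mapE [RHS]mxE /q /ev7 raddf_sum; apply: eq_bigr => i _.
  by rewrite /= mevalZ -/(ev7 w _) SE mulrC [mpoly_map _ _ _ _]mxE.
have key w : V w -> w != 0 -> mpoly_map P (w *m psi) != 0 ->
    exists2 c, c != 0 & mpoly_map q w = c *: lift_fun f w.
  move=> Vw w0 Pw; have xw := point_ofP Vw w0; have [c c0 cE] := vpick_at xw.
  have Py : mpoly_map P (vpick (val (val (point_of w)))) != 0.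
    by rewrite cE (mpoly_mapZ _ _ hP) scaler_eq0 negb_or expf_neq0.
  have := lift_at f Vw w0 xw; rewrite /at_pt (Pf _ Py) cE (mpoly_mapZ _ _ hP) vlineZ ?expf_neq0 // => E.
  have : mpoly_map P (w *m psi) \in <[lift_fun f w *m psi]>%VS by rewrite -E memv_line.
  case/vlineP => e eE; exists e; last by rewrite qE eE -scalemxAl mul_psiK.
  by apply: contraNneq Pw => e0; rewrite eE e0 scale0r.
have Pneq w : mpoly_map q w != 0 -> mpoly_map P (w *m psi) != 0.
  by apply: contra_neq => E; rewrite qE E mul0mx.
exists d, q; split.
  split=> [j|w Vw w0 /Pneq]; last exact: key.
  apply: rpred_sum => i _; rewrite dhomogZ // -[d]mul1n; apply: dhomog_comp => // b.
  rewrite tnth_mktuple; apply: rpred_sum => a _; rewrite dhomogZ //; exact: X_homog.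
have [|c c0 ->] := key v Vv v0.
  have [c c0 cE] := vpick_at (point_ofP Vv v0); apply: contra_neq Pv => E.
  by rewrite cE (mpoly_mapZ _ _ hP) E scaler0.
by rewrite scaler_eq0 negb_or c0; have [] := lift_cone f v.
Qed.

Lemma GL_autom_surj (f : autom X) : exists g, GL_autom psiH g = f.
Proof.
pose F := lift_fun f; pose G := lift_fun (autom_inv f).
have FV v : V v -> v != 0 -> V (F v) /\ F v != 0 by move=> _ _; exact: lift_cone.
have GV v : V v -> v != 0 -> V (G v) /\ G v != 0 by move=> _ _; exact: lift_cone.
have [L LU LE] : exists2 L : 'M[K]_7, L \in unitmx &
    forall v, V v -> v != 0 -> exists2 e, e != 0 & v *m L = e *: F v.
  apply: (regular_cone_linear FV GV).
  - by move=> v c Vv v0 c0; exists 1; rewrite ?oner_neq0 // scale1r /G liftZ.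
  - by move=> v Vv v0; apply: lift_cancel => //; exact: autom_funK.
  - exact/lift_regular/autom_fun_regular.
  - exact/lift_regular/autom_inv_regular.
have V0 : V (0 : 'rV[K]_7) by rewrite -(scale0r (e6 K)); apply: VZ; exact: V_nu.
have [||g gU [c c0 gE]] := linear_symM LU.
- move=> v Vv; have [->|v0] := eqVneq v 0; first by rewrite mul0mx.
  by have [e e0 ->] := LE v Vv v0; apply: VZ; have [] := FV v Vv v0.
- move=> v Vv; have [->|v0] := eqVneq v 0; first by rewrite mul0mx.
  have [VG G0] := GV v Vv v0.
  have [e e0 eE] := lift_cancel (autom_invK f) Vv v0; have [d d0 dE] := LE _ VG G0.
  have -> : v *m invmx L = (e^-1 * d^-1) *: G v.
    apply: (can_inj (mulmxK LU)); rewrite mulmxKV // -scalemxAl dE scalerA -mulrA mulVf // mulr1.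
    by rewrite /F eE scalerA mulVf ?scale1r.
  exact: VZ.
(* [GL_fun] acts through the inverse matrix. *)
pose h := (MkGL gU)^-1%g : GL 2 K; exists h; apply: autom_eqP => x /=.
have hE : GL_mx (h^-1)%g = g by rewrite /h invgK.
congr (_ x); apply: (acts_eq psiH (GL_fun_acts psiH h) (c := c)) => // y v Vv v0 yv.
rewrite hE -gE; have [e e0 ->] := LE v Vv v0.
by apply: at_ptZ => //; exact: lift_at.
Qed.

Theorem autom_PGL : isomorphic (autom X) (PGL 2 K).
Proof.
pose phi (x : PGL 2 K) := GL_autom psiH (repr x).
have phiE (g : GL 2 K) : phi (\pi_(PGL 2 K) g) = GL_autom psiH g.
  apply/GL_autom_eq; apply/pi_PGL_eqP; rewrite reprK //.
have phiM : {morph phi : x y / (x * y)%g}.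
  move=> x y; have [g ->] := PGL_piP x; have [h ->] := PGL_piP y.
  rewrite [(_ * _)%g](PGL_mulE g h) !phiE; apply: autom_eqP => z /=.
  by rewrite GL_funM.
have phi_inj : injective phi.
  move=> x y; have [g ->] := PGL_piP x; have [h ->] := PGL_piP y.
  rewrite !phiE => /GL_autom_eq gh; apply/eqP/pi_PGL_eqP; exact: gh.
have phi_surj f : exists x, phi x = f.
  by have [g <-] := GL_autom_surj f; exists (\pi_(PGL 2 K) g); rewrite phiE.
have [psi'' psi''K] := choice phi_surj.
have phiK : cancel phi psi'' by move=> x; apply: phi_inj; rewrite psi''K.
exists psi''; last by exists phi.
by move=> f g; apply: phi_inj; rewrite phiM !psi''K.
Qed.
End Surjective.

Theorem general_section (K : numClosedFieldType) :
  exists2 U : set (grass K ('C(5, 2) - 3) 'C(5, 2)),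
    zariski_open U /\ U !=set0 &
    forall H, U H ->
      isomorphic (autom (linear_section (@plucker_image K 2 5) H)) (PGL 2 K).
Proof.
pose Phi := chart_poly K (@ex_f) ex_c.
exists [set H | Phi.@[fun i => plucker H 0 i] != 0].
  split.
    exists [set Phi]; split=> [p ->|]; first exact: chart_poly_homog.
    by apply/seteqP; split=> [H HP|H [p -> //]]; exists Phi.
  pose B := ex_B K.
  have fr : free [tuple row i B | i < 'C(5, 2) - 3].
    apply/freeP => k E i; have : (\row_j k j) *m B = 0.
      rewrite mulmx_sum_row -[RHS]E; apply: eq_bigr => j _.
      by rewrite mxE -tnth_nth tnth_mktuple.
    move=> /rowP/(_ (ex_f i)); rewrite mxE [RHS]mxE => <-.
    have Bf j : B j (ex_f i) = (j == i)%:R.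
      by have /matrixP/(_ j i) := ex_colsub K; rewrite [LHS]mxE [RHS]mxE.
    rewrite (bigD1 i) //= Bf eqxx mulr1 mxE big1 ?addr0 // => j /negPf ji.
    by rewrite Bf ji mulr0.
  have dU : \dim <<[tuple row i B | i < 'C(5, 2) - 3]>> == ('C(5, 2) - 3)%N.
    by move: fr; rewrite /free size_tuple.
  pose H0 : grass K ('C(5, 2) - 3) 'C(5, 2) := exist _ <<_>>%VS dU.
  exists H0 => /=; have [|G BE] := @grass_mx_factor _ _ _ H0 _ B.
    by move=> i; rewrite memv_span //; apply/tnthP; exists i; rewrite tnth_mktuple.
  have [d hd] := chart_poly_homog K (@ex_f) ex_c.
  (* B and the chosen basis of H0 differ by G, so by homogeneity the two values of [Phi] differ by a
     power of det G. *)
  have := ex_chart K; rewrite -/B BE wedge_mulmx -/(plucker H0) => nz.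
  apply: contra_neq nz => z; have := mpoly_mapZ (\det G) (plucker H0) (fun _ : 'I_1 => hd).
  by move/rowP/(_ 0); rewrite !mxE -/Phi => E; rewrite [LHS]E z mulr0.
by move=> H HU; have [psi psiH] := chart_parametrizes HU; exact: autom_PGL psiH.
Qed.

Theorem theorem7p5 (R : realType) :
  exists2 U : set (grass R[i] ('C(5, 2) - 3) 'C(5, 2)),
    zariski_open U /\ U !=set0 &
    forall H, U H ->
      isomorphic (autom (linear_section (@plucker_image R[i] 2 5) H))
                 (PGL 2 R[i]).
Proof. exact: general_section. Qed.
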